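(* Let $\mathcal{H}$ be a cycle hypergraph. Then $\mathrm{ara}(\mathcal{H}) = \mathrm{triara}(\mathcal{H}) = \mathrm{pd}(\mathcal{H})$. Equivalently: if $K$ is any field, $R=K[x_1,\dots,x_n]$, and $I\subset R$ is a squarefree monomial ideal such that $\mathcal{H}(I)$ is a cycle hypergraph, then $\mathrm{ara}\, I = \mathrm{triara}\, I = \mathrm{pd}\, R/I$.
   Context: Let $R=K[x_1,\dots,x_n]$ be a polynomial ring over a field $K$. For a squarefree monomial ideal $I$ with minimal monomial generators $m_1,\dots,m_\mu$, the associated hypergraph on $[\mu]$ is $\mathcal{H}(I)=\{\{j\in[\mu]: x_i\mid m_j\} : x_i \text{ divides some } m_j\}$ (elements are faces). A vertex $j$ is closed if $\{j\}$ is a face, open otherwise. A hypergraph on $[\mu]$ is a string if $\{j,j+1\}$ is a face for $j=1,\dots,\mu-1$ and all other faces are singletons. For $\mu\ge 3$, a hypergraph $\mathcal{H}$ on $[\mu]$ is a $\mu$-cycle (cycle hypergraph) if $\mathcal{H}=\widetilde{\mathcal{H}}\cup\{\{\mu,1\}\}$ for a string hypergraph $\widetilde{\mathcal{H}}$ on $[\mu]$. $\mathrm{ara}\, I$ is the least $u$ such that some $q_1,\dots,q_u\in R$ satisfy $\sqrt{(q_1,\dots,q_u)}=\sqrt I$; $\mathrm{triara}\, I$ is the same minimum with each $q_i$ required to be a monomial, binomial or trinomial (i.e. to have at most three terms). For $\mathcal{H}=\mathcal{H}(I)$, set $\mathrm{pd}(\mathcal{H}):=\mathrm{pd}\,R/I$,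 $\mathrm{ara}(\mathcal{H}):=\mathrm{ara}\, I$, $\mathrm{triara}(\mathcal{H}):=\mathrm{triara}\, I$; these depend only on $\mathcal{H}$. *)

(* Defs.v *)
From HB Require Import structures.
From mathcomp Require Import all_boot all_order all_algebra.
From mathcomp Require Import mpoly.
Set Implicit Arguments. Unset Strict Implicit. Unset Printing Implicit Defensive.
Import GRing.Theory.
Local Open Scope ring_scope.

Section Defs.
Variables (K : fieldType) (n : nat).
Local Notation R := {mpoly K[n]}.

Definition in_ideal (gs : seq R) (f : R) : Prop :=
  exists cs : seq R, size cs = size gs /\
    f = \sum_(i < size gs) cs`_i * gs`_i.

Definition in_rad (gs : seq R) (f : R) : Prop :=
  exists k : nat, in_ideal gs (f ^+ k).

Definition same_rad (qs gs : seq R) : Prop :=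
  forall f : R, in_rad qs f <-> in_rad gs f.

Definition is_ara (gs : seq R) (u : nat) : Prop :=
  (exists qs : seq R, size qs = u /\ same_rad qs gs) /\
  (forall qs : seq R, same_rad qs gs -> (u <= size qs)%N).

Definition at_most_trinomial (q : R) : bool := (size (msupp q) <= 3)%N.

Definition is_triara (gs : seq R) (u : nat) : Prop :=
  (exists qs : seq R, size qs = u /\ all at_most_trinomial qs /\ same_rad qs gs) /\
  (forall qs : seq R, all at_most_trinomial qs -> same_rad qs gs ->
     (u <= size qs)%N).

(** A finite free resolution of R/(gs):
      ... -> F_2 --d_2--> F_1 --d_1--> F_0 = R -> R/(gs) -> 0,
    with F_i = R^(r i) (row vectors), d_(i+1) given by right multiplication
    by the matrix D i : 'M_(r i.+1, r i). *)
Definition free_res (gs : seq R) (r : nat -> nat)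
    (D : forall i : nat, 'M[R]_(r i.+1, r i)) : Prop :=
  [/\ r 0 = 1%N,
      (forall f : R, (exists v : 'rV[R]_(r 1),
          exists j : 'I_(r 0), (v *m D 0%N) ord0 j = f) <-> in_ideal gs f) &
      (forall (i : nat) (v : 'rV[R]_(r i.+1)),
          v *m D i = 0 <-> exists u : 'rV[R]_(r i.+2), u *m D i.+1 = v)].

Definition is_pd (gs : seq R) (p : nat) : Prop :=
  (exists r D, free_res gs (r := r) D /\ forall i, (p < i)%N -> r i = 0%N) /\
  (forall r D, free_res gs (r := r) D ->
     forall q : nat, (forall i, (q < i)%N -> r i = 0%N) -> (p <= q)%N).

Definition sqf_mon (S : {set 'I_n}) : R := \prod_(i in S) 'X_i.

End Defs.

(** generators m_1..m_mu given by supports g : 'I_mu -> {set 'I_n};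
    they form a minimal generating set iff pairwise non-comparable *)
Definition minimal_sqf_gens (n mu : nat) (g : 'I_mu -> {set 'I_n}) : Prop :=
  forall j k : 'I_mu, j != k -> ~~ (g j \subset g k).

Definition gens_list (K : fieldType) (n mu : nat) (g : 'I_mu -> {set 'I_n})
  : seq {mpoly K[n]} := [seq sqf_mon K (g j) | j <- enum 'I_mu].

Definition hyp_of (n mu : nat) (g : 'I_mu -> {set 'I_n}) : {set {set 'I_mu}} :=
  [set [set j | i \in g j] | i in [set i : 'I_n | [exists j, i \in g j]]].

(** with vertices [mu] written 0..mu-1: the pair {j, j+1} *)
Definition spair (mu j : nat) : {set 'I_mu} :=
  [set k : 'I_mu | (val k == j) || (val k == j.+1)].

(** the closing pair {mu, 1}, i.e. {mu-1, 0} in 0-based indexing *)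
Definition cpair (mu : nat) : {set 'I_mu} :=
  [set k : 'I_mu | (val k == mu.-1) || (val k == 0%N)].

Definition is_string (mu : nat) (H : {set {set 'I_mu}}) : Prop :=
  (forall j : nat, (j.+1 < mu)%N -> spair mu j \in H) /\
  (forall F, F \in H -> #|F| = 1%N \/ exists j : nat, (j.+1 < mu)%N /\ F = spair mu j).

Definition is_cycle (mu : nat) (H : {set {set 'I_mu}}) : Prop :=
  (3 <= mu)%N /\ exists Ht, is_string Ht /\ H = Ht :|: [set cpair mu].

(* Main.v *)
(** Call a generator open if no variable divides it alone; an open generator divides the product of its
    two neighbours on the cycle.  Write the cycle as a, x, l, y.  Let G(w) be the number of open letters
    that a scan of w meets when it skips closed letters and, after an open letter, also skips the next two.
    The common value is p = mu - t with t = min (G (x l y)) (G l + 1).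

    Upper bound for triara: take p suitable sums of at most three generators.  At a common zero, a sum all of
    whose terms but one vanish makes the last one vanish too; and where an open m_i vanishes between two
    neighbours not yet known to vanish, m_(i-1) m_(i+1) = 0 allows branching.
    Upper bound for pd: add the generators by mapping cones, in blocks; a block c, a, b with m_c dividing
    m_a m_b only costs 2.
    Lower bounds: map the generators (for ara) or some variables (for pd) to p letters, and pull back the top
    cochain c of the simplex on these letters.  Then c / x^b is a Čech cocycle of degree p on the generators,
    and would be a coboundary if fewer than p polynomials had the same radical, by comparison with their Čech
    complex; likewise c detects a nonzero class in Tor_p.  Both follow by pairing c with a suitable chain.
    If some vertex is closed or mu is not 1 mod 3, there is a minimal prime of height p, which yields the map
    to letters and a one-simplex chain; otherwise the map identifies vertices in pairs and the chain is
    explicit. *)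

Require Import Defs.
From HB Require Import structures.
From mathcomp Require Import all_boot all_order all_algebra.
From mathcomp Require Import mpoly.
From mathcomp Require Import zify ring.
Set Implicit Arguments. Unset Strict Implicit. Unset Printing Implicit Defensive.
Import GRing.Theory.

(** * Saving polynomials on a cyclic word *)

Section Words.
Variables (T : finType).
Implicit Types (O Z r : {set T}) (s : seq T) (rows : seq {set T}).

(** The minimum [t] has the shape of the mapping cone for m_a. Without m_a, the open vertex y has
    lost a neighbour, so x l y saves only G(l) and needs mu - 1 - G(l) degrees. In the colon ideal
    by m_a, the end letters x and y need one neighbour only; it saves G(x l y), and the cone shifts
    its mu - 1 - G(x l y) by one.

    For the radical, the cycle grows from a loop of two letters by inserting one letter with one
    row, or three letters with two rows. A single scan yields only G(l y) or G(x l), according to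
    the starting point; both can fall one short of [t], and then two scans must be interlaced.

    If no vertex is closed, a minimal prime cuts the cycle into stretches of two or three vertices,
    each costing one variable less than its length. For mu = 3k + 1 there are at least k + 1
    stretches, so every minimal prime has height at most 2k, whereas p = 2k + 1. Hence no prime can
    give the lower bound there, and the single simplex gives way to a chain whose boundary terms
    cancel. *)

Definition rows_closed rows Z := all (fun r => #|r :\: Z| != 1%N) rows.

Definition isolated O s Z := exists s1 y i z s2,
  [/\ s = s1 ++ y :: i :: z :: s2, i \in O, i \in Z, y \notin Z & z \notin Z].

(* Z stands for the generators already known to lie in the ideal: a row meeting the complement of Z in one
   element enlarges Z, and an isolated open vertex i, where m_i divides m_y m_z, allows branching on
   m_y = 0 or m_z = 0. *)
Definition row_system O s rows :=
  forall Z, rows_closed rows Z -> ~~ all (mem Z) s -> isolated O s Z.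

Definition infix3 (y i z : T) s := exists s1 s2, s = s1 ++ [:: y, i, z & s2].

Lemma infix3_cons x y i z s : infix3 y i z s -> infix3 y i z (x :: s).
Proof. by move=> [s1 [s2 ->]]; exists (x :: s1), s2. Qed.

Lemma infix3_cat s0 y i z s : infix3 y i z s -> infix3 y i z (s0 ++ s).
Proof. by move=> [s1 [s2 ->]]; exists (s0 ++ s1), s2; rewrite catA. Qed.

(** A window of three letters survives the insertion unless it straddles the gap between [u] and
    [w]; the last two cases are what an insertion has to repair. *)
Lemma infix3_insert y i z s1 u m w s2 :
  infix3 y i z (s1 ++ u :: w :: s2) ->
  [\/ infix3 y i z (s1 ++ u :: m ++ w :: s2),
      [/\ i = u, z = w & exists s1', s1 = s1' ++ [:: y]] |
      [/\ y = u, i = w & exists s2', s2 = z :: s2']].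
Proof.
elim: s1 => [|x s1 IH] [[|x' a1] [a2 /=]].
- by case=> -> -> ->; constructor 3; split=> //; exists a2.
- case=> _ E; constructor 1; apply/infix3_cons/infix3_cat.
  by exists a1, a2.
- case=> ->; case: s1 IH => [|b1 [|b2 s1]] IH /=.
  + by case=> -> -> _; constructor 2; split=> //; exists [::].
  + by case=> -> -> _; constructor 1; exists [::]; eexists.
  + by case=> -> -> _; constructor 1; exists [::]; eexists.
- case=> _ E; case: IH; first by exists a1, a2.
  + by move=> H; constructor 1; apply: infix3_cons.
  + by move=> [-> -> [s1' ->]]; constructor 2; split=> //; exists (x :: s1').
  + by move=> [-> -> [s2' ->]]; constructor 3; split=> //; exists s2'.
Qed.

Lemma isolatedP O s Z : isolated O s Z <->
  exists y i z, [/\ infix3 y i z s, i \in O, i \in Z, y \notin Z & z \notin Z].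
Proof.
split=> [[s1 [y [i [z [s2 [-> ? ? ? ?]]]]]]|[y [i [z [[s1 [s2 ->]] ? ? ? ?]]]]].
  by exists y, i, z; split=> //; exists s1, s2.
by exists s1, y, i, z, s2.
Qed.

(* The vertices are those of a cycle, listed by s with its end point repeated. *)
Definition saves O s (t : nat) := exists rows,
  [/\ (size rows + t = #|s|)%N, all (fun r => #|r| <= 3)%N rows,
      forall r x, r \in rows -> x \in r -> x \in s & row_system O s rows].

Lemma isolated_mono O O' s Z : O \subset O' -> isolated O s Z -> isolated O' s Z.
Proof.
move=> /subsetP OO /isolatedP [y [i [z [H1 iO H2 H3 H4]]]]; apply/isolatedP.
by exists y, i, z; split=> //; apply: OO.
Qed.

Lemma saves_mono O O' s t : O \subset O' -> saves O s t -> saves O' s t.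
Proof.
move=> OO [rows [H1 H2 H3 H4]]; exists rows; split=> // Z Zc /(H4 _ Zc).
exact: isolated_mono.
Qed.

Lemma saves_leq O s t t' : (t' <= t)%N -> saves O s t -> saves O s t'.
Proof.
move=> tt [rows [H1 H2 H3 H4]]; exists (nseq (t - t') set0 ++ rows); split.
- by rewrite size_cat size_nseq -H1; lia.
- by rewrite all_cat H2 andbT; apply/allP => r /nseqP [-> _]; rewrite cards0.
- move=> r x; rewrite mem_cat => /orP [/nseqP [-> _]|]; last exact: H3.
  by rewrite inE.
- by move=> Z; rewrite /rows_closed all_cat => /andP [_]; apply: H4.
Qed.

Lemma rows_closed_cons r rows Z : rows_closed (r :: rows) Z = (#|r :\: Z| != 1%N) && rows_closed rows Z.
Proof. by []. Qed.

Lemma setD_one (r Z : {set T}) x :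
  x \in r -> x \notin Z -> (forall y, y \in r -> y != x -> y \in Z) -> #|r :\: Z| == 1%N.
Proof.
move=> xr xZ H; apply/cards1P; exists x; apply/setP => y; rewrite !inE.
case: (eqVneq y x) => [->|yx]; first by rewrite xZ xr.
by apply/negP => /andP [yZ yr]; rewrite (H _ yr yx) in yZ.
Qed.

Lemma card_cons x s s' : x \notin s -> s' =i x :: s -> #|s'| = #|s|.+1.
Proof. by move=> xs E; rewrite (eq_card E) (cardU1 x (mem s)) xs. Qed.

Lemma cards3_leq (x y z : T) : #|[set x; y; z]| <= 3.
Proof.
rewrite -setUA cardsU1 cards2; case: (x \notin _); by case: (y != z).
Qed.

(** The new row consists of [x], [u] and [w]. If the gap splits an isolated triple, exactly one of
    [u] and [w] lies in [Z]; closedness then keeps [x] outside [Z], and [x] replaces the lost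
    neighbour. *)
Lemma saves_insert1 O s1 u x w s2 t : x \notin s1 ++ u :: w :: s2 ->
  saves O (s1 ++ u :: w :: s2) t -> saves O (s1 ++ u :: x :: w :: s2) t.
Proof.
set s := s1 ++ _ => xs [rows [H1 H2 H3 H4]].
have Es : s1 ++ u :: x :: w :: s2 =i x :: s.
  by move=> y; rewrite /s !(mem_cat, inE); do !case: (_ == _); rewrite ?orbT.
exists ([set x; u; w] :: rows); split=> /=.
- by rewrite (card_cons xs Es) -H1.
- by rewrite H2 andbT cards3_leq.
- move=> r y; rewrite !inE => /orP [/eqP ->|rr yr]; last by rewrite Es inE (H3 r) ?orbT.
  by rewrite !inE Es inE /s mem_cat !inE => /orP [/orP [->|->]|->]; rewrite ?orbT.
- move=> Z; rewrite rows_closed_cons => /andP [Zr Zc] nall.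
  have us : u \in s by rewrite mem_cat !inE eqxx orbT.
  have ws : w \in s by rewrite mem_cat !inE eqxx !orbT.
  have nx y : y \in s -> y != x by apply: contraTneq => ->.
  have H y : y \in [set x; u; w] -> y \notin Z ->
      (forall y', y' \in [set x; u; w] -> y' != y -> y' \in Z) -> False.
    by move=> h1 h2 h3; move: Zr; rewrite (setD_one h1 h2 h3).
  case: (boolP (all (mem Z) s)) => [/allP sZ|/(H4 _ Zc) /isolatedP [y [i [z [Hi iO iZ yZ zZ]]]]].
    case/negP: nall; apply/allP => y; rewrite Es inE => /orP [/eqP ->|/sZ //].
    apply: contraT => xZ; exfalso; apply: (H x) => // [|y']; first by rewrite !inE eqxx.
    by rewrite !inE => /orP [/orP [->//|/eqP -> _]|/eqP -> _]; apply: sZ.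
  apply/isolatedP; case: (infix3_insert [:: x] Hi) => [H'|[Eu Ew [s1' E1]]|[Eu Ew [s2' E2]]].
  + by exists y, i, z.
  + subst i z; exists y, u, x; split=> //; first by rewrite E1; exists s1'; eexists; rewrite -catA.
    apply: contraT; rewrite negbK => xZ; exfalso; apply: (H w) => // [|y'].
      by rewrite !inE eqxx orbT.
    by rewrite !inE => /orP [/orP [/eqP -> //|/eqP -> //]|->].
  + subst i y; exists x, w, z; split=> //; first by rewrite E2; exists (s1 ++ [:: u]); eexists; rewrite -catA.
    apply: contraT; rewrite negbK => xZ; exfalso; apply: (H u) => // [|y'].
      by rewrite !inE eqxx orbT.
    by rewrite !inE => /orP [/orP [/eqP -> //|->]|/eqP -> //].
Qed.

(** The row of [c], [c'] makes these two enter [Z] together; the row of [q], [u], [w] forces [q]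
    into [Z] once all old letters are there, and then [q] is isolated. If an isolated triple is
    split, either [c] and [c'] are outside [Z] and one of them replaces the lost neighbour, or both
    are in [Z] and the one next to the lost neighbour is isolated between it and [q]. The conditions
    on [u] and [w] make that letter open. *)
Lemma saves_insert3 O1 O2 s1 u c q c' w s2 t :
  uniq [:: c; q; c'] ->
  (forall x, x \in [:: c; q; c'] -> x \notin s1 ++ u :: w :: s2) ->
  O1 \subset O2 -> q \in O2 -> (u \in O1 -> c' \in O2) -> (w \in O1 -> c \in O2) ->
  saves O1 (s1 ++ u :: w :: s2) t ->
  saves O2 (s1 ++ [:: u, c, q, c', w & s2]) t.+1.
Proof.
set s := s1 ++ _; rewrite /= !inE !negb_or !andbT.
move=> /andP [/andP [cq cc'] qc'] Hs OO qO uO wO [rows [H1 H2 H3 H4]].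
have [cs qs c's] : [/\ c \notin s, q \notin s & c' \notin s].
  by split; apply: Hs; rewrite !inE eqxx ?orbT.
have Es : s1 ++ [:: u, c, q, c', w & s2] =i [:: c, q, c' & s].
  by move=> y; rewrite /s !(mem_cat, inE); do !case: (_ == _); rewrite ?orbT.
have us : u \in s by rewrite mem_cat !inE eqxx orbT.
have ws : w \in s by rewrite mem_cat !inE eqxx !orbT.
exists ([set c; c'] :: [set q; u; w] :: rows); split=> /=.
- rewrite (@card_cons c [:: q, c' & s]) // ?inE ?negb_or ?cq ?cc' //.
  rewrite (@card_cons q [:: c' & s]) // ?inE ?negb_or ?qc' //.
  by rewrite (@card_cons c' s) // -H1 !addSn addnS.
- by rewrite H2 cards3_leq cards2; case: (_ != _).
- move=> r y; rewrite !inE => /or3P [/eqP ->|/eqP ->|rr yr]; last by rewrite Es !inE (H3 r) ?orbT.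
    by rewrite !inE Es !inE => /orP [->|->]; rewrite ?orbT.
  by rewrite !inE Es !inE => /orP [/orP [->|/eqP ->]|/eqP ->]; rewrite ?us ?ws ?orbT.
- move=> Z; rewrite !rows_closed_cons => /and3P [Z1 Z2 Zc] nall.
  have Hr r y : #|r :\: Z| != 1 -> y \in r -> y \notin Z ->
      (forall y', y' \in r -> y' != y -> y' \in Z) -> False.
    by move=> h0 h1 h2 h3; move: h0; rewrite (setD_one h1 h2 h3).
  have Hcc : (c \in Z) = (c' \in Z).
    apply/idP/idP => h; apply: contraT => h'; exfalso.
      apply: (Hr _ c' Z1) => // [|y]; first by rewrite !inE eqxx orbT.
      by rewrite !inE => /orP [/eqP -> //|->].
    apply: (Hr _ c Z1) => // [|y]; first by rewrite !inE eqxx.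
    by rewrite !inE => /orP [->|/eqP -> //].
  apply/isolatedP; case: (boolP (all (mem Z) s)) => [/allP sZ|/(H4 _ Zc) /isolatedP [y [i [z [Hi iO iZ yZ zZ]]]]].
    have qZ : q \in Z.
      apply: contraT => qZ; exfalso; apply: (Hr _ q Z2) => // [|y]; first by rewrite !inE eqxx.
      by rewrite !inE => /orP [/orP [->//|/eqP -> _]|/eqP -> _]; apply: sZ.
    have cZ : c \notin Z.
      apply: contra nall => cZ; apply/allP => y; rewrite Es !inE.
      by move=> /or4P [/eqP ->|/eqP ->|/eqP ->|/sZ //] //; rewrite /= -Hcc.
    exists c, q, c'; split=> //; last by rewrite -Hcc.
    by exists (s1 ++ [:: u]); eexists; rewrite -catA.
  have iO2 := subsetP OO _ iO.
  case: (infix3_insert [:: c; q; c'] Hi) => [H'|[Eu Ew [s1' E1]]|[Eu Ew [s2' E2]]].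
  + by exists y, i, z.
  + subst i z; case: (boolP (c \in Z)) => cZ; last first.
      exists y, u, c; split=> //; rewrite E1; exists s1'; eexists; by rewrite -catA.
    exists q, c', w; split=> //; [|exact: uO|by rewrite -Hcc|].
      exists (s1 ++ [:: u; c]); eexists; by rewrite -catA.
    apply: contraT; rewrite negbK => qZ; exfalso; apply: (Hr _ w Z2) => // [|y'].
      by rewrite !inE eqxx orbT.
    by rewrite !inE => /orP [/orP [/eqP -> //|/eqP -> //]|->].
  + subst i y; case: (boolP (c \in Z)) => cZ; last first.
      exists c', w, z; split=> //; last by rewrite -Hcc.
      rewrite E2; exists (s1 ++ [:: u; c; q]); eexists; by rewrite -catA.
    exists u, c, q; split=> //; [|exact: wO|].
      exists s1; eexists; by [].
    apply: contraT; rewrite negbK => qZ; exfalso; apply: (Hr _ u Z2) => // [|y'].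
      by rewrite !inE eqxx orbT.
    by rewrite !inE => /orP [/orP [/eqP -> //|->]|/eqP -> //].
Qed.

Lemma card_loop (z v : T) : z != v -> #|[:: z; v; z]| = 2.
Proof.
move=> zv; have -> : #|[:: z; v; z]| = #|[:: z; v]|.
  by apply: eq_card => x; rewrite !inE; do !case: (_ == _).
have U : uniq [:: z; v] by rewrite /= inE zv.
by rewrite (card_uniqP U).
Qed.

Lemma saves_loop z v : z != v -> saves set0 [:: z; v; z] 0.
Proof.
move=> zv; exists [:: [set z]; [set v]]; split=> /=.
- by rewrite card_loop.
- by rewrite !cards1.
- by move=> r x; rewrite !inE => /orP [] /eqP ->; rewrite !inE => ->; rewrite ?orbT.
- move=> Z; rewrite !rows_closed_cons => /and3P [zZ vZ _] /=.
  have H x : #|[set x] :\: Z| != 1 -> x \in Z.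
    by apply: contraR => xZ; apply: setD_one xZ _ => [|y]; rewrite inE // => ->.
  by rewrite !H.
Qed.

(** In the degenerate cycle of two letters, [p] has [z] on both sides and is isolated as soon as [z]
    is outside [Z]. *)
Lemma saves_single z p : z != p -> saves [set p] [:: z; p; z] 1.
Proof.
move=> zp; exists [:: [set p]]; split=> /=.
- by rewrite card_loop.
- by rewrite cards1.
- by move=> r x; rewrite !inE => /eqP ->; rewrite !inE => ->; rewrite ?orbT.
- move=> Z; rewrite !rows_closed_cons => /andP [pZ _] /= nall; apply/isolatedP.
  have {}pZ : p \in Z.
    by apply: contraR pZ => xZ; apply: setD_one xZ _ => [|y]; rewrite inE // => ->.
  have zZ : z \notin Z by apply: contra nall => ->; rewrite pZ.
  by exists z, p, z; split; rewrite ?inE //; exists [::], [::].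
Qed.

Fixpoint greedy O (m : seq T) : nat :=
  if m is x :: m1 then
    if x \in O then (if m1 is [:: _, _ & m3] then greedy O m3 else 0).+1 else greedy O m1
  else 0.

Lemma greedy_drop O x m : greedy O (x :: m) =
  if x \in O then (greedy O (drop 2 m)).+1 else greedy O m.
Proof. by case: m => [|a [|b m]] //=; rewrite drop0. Qed.

(** Counting only letters of [m] as open turns [z] and [v] into closed ends of the gap, so the side
    conditions of [saves_insert3] hold. An open letter uses up its two successors: one becomes [c'],
    the other the next [v]. This is why the scan skips two. *)
Lemma saves_pack O z v m : uniq (z :: v :: m) ->
  saves (O :&: [set x in m]) (z :: v :: rcons m z) (greedy O m).
Proof.
have [k] := ubnP (size m); elim: k m v => // k IH m v; rewrite ltnS => sz.
case: m sz => [|x m] sz U.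
  have -> : O :&: [set x in [::]] = set0 by apply/setP => x; rewrite !inE andbF.
  by apply: saves_loop; move: U => /=; rewrite inE => /andP [].
rewrite greedy_drop; case: ifP => xO; last first.
  move: U => /= /and4P [h1 h2 h3 h4]; move: h1 h2; rewrite !inE !negb_or => /and3P [zv zx zm] /andP [vx vm].
  apply: (@saves_insert1 _ [::] z v x (rcons m z)).
    by rewrite /= !inE mem_rcons inE !negb_or vx vm eq_sym zv.
  apply: (saves_mono _ (IH m x _ _)) => //; last by rewrite /= inE negb_or zx zm h3.
  by apply/setIS/subsetP => y; rewrite !inE => ->; rewrite orbT.
case: m sz U => [|x' [|v' m]] sz U.
- move: U; rewrite /= !inE !negb_or => /and3P [/andP [zv zx] vx _].
  apply: (@saves_insert1 _ [::] z v x [:: z]).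
    by rewrite /= !inE !negb_or vx eq_sym zv.
  apply: (saves_mono _ (saves_single zx)); apply/subsetP => y; rewrite !inE => /eqP ->.
  by rewrite xO eqxx.
- move: U; rewrite /= !inE !negb_or => /and4P [/and3P [zv zx zx'] /andP [vx vx'] xx' _] /=.
  apply: (@saves_insert1 _ [::] z v x [:: x'; z]).
    by rewrite /= !inE !negb_or vx eq_sym zv vx'.
  apply: (@saves_insert1 _ [:: z] x x' z [::]).
    by rewrite /= !inE !negb_or eq_sym zx' eq_sym xx'.
  apply: (saves_mono _ (saves_single zx)); apply/subsetP => y; rewrite !inE => /eqP ->.
  by rewrite xO eqxx.
- rewrite [drop _ _]/= drop0.
  have U1 : uniq [:: z, v' & m].
    move: U => /=; rewrite !inE !negb_or => /and3P [/and4P [_ _ _ /andP [-> ->]] _ /and3P [_ _ /andP [-> ->]]].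
    by [].
  have H := IH m v' _ U1.
  apply: (@saves_insert3 (O :&: [set x in m]) _ [::] z v x x' v' (rcons m z)).
  + by move: U => /=; rewrite !inE !negb_or => /and4P [_ /and3P [-> -> _] /andP [-> _] _].
  + move=> y; rewrite !inE !mem_rcons !inE !negb_or; move: U; rewrite /= !inE !negb_or.
    move=> /and4P [/and5P [zv zx zx' zv' zm] /and4P [vx vx' vv' vm] /and3P [xx' xv' xm] /andP [/andP [x'v' x'm] _]].
    by move=> /or3P [] /eqP ->; rewrite !(eq_sym _ z) ?zv ?zx ?zx' ?vv' ?vm ?xv' ?xm ?x'v' ?x'm.
  + by apply/setIS/subsetP => y; rewrite !inE => ->; rewrite !orbT.
  + by rewrite !inE xO eqxx.
  + rewrite !inE => /andP [_ zm]; move: U => /=; rewrite !inE !negb_or.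
    by move=> /andP [/and5P [_ _ _ _]]; rewrite zm.
  + rewrite !inE => /andP [_ zm]; move: U1 => /=; rewrite !inE !negb_or.
    by rewrite zm andbF.
  + by apply: H; move: sz => /=; lia.
Qed.


Lemma eq_in_greedy O O' m : {in m, O =i O'} -> greedy O m = greedy O' m.
Proof.
have [k] := ubnP (size m); elim: k m => // k IH [|x m] //; rewrite ltnS => sz E.
rewrite !greedy_drop E ?mem_head // !IH //.
- by move=> y ym; apply: E; rewrite inE ym orbT.
- by rewrite size_drop; move: sz => /=; lia.
- by move=> y /mem_drop ym; apply: E; rewrite inE ym orbT.
Qed.

Lemma drop1_cons (b : T) m : drop 1 (b :: m) = m.
Proof. by rewrite /= drop0. Qed.

Lemma drop2_cons (b c : T) m : drop 2 [:: b, c & m] = m.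
Proof. by rewrite /= drop0. Qed.

Lemma greedy_D1 O w m : w \notin m -> greedy (O :\ w) m = greedy O m.
Proof.
move=> wm; apply: eq_in_greedy => x xm; rewrite inE in_set1.
by case: eqP xm wm => // -> ->.
Qed.

Ltac uniq_solve U :=
  let V := fresh in
  move: (U) => V; rewrite ?cat0s ?cat_cons ?rcons_cons ?cons_uniq ?rcons_uniq in V *;
  rewrite ?(in_cons, mem_rcons) ?in_nil ?orbF ?negb_or ?andbT in V *;
  repeat match goal with H : is_true (_ && _) |- _ => case/andP: H => ? ? end;
  repeat (apply/andP; split); (done || by rewrite eq_sym).

Ltac notin_solve U := let y := fresh in let H := fresh in
  move=> y H; rewrite !in_cons in_nil orbF in H; case/or3P: H => /eqP ->; uniq_solve U.

(* The two greedy selections, from the first letter and from the second,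
   interlace into an odd number of open vertices; the recursion peels off two of them at a time. *)
Lemma saves_gap O a x l y k : uniq (a :: x :: rcons l y) -> a \notin O ->
  x \in O -> y \in O -> greedy O (x :: rcons l y) = k.+1 -> greedy O (x :: l) = k ->
  greedy O l = k -> greedy O (rcons l y) = k ->
  saves O [:: a, x & rcons (rcons l y) a] k.+1.
Proof.
have [N] := ubnP (size l); elim: N O x l k => // N IH O x l k; rewrite ltnS => sz U aO xO yO.
case: l sz U => [|q l1] sz U; first by rewrite /= xO => _ <-.
case: (boolP (q \in O)) => qO.
  case: l1 sz U => [|c' rest] sz U; first by rewrite /= xO => - [<-].
  rewrite !rcons_cons !greedy_drop xO qO !drop2_cons /= => -[g1] g2 g3 g4.
  case: rest sz U g1 g2 g3 g4 => [|x' r] sz U.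
    rewrite /= yO => <- _ _ _.
    apply: (@saves_insert3 [set y] _ [::] a x q c' y [:: a]) => //.
    + by uniq_solve U.
    + by notin_solve U.
    + by rewrite sub1set.
    + have ay : a != y by uniq_solve U.
      by rewrite inE (negbTE ay).
    + by apply: (@saves_single a y); uniq_solve U.
  rewrite rcons_cons !drop1_cons; case: k => // k g1 [g2] [g3] [g4].
  have x'O : x' \in O.
    by apply: contraT => x'O; move: g1; rewrite greedy_drop (negbTE x'O) g4 => /n_Sn.
  apply: (@saves_insert3 O _ [::] a x q c' x' (rcons (rcons r y) a)) => //.
  - by uniq_solve U.
  - by notin_solve U.
  - by rewrite (negbTE aO).
  - by apply: IH => //; [move: sz => /=; lia | uniq_solve U].
case: l1 sz U => [|h r] sz U; first by rewrite /= xO (negbTE qO) => _ <-.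
rewrite !rcons_cons [greedy O (x :: _)]greedy_drop [greedy O (x :: _ :: _)]greedy_drop xO.
rewrite ![greedy O (q :: _)]greedy_drop (negbTE qO) !drop2_cons => -[g1] g2.
case: (boolP (h \in O)) => hO; last first.
  by rewrite !greedy_drop (negbTE hO) => g3; move: g2; rewrite g3 => /esym /n_Sn.
case: r sz U g1 g2 => [|j r] sz U.
  move=> _ /= <- _ _.
  apply: (@saves_insert3 [set x] _ [:: a] x q h y a [::]) => //.
  - by uniq_solve U.
  - by notin_solve U.
  - by rewrite sub1set.
  - by move: U => /=; rewrite !inE negb_or => /andP [/andP [/negbTE ->]].
  - by apply: (@saves_single a x); uniq_solve U.
case: (boolP (j \in O)) => jO; last first.
  (* Deleting [q] does not change the scan from [x]: it then skips [h] and the closed [j] instead of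
     [q] and [h]. *)
  rewrite rcons_cons !greedy_drop hO (negbTE jO) => g1 g2 g3 g4.
  apply: (@saves_insert1 _ [:: a] x q h (rcons (rcons (j :: r) y) a)).
    by uniq_solve U.
  apply: (IH O x [:: h, j & r]) => //.
  - by uniq_solve U.
  - by rewrite rcons_cons greedy_drop xO /= drop0 g1.
  - by rewrite greedy_drop xO /= drop0.
  - by rewrite greedy_drop hO.
  - by rewrite !rcons_cons greedy_drop hO.
case: r sz U => [|w r] sz U; first by rewrite /= jO => <-.
rewrite !rcons_cons ![greedy O (h :: _)]greedy_drop ![greedy O (j :: _)]greedy_drop hO jO.
rewrite ?drop2_cons; case: k => // k [g1] [g2] [g3] [g4].
(* [w] counts as closed in the shorter word: an open [w] would require the first inserted letter [q]
   to be open. *)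
apply: (@saves_insert3 (O :\ w) _ [:: a] x q h j w (rcons (rcons r y) a)) => //.
- by uniq_solve U.
- by notin_solve U.
- exact: subsetDl.
- by rewrite !inE eqxx.
- have w1 : w \notin r by uniq_solve U.
  have w2 : w \notin rcons r y by uniq_solve U.
  have wx : x != w by uniq_solve U.
  have wy : y != w by uniq_solve U.
  have wa : a != w by uniq_solve U.
  have Dr s : w \notin s -> greedy (O :\ w) (drop 1 s) = greedy O (drop 1 s).
    by move=> ws; apply: greedy_D1; apply: contra ws => /mem_drop.
  apply: (IH (O :\ w) x (w :: r)) => //.
  + by move: sz => /=; lia.
  + by uniq_solve U.
  + by rewrite inE (negbTE aO) andbF.
  + by rewrite !inE wx.
  + by rewrite !inE wy.
  + by rewrite rcons_cons greedy_drop !inE wx xO (_ : drop 2 (w :: rcons r y) = drop 1 (rcons r y)) // Dr // g1.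
  + by rewrite greedy_drop !inE wx xO (_ : drop 2 (w :: r) = drop 1 r) // Dr // g2.
  + by rewrite greedy_drop setD11 greedy_D1.
  + by rewrite rcons_cons greedy_drop setD11 greedy_D1.
Qed.

(** After an open letter the scan resumes three letters further on, so scans started at most three
    letters apart never differ by more than one. *)
Lemma greedy_drop_bounds O m k : k <= 3 ->
  greedy O (drop k m) <= greedy O m <= (greedy O (drop k m)).+1.
Proof.
have [N] := ubnP (size m); elim: N m k => // N IH [|b m] [|k]; rewrite ?drop0 ?leqnn ?leqnSn //.
rewrite !ltnS => sz k2; rewrite [drop _ _]/= greedy_drop; case: ifP => _.
  have : greedy O (drop (2 - k) (drop k m)) <= greedy O (drop k m)
         <= (greedy O (drop (2 - k) (drop k m))).+1.
    apply: IH; first by rewrite size_drop; apply: leq_ltn_trans sz; apply: leq_subr.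
    by apply: leq_trans (leq_subr _ _) _.
  by rewrite drop_drop subnK // ltnS => /andP [h1 h2]; rewrite h2 (leq_trans h1).
by apply: IH => //; apply: leq_trans k2 _.
Qed.

(** Packing from the pair [a], [x] saves G(l y), from the pair [y], [a] it saves G(x l). If both are
    below [t], the bounds for one added letter force the four equalities of [saves_gap]. *)
Lemma saves_cycle O a x l y : uniq (a :: x :: rcons l y) ->
  exists z v m, [/\ uniq (z :: v :: m), z :: v :: m =i a :: x :: rcons l y,
    next (z :: v :: m) =1 next (a :: x :: rcons l y) &
    saves O (z :: v :: rcons m z) (minn (greedy O (x :: rcons l y)) (greedy O l).+1)].
Proof.
move=> U; set t := minn _ _.
have Ea : saves O (a :: x :: rcons (rcons l y) a) t -> exists z v m, [/\ uniq (z :: v :: m),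
    z :: v :: m =i a :: x :: rcons l y, next (z :: v :: m) =1 next (a :: x :: rcons l y) &
    saves O (z :: v :: rcons m z) t].
  by move=> V; exists a, x, (rcons l y).
have Va : t <= greedy O (rcons l y) -> saves O (a :: x :: rcons (rcons l y) a) t.
  move=> tle; apply: saves_leq tle _; apply: saves_mono (saves_pack _ U); exact: subsetIl.
case: (boolP (x \in O)) => xO; last first.
  by apply/Ea/Va; rewrite /t greedy_drop (negbTE xO) geq_minl.
case: (leqP t (greedy O (x :: l))) => tx.
  have U' : uniq (y :: a :: x :: l) by rewrite -(rot_uniq 1) rot1_cons.
  exists y, a, (x :: l); split=> //.
  - by move=> u; rewrite -(mem_rot 1 (y :: _)) rot1_cons.
  - by move=> u; rewrite -(next_rot 1 U') rot1_cons.
  - apply: saves_leq tx _; apply: saves_mono (saves_pack _ U'); exact: subsetIl.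
case: (leqP t (greedy O (rcons l y))) => ty; first exact/Ea/Va.
apply: Ea.
have G1 m : greedy O m <= greedy O (rcons m y) <= (greedy O m).+1 /\
            (y \notin O -> greedy O (rcons m y) = greedy O m).
  have [N] := ubnP (size m); elim: N m => // N IH m; rewrite ltnS => sz.
  case: m sz => [|b m] sz; first by rewrite /=; case: (y \in O).
  rewrite rcons_cons !greedy_drop; case: (b \in O); last by apply: IH.
  case: m sz => [|c [|d m]] sz; rewrite /= ?drop0 //.
  by have [] := IH m ltac:(move: sz => /=; lia); rewrite !ltnS => -> H; split=> // /H ->.
have G2 m : greedy O m <= greedy O (x :: m) <= (greedy O m).+1.
  by have := greedy_drop_bounds O (x :: m) (isT : 1 <= 3); rewrite drop1_cons.
have [/andP [h1 h2] h3] := G1 (x :: l); have [/andP [h4 h5] _] := G1 l.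
have /andP [h6 h7] := G2 l; have /andP [h8 h9] := G2 (rcons l y).
have tE : t = minn (greedy O (x :: rcons l y)) (greedy O l).+1 by [].
move: h1 h2 h3; rewrite rcons_cons => h1 h2 h3.
have yO : y \in O by apply: contraT => /h3 E; move: tE tx; rewrite E; lia.
have al : a \notin l by move: U; rewrite /= !inE mem_rcons inE !negb_or => /andP [/and3P [_ _ ->]].
have ax : x != a by move: U; rewrite /= !inE negb_or eq_sym => /andP [/andP [->]].
have ay : y != a by move: U; rewrite /= !inE mem_rcons inE !negb_or eq_sym (eq_sym a y) => /andP [/and3P [_ ->]].
have tk : t = (greedy O (x :: l)).+1 by lia.
rewrite tk; apply: (@saves_mono (O :\ a)); first exact: subsetDl.
apply: saves_gap => //.
- by rewrite !inE eqxx.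
- by rewrite !inE ax.
- by rewrite !inE ay.
- rewrite greedy_D1; last by move: U => /andP [].
  by lia.
- by rewrite greedy_D1 // inE negb_or al eq_sym ax.
- by rewrite greedy_D1 //; lia.
- by rewrite greedy_D1 ?mem_rcons ?inE ?negb_or ?al ?(eq_sym a) ?ay //; lia.
Qed.

End Words.

Local Open Scope ring_scope.

(** * Ideals and radicals *)

Section Ideals.
Variables (K : fieldType) (n : nat).
Local Notation R := {mpoly K[n]}.
Implicit Types (f g h : R) (gs hs : seq R).

Lemma in_ideal_nil f : in_ideal [::] f <-> f = 0.
Proof.
split=> [[cs [_ ->]]|->]; first by rewrite big_ord0.
by exists [::]; rewrite big_ord0.
Qed.

Lemma in_ideal_cons g gs f :
  in_ideal (g :: gs) f <-> exists c h, f = c * g + h /\ in_ideal gs h.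
Proof.
split=> [[[|c cs] [] // [sz] ->]|[c [h [-> [cs [sz ->]]]]]].
  exists c, (\sum_(i < size gs) cs`_i * gs`_i); split; last by exists cs.
  by rewrite big_ord_recl.
by exists (c :: cs); rewrite /= sz; split=> //; rewrite big_ord_recl.
Qed.

Lemma in_ideal0 gs : in_ideal gs 0.
Proof.
elim: gs => [|g gs IH]; first exact/in_ideal_nil.
by apply/in_ideal_cons; exists 0, 0; rewrite mul0r addr0.
Qed.

Lemma in_idealD gs f g : in_ideal gs f -> in_ideal gs g -> in_ideal gs (f + g).
Proof.
elim: gs f g => [|a gs IH] f g; first by move=> /in_ideal_nil -> /in_ideal_nil ->; rewrite addr0; apply/in_ideal_nil.
move=> /in_ideal_cons [c [h [-> Hh]]] /in_ideal_cons [c' [h' [-> Hh']]].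
by apply/in_ideal_cons; exists (c + c'), (h + h'); split; [rewrite mulrDl addrACA | apply: IH].
Qed.

Lemma in_idealM gs f g : in_ideal gs g -> in_ideal gs (f * g).
Proof.
elim: gs g => [|a gs IH] g; first by move=> /in_ideal_nil ->; rewrite mulr0; apply/in_ideal_nil.
move=> /in_ideal_cons [c [h [-> Hh]]].
by apply/in_ideal_cons; exists (f * c), (f * h); split; [rewrite mulrDr mulrA | apply: IH].
Qed.

Lemma in_idealMr gs f g : in_ideal gs g -> in_ideal gs (g * f).
Proof. by rewrite mulrC; apply: in_idealM. Qed.

Lemma in_idealN gs f : in_ideal gs f -> in_ideal gs (- f).
Proof. by rewrite -mulN1r; apply: in_idealM. Qed.

Lemma in_idealB gs f g : in_ideal gs f -> in_ideal gs g -> in_ideal gs (f - g).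
Proof. by move=> Hf /in_idealN; apply: in_idealD. Qed.

Lemma in_ideal_sum (I : Type) (r : seq I) (P : pred I) (F : I -> R) gs :
  (forall i, P i -> in_ideal gs (F i)) -> in_ideal gs (\sum_(i <- r | P i) F i).
Proof. by move=> H; apply: big_ind => //; [apply: in_ideal0 | apply: in_idealD]. Qed.

Lemma mem_in_ideal gs g : g \in gs -> in_ideal gs g.
Proof.
elim: gs => // a gs IH; rewrite inE => /orP [/eqP ->|/IH H]; apply/in_ideal_cons.
  by exists 1, 0; rewrite mul1r addr0; split=> //; apply: in_ideal0.
by exists 0, g; rewrite mul0r add0r.
Qed.

Lemma in_ideal_sub gs hs f :
  (forall g, g \in gs -> in_ideal hs g) -> in_ideal gs f -> in_ideal hs f.
Proof.
elim: gs f => [|a gs IH] f H; first by move=> /in_ideal_nil ->; apply: in_ideal0.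
move=> /in_ideal_cons [c [h [-> Hh]]]; apply: in_idealD.
  by apply/in_idealM/H; rewrite mem_head.
by apply: IH Hh => g Hg; apply: H; rewrite inE Hg orbT.
Qed.

Lemma in_ideal_subset gs hs f : {subset gs <= hs} -> in_ideal gs f -> in_ideal hs f.
Proof. by move=> H; apply: in_ideal_sub => g /H; apply: mem_in_ideal. Qed.

Lemma ideal_rad gs f : in_ideal gs f -> in_rad gs f.
Proof. by exists 1%N; rewrite expr1. Qed.

Lemma in_ideal_exp gs f k l : (k <= l)%N -> in_ideal gs (f ^+ k) -> in_ideal gs (f ^+ l).
Proof. by move=> /subnK <-; rewrite exprD; apply: in_idealM. Qed.

Lemma in_radD gs f g : in_rad gs f -> in_rad gs g -> in_rad gs (f + g).
Proof.
move=> [k Hk] [l Hl]; exists (k + l)%N; rewrite exprDn.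
apply: in_ideal_sum => i _; rewrite -mulr_natr; apply: in_idealMr.
case: (leqP l i) => Hi; first by apply: in_idealM; apply: in_ideal_exp Hl.
by apply/in_idealMr; apply: in_ideal_exp Hk; lia.
Qed.

Lemma in_radM gs f g : in_rad gs g -> in_rad gs (f * g).
Proof. by move=> [k Hk]; exists k; rewrite exprMn; apply: in_idealM. Qed.

Lemma in_rad_exp gs f k : in_rad gs (f ^+ k) -> in_rad gs f.
Proof. by move=> [l]; rewrite -exprM; exists (k * l)%N. Qed.

Lemma in_rad_sub gs hs f :
  (forall g, g \in gs -> in_rad hs g) -> in_rad gs f -> in_rad hs f.
Proof.
move=> H [k Hk]; apply: (@in_rad_exp _ _ k); move: (f ^+ k) Hk => {f k}.
elim: gs H => [|a gs IH] H f; first by move=> /in_ideal_nil ->; apply/ideal_rad/in_ideal0.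
move=> /in_ideal_cons [c [h [-> Hh]]]; apply: in_radD.
  by apply/in_radM/H; rewrite mem_head.
by apply: IH Hh => g Hg; apply: H; rewrite inE Hg orbT.
Qed.

(* Splitting V(J) along y z = 0 into its parts in y = 0 and in z = 0. *)
Lemma in_rad_branch gs y z f :
  in_ideal gs (y * z) -> in_rad (y :: gs) f -> in_rad (z :: gs) f -> in_rad gs f.
Proof.
move=> yz [k /in_ideal_cons [c [h [E1 H1]]]] [l /in_ideal_cons [d [e [E2 H2]]]].
exists (k + l)%N; rewrite exprD E1 E2 mulrDr; apply: in_idealD; last exact: in_idealM.
rewrite mulrDl; apply: in_idealD; last exact: in_idealMr.
by rewrite mulrACA; apply: in_idealM.
Qed.

End Ideals.

(** * Squarefree monomials *)

Section Monomials.
Variables (K : fieldType) (n : nat).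
Local Notation R := {mpoly K[n]}.

Definition set_mnm (S : {set 'I_n}) : 'X_{1..n} := [multinom (i \in S : nat) | i < n].

Lemma sqf_monE (S : {set 'I_n}) : sqf_mon K S = 'X_[set_mnm S].
Proof.
rewrite /sqf_mon mpolyXE_id [RHS](bigID (mem S)) /= [X in _ * X]big1 ?mulr1.
  by apply: eq_bigr => i iS; rewrite mnmE iS expr1.
by move=> i iS; rewrite mnmE (negbTE iS) expr0.
Qed.

Lemma mpolyX_dvd (a b : 'X_{1..n}) : (a <= b)%MM -> 'X_[b] = 'X_[(b - a)%MM] * 'X_[a] :> R.
Proof. by move=> ab; rewrite -mpolyXD submK. Qed.

Lemma set_mnm_subset (A B : {set 'I_n}) : (set_mnm A <= set_mnm B)%MM = (A \subset B).
Proof.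
apply/mnm_lepP/subsetP => [H i iA|H i]; last first.
  by rewrite !mnmE; case iA: (i \in A) => //; rewrite H.
by have := H i; rewrite !mnmE iA; case: (i \in B).
Qed.

Lemma sqf_dvd (A B C : {set 'I_n}) : A \subset B :|: C ->
  exists c : R, sqf_mon K B * sqf_mon K C = c * sqf_mon K A.
Proof.
move=> H; rewrite !sqf_monE -mpolyXD (@mpolyX_dvd (set_mnm A)); first by eexists.
apply/mnm_lepP => i; rewrite mnmDE !mnmE; move/subsetP/(_ i): H; rewrite inE.
by case: (i \in A) => //= /(_ isT) /orP [->|->] //; rewrite addn1.
Qed.

End Monomials.

(** * From row systems to radicals *)

Section Rows.
Variables (T : finType).
Implicit Types (O Z r : {set T}) (s : seq T) (rows : seq {set T}).

Variables (K : fieldType) (n : nat) (g : T -> {set 'I_n}).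
Local Notation R := {mpoly K[n]}.
Local Notation m j := (sqf_mon K (g j)).

Definition row_poly r : R := \sum_(i in r) m i.

(** Induction on the number of vertices outside [Z], with [es] the generators set to zero in the
    branches taken so far. A row with one unknown entry and either side of a branching enlarge
    [Z]. *)
Lemma row_system_rad O s rows :
  (forall s1 y i z s2, s = s1 ++ y :: i :: z :: s2 -> i \in O -> g i \subset g y :|: g z) ->
  row_system O s rows ->
  forall j, j \in s -> in_rad [seq row_poly r | r <- rows] (m j).
Proof.
move=> Hopen Hs j js; set qs := map _ _.
have [k] := ubnP (#|~: (set0 : {set T})|).
have: forall i, i \in (set0 : {set T}) -> in_ideal qs (m i) by move=> i; rewrite inE.
rewrite -[qs in in_rad qs]cat0s -[qs in in_ideal qs]cat0s.
move: ([::] : seq R) (set0 : {set T}) => es Z HZ Hk.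
elim: k es Z HZ Hk => // k IH es Z HZ Hk.
have Hgrow i es' : i \notin Z -> in_ideal (es' ++ qs) (m i) ->
    (forall f, in_ideal (es ++ qs) f -> in_ideal (es' ++ qs) f) ->
    in_rad (es' ++ qs) (m j).
  move=> iZ Hi Hes; apply: (IH _ (i |: Z)) => [i'|].
    by rewrite !inE => /orP [/eqP -> //|/HZ]; apply: Hes.
  rewrite -ltnS; apply: leq_trans Hk; rewrite ltnS; apply/proper_card/properP; split.
    by apply/subsetP => x; rewrite !inE negb_or => /andP [].
  by exists i; rewrite !inE ?eqxx.
case: (boolP (rows_closed rows Z)) => [Zcl|/allPn [r rrows]]; last first.
  rewrite negbK => /cards1P [i Hi].
  have /setDP [ir iZ] : i \in r :\: Z by rewrite Hi inE.
  apply: (Hgrow i es) => //.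
  have -> : m i = row_poly r - \sum_(l in r | l != i) m l.
    by rewrite /row_poly (bigD1 i) //= addrK.
  apply: in_idealB; first by apply: mem_in_ideal; rewrite mem_cat map_f ?orbT.
  apply: in_ideal_sum => l /andP [lr li]; apply: HZ.
  apply: contraNT li => lZ; have : l \in r :\: Z by rewrite inE lZ.
  by rewrite Hi inE.
case: (boolP (all (mem Z) s)) => [/allP /(_ _ js) /= jZ|]; first exact/ideal_rad/HZ.
move=> /(Hs _ Zcl) [s1 [y [i [z [s2 [E iO iZ yZ zZ]]]]]].
have [c Ec] := sqf_dvd K (Hopen _ _ _ _ _ E iO).
apply: (@in_rad_branch _ _ _ (m y) (m z)).
- by rewrite Ec; apply/in_idealM/HZ.
- apply: (Hgrow y (m y :: es)) => //; first by apply: mem_in_ideal; rewrite mem_head.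
  by move=> f; apply: in_ideal_subset => h; rewrite inE orbC => ->.
- apply: (Hgrow z (m z :: es)) => //; first by apply: mem_in_ideal; rewrite mem_head.
  by move=> f; apply: in_ideal_subset => h; rewrite inE orbC => ->.
Qed.

Lemma msupp_row_poly r : (#|r| <= 3)%N -> at_most_trinomial (row_poly r).
Proof.
move=> Hr; rewrite /at_most_trinomial; apply: leq_trans Hr.
rewrite /row_poly -big_enum /= cardE; elim: (enum r) => [|i e IH].
  by rewrite big_nil msupp0.
rewrite big_cons /=.
have sub : {subset msupp (m i + \sum_(l <- e) m l) <= set_mnm (g i) :: msupp (\sum_(l <- e) m l)}.
  by move=> a /msuppD_le; rewrite mem_cat sqf_monE msuppX !inE.
apply: leq_trans (uniq_leq_size (msupp_uniq _) sub) _; exact: IH.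
Qed.

End Rows.

(** * Cochains on ordered simplices *)

Section Cochains.
Variables (I : Type) (A : comNzRingType).
Implicit Types (z : seq I -> A) (phi psi : I -> A) (s : seq I).

(* The wedge product with the 0-cochain phi, on ordered (possibly degenerate) simplices:
   (phi /\ z)(x_0..x_p) = sum_k (-1)^k phi(x_k) z(.. omit x_k ..) *)
Fixpoint wedge phi z s : A :=
  if s is x :: s' then phi x * z s' - wedge phi (fun t => z (x :: t)) s' else 0.

Definition cobd z s := wedge (fun=> 1) z s.

Lemma wedge_cons phi z x s :
  wedge phi z (x :: s) = phi x * z s - wedge phi (fun t => z (x :: t)) s.
Proof. by []. Qed.

Lemma eq_wedge phi psi z z' s : phi =1 psi -> z =1 z' -> wedge phi z s = wedge psi z' s.
Proof. by move=> E; elim: s z z' => //= x s IH z z' Ez; rewrite E Ez (IH _ (fun t => z' (x :: t))). Qed.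

Lemma eq_wedge_size phi z z' s : (forall t, (size t).+1 = size s -> z t = z' t) ->
  wedge phi z s = wedge phi z' s.
Proof.
elim: s z z' => //= x s IH z z' E; rewrite E // (IH _ (fun t => z' (x :: t))) // => t Et.
by apply: E; rewrite /= Et.
Qed.

Lemma wedgeD phi z z' s : wedge phi (fun t => z t + z' t) s = wedge phi z s + wedge phi z' s.
Proof. by elim: s z z' => [|x s IH] z z' /=; rewrite ?addr0 // IH; ring. Qed.

Lemma wedgeM phi a z s : wedge phi (fun t => a * z t) s = a * wedge phi z s.
Proof. by elim: s z => [|x s IH] z /=; rewrite ?mulr0 // IH; ring. Qed.

Lemma wedge0 phi s : wedge phi (fun=> 0) s = 0.
Proof. by elim: s => //= x s ->; rewrite mulr0 subr0. Qed.

Lemma wedgeN phi z s : wedge phi (fun t => - z t) s = - wedge phi z s.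
Proof. by rewrite -mulN1r -wedgeM; apply: eq_wedge => // t; rewrite mulN1r. Qed.

Lemma wedgeB phi z z' s : wedge phi (fun t => z t - z' t) s = wedge phi z s - wedge phi z' s.
Proof. by rewrite wedgeD wedgeN. Qed.

Lemma wedge_suml (J : Type) (r : seq J) (F : J -> I -> A) z s :
  wedge (fun x => \sum_(j <- r) F j x) z s = \sum_(j <- r) wedge (F j) z s.
Proof.
elim: s z => [|x s IH] z /=; first by rewrite big1.
by rewrite IH mulr_suml -sumrB.
Qed.

Lemma wedge_anti phi psi z s : wedge phi (wedge psi z) s = - wedge psi (wedge phi z) s.
Proof.
elim: s z => [|x s IH] z; first by rewrite oppr0.
rewrite wedge_cons [in RHS]wedge_cons /= !wedgeB !wedgeM IH; ring.
Qed.

(** Anticommutation alone would leave a factor 2, which may be zero. *)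
Lemma wedge_sq phi z s : wedge phi (wedge phi z) s = 0.
Proof.
elim: s z => [|x s IH] z //; rewrite wedge_cons /= wedgeB wedgeM IH; ring.
Qed.

Lemma cobd_cobd z s : cobd (cobd z) s = 0.
Proof. exact: wedge_sq. Qed.

End Cochains.

Section TopCochain.
Variables (I : Type) (J : eqType) (A : comNzRingType) (f : I -> J).
Implicit Types (s : seq I) (js : seq J).

Definition ind j (x : I) : A := (f x == j)%:R.

(* The pull-back along f of the top cochain of the simplex with vertices js. *)
Fixpoint topc js : seq I -> A :=
  if js is j :: js' then wedge (ind j) (topc js') else fun s => (nilp s)%:R.

Lemma wedge_ind_topc j js s : j \in js -> wedge (ind j) (topc js) s = 0.
Proof.
elim: js s => // j' js IH s; rewrite inE; case: eqP => [-> _|_ /= jjs]; first exact: wedge_sq.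
rewrite /= wedge_anti (@eq_wedge _ _ _ (ind j') _ (fun=> 0)) ?wedge0 ?oppr0 //.
by move=> t; apply: IH.
Qed.

(** The constant 1 is the sum of the [ind j], and each of these is already a factor of [topc js]. *)
Lemma cobd_topc js s : uniq js -> (forall x, f x \in js) -> cobd (topc js) s = 0.
Proof.
move=> U fjs; rewrite /cobd (@eq_wedge _ _ _ (fun x => \sum_(j <- js) ind j x) _ (topc js)) //.
  by rewrite wedge_suml big1_seq // => j /andP [_ ?]; apply: wedge_ind_topc.
move=> x; rewrite (bigD1_seq (f x)) //= /ind eqxx big1 ?addr0 // => j.
by rewrite eq_sym => /negbTE ->.
Qed.

Lemma wedge_ind0 j z s : j \notin map f s -> wedge (ind j) z s = 0.
Proof.
elim: s z => // x s IH z; rewrite inE negb_or => /andP [jx js] /=.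
by rewrite IH // /ind eq_sym (negbTE jx) mul0r subr0.
Qed.

Lemma wedge_miss (phi : I -> A) j z s : (forall t, j \notin map f t -> z t = 0) ->
  j \notin map f s -> wedge phi z s = 0.
Proof.
elim: s z => // x s IH z H; rewrite /= inE negb_or => /andP [jx js].
rewrite H // mulr0 IH ?subr0 // => t jt; apply: H.
by rewrite /= inE negb_or jx.
Qed.

Lemma topc_miss js s j : j \in js -> j \notin map f s -> topc js s = 0.
Proof.
elim: js s => // j' js IH s; rewrite inE => /orP [/eqP ->|jjs] /=; first exact: wedge_ind0.
by apply: wedge_miss => t; apply: IH.
Qed.

Lemma topc_neq0 js s : topc js s != 0 -> {subset js <= map f s}.
Proof. by move=> H j jjs; apply: contraR H => /(topc_miss jjs) ->. Qed.

Lemma topc_id s : uniq (map f s) -> topc (map f s) s = 1.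
Proof.
elim: s => //= x s IH /andP [xs U].
by rewrite IH // wedge_ind0 // /ind eqxx mulr1 subr0.
Qed.

End TopCochain.

(** * Chains, boundary and pairing *)

Section Chains.
Variables (I : finType) (V : zmodType).
Implicit Types (w : seq I -> V) (s : seq I).

(* A chain of ordered (possibly degenerate) simplices is given by its coefficient function w. *)
Fixpoint bd w s : V :=
  if s is x :: s' then \sum_v w (v :: x :: s') - bd (fun t => w (x :: t)) s'
  else \sum_v w [:: v].

Lemma bd_cons w x s : bd w (x :: s) = \sum_v w [:: v, x & s] - bd (fun t => w (x :: t)) s.
Proof. by []. Qed.

Lemma eq_bd_size w w' s : (forall t, size t = (size s).+1 -> w t = w' t) -> bd w s = bd w' s.
Proof.
elim: s w w' => [|x s IH] w w' E /=; first by apply: eq_bigr => v _; apply: E.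
congr (_ - _); first by apply: eq_bigr => v _; apply: E.
by apply: IH => t Et; apply: E; rewrite /= Et.
Qed.

Lemma bdD w w' s : bd (fun t => w t + w' t) s = bd w s + bd w' s.
Proof.
elim: s w w' => [|x s IH] w w' /=; rewrite big_split //= IH.
by rewrite opprD addrACA.
Qed.

Lemma bdN w s : bd (fun t => - w t) s = - bd w s.
Proof. by elim: s w => [|x s IH] w /=; rewrite sumrN // IH opprB opprK addrC. Qed.

Lemma bdB w w' s : bd (fun t => w t - w' t) s = bd w s - bd w' s.
Proof. by rewrite bdD bdN. Qed.

Lemma bd0 s : bd (fun=> 0) s = 0.
Proof. by elim: s => [|x s IH] /=; rewrite big1 // IH subr0. Qed.

Lemma bd_sum (J : Type) (r : seq J) (F : J -> seq I -> V) s :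
  bd (fun t => \sum_(j <- r) F j t) s = \sum_(j <- r) bd (F j) s.
Proof.
elim: r => [|j r IH].
  by rewrite big_nil -[RHS](bd0 s); apply: eq_bd_size => t _; rewrite big_nil.
rewrite big_cons -IH -bdD; apply: eq_bd_size => t _; exact: big_cons.
Qed.

Lemma bd_bd w s : bd (bd w) s = 0.
Proof.
elim: s w => [|x s IH] w.
  by rewrite /= sumrB exchange_big /= subrr.
rewrite bd_cons; under eq_bigr do rewrite bd_cons /=.
rewrite sumrB [bd (fun t => bd w (x :: t)) s](_ : _ =
    bd (fun t => \sum_v w [:: v, x & t] - bd (fun t => w (x :: t)) t) s) //.
rewrite bdB IH subr0 bd_sum sumrB exchange_big /=.
by rewrite opprB addrCA subrr addr0 subrr.
Qed.

End Chains.

Section Pairing.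
Variables (I : finType) (A : comNzRingType).
Implicit Types (c w : seq I -> A).

Fixpoint pairing p c w : A :=
  if p is p'.+1 then \sum_v pairing p' (fun t => c (v :: t)) (fun t => w (v :: t))
  else c [::] * w [::].

(** Serves to show that one monomial coefficient of a pairing vanishes, term by term. *)
Lemma pairing_ind (P : A -> Prop) p c w : P 0 -> (forall x y, P x -> P y -> P (x + y)) ->
  (forall t, size t = p -> P (c t * w t)) -> P (pairing p c w).
Proof.
move=> P0 PD; elim: p c w => [|p IH] c w H /=; first exact: H.
apply: big_ind => // v _; apply: IH => t Et.
by apply: (H (v :: t)); rewrite /= Et.
Qed.

Lemma pairing_eq p c c' w w' : (forall t, size t = p -> c t * w t = c' t * w' t) ->
  pairing p c w = pairing p c' w'.
Proof.
elim: p c c' w w' => [|p IH] c c' w w' H /=; first exact: H.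
apply: eq_bigr => v _; apply: IH => t Et.
by apply: H; rewrite /= Et.
Qed.

Lemma pairingDr p c w w' : pairing p c (fun t => w t + w' t) = pairing p c w + pairing p c w'.
Proof.
elim: p c w w' => [|p IH] c w w' /=; first by rewrite mulrDr.
by rewrite -big_split; apply: eq_bigr => v _; rewrite IH.
Qed.

Lemma pairing0r p c : pairing p c (fun=> 0) = 0.
Proof.
by elim: p c => [|p IH] c /=; rewrite ?mulr0 // big1.
Qed.

Lemma pairingNr p c w : pairing p c (fun t => - w t) = - pairing p c w.
Proof.
elim: p c w => [|p IH] c w /=; first by rewrite mulrN.
by rewrite -sumrN; apply: eq_bigr => v _; rewrite IH.
Qed.

Lemma pairingBr p c w w' : pairing p c (fun t => w t - w' t) = pairing p c w - pairing p c w'.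
Proof. by rewrite pairingDr pairingNr. Qed.

Lemma pairingBl p c c' w : pairing p (fun t => c t - c' t) w = pairing p c w - pairing p c' w.
Proof.
elim: p c c' w => [|p IH] c c' w /=; first by rewrite mulrBl.
by rewrite -sumrB; apply: eq_bigr => v _; rewrite IH.
Qed.

Lemma pairing_sumr (J : Type) (r : seq J) p c (F : J -> seq I -> A) :
  pairing p c (fun t => \sum_(j <- r) F j t) = \sum_(j <- r) pairing p c (F j).
Proof.
elim: r => [|j r IH].
  by rewrite big_nil -[RHS](pairing0r p c); apply: pairing_eq => t _; rewrite big_nil.
rewrite big_cons -IH -pairingDr; apply: pairing_eq => t _; by rewrite big_cons.
Qed.

(** [bd] is the adjoint of [cobd]: it sums over all insertions of a letter, signed by the
    position. *)
Lemma stokes p c w : pairing p.+1 (cobd c) w = pairing p c (bd w).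
Proof.
elim: p c w => [|p IH] c w.
  by rewrite /cobd /= mulr_sumr; apply: eq_bigr => v _; rewrite subr0 mul1r.
have -> : pairing p.+2 (cobd c) w = \sum_v pairing p.+1 c (fun t => w (v :: t))
    - \sum_v pairing p.+1 (cobd (fun t => c (v :: t))) (fun t => w (v :: t)).
  rewrite -sumrB (_ : pairing _ _ _ = \sum_v pairing p.+1
    (fun t => cobd c (v :: t)) (fun t => w (v :: t))) //; apply: eq_bigr => v _; rewrite -pairingBl.
  by apply: pairing_eq => t _; rewrite /cobd wedge_cons mul1r.
under [X in _ - X]eq_bigr do rewrite IH.
rewrite exchange_big -sumrB; apply: eq_bigr => x _ /=.
by rewrite -pairing_sumr -pairingBr.
Qed.

End Pairing.

Lemma mpolyX_neq0 (K : fieldType) n (m : 'X_{1..n}) : 'X_[m] != 0 :> {mpoly K[n]}.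
Proof. by apply/eqP => /mpolyP /(_ m) /eqP; rewrite mcoeffX mcoeff0 eqxx oner_eq0. Qed.

(** * Divisibility by monomials *)

Section MonomialDivisibility.
Variables (K : fieldType) (n : nat).
Local Notation R := {mpoly K[n]}.
Implicit Types (f : R) (m a : 'X_{1..n}).

Definition mdvd m f := forall a, f@_a != 0 -> (m <= a)%MM.

(** Exponents are subtracted with truncation, so this is a quotient only under [mdvd m f]. *)
Definition mquo m f : R := \sum_(a <- msupp f) f@_a *: 'X_[(a - m)%MM].

Lemma mquoK m f : mdvd m f -> f = 'X_[m] * mquo m f.
Proof.
move=> H; rewrite {1}(mpolyE f) mulr_sumr; apply: eq_big_seq => a.
by rewrite mcoeff_msupp => /H ma; rewrite -scalerAr -mpolyXD addmC submK.
Qed.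

Lemma mdvdX m f : mdvd m ('X_[m] * f).
Proof.
move=> a; rewrite -mcoeff_msupp mulrC (perm_mem (msuppMX _ _)) => /mapP [b _ ->].
by rewrite addmC; apply: lem_addl.
Qed.

Lemma mdvd0 m : mdvd m 0. Proof. by move=> a; rewrite mcoeff0 eqxx. Qed.

Lemma mdvdD m f g : mdvd m f -> mdvd m g -> mdvd m (f + g).
Proof.
move=> Hf Hg a; rewrite mcoeffD; case: (eqVneq f@_a 0) => [->|/Hf //].
by rewrite add0r; apply: Hg.
Qed.

Lemma mdvdN m f : mdvd m f -> mdvd m (- f).
Proof. by move=> Hf a; rewrite mcoeffN oppr_eq0; apply: Hf. Qed.

Lemma mdvdMr m f g : mdvd m f -> mdvd m (f * g).
Proof. by move=> /mquoK ->; rewrite -mulrA; apply: mdvdX. Qed.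

Lemma mdvd_trans m m' f : (m <= m')%MM -> mdvd m' f -> mdvd m f.
Proof. by move=> mm H a /H; apply: lepm_trans. Qed.

Lemma in_mon_idealP (L : seq {set 'I_n}) f :
  in_ideal [seq sqf_mon K A | A <- L] f <->
  forall a, f@_a != 0 -> exists2 A, A \in L & (set_mnm A <= a)%MM.
Proof.
split; last first.
  move=> H; rewrite (mpolyE f) big_seq; apply: in_ideal_sum => a.
  rewrite mcoeff_msupp => /H [B BL Ba]; rewrite -mul_mpolyC (mpolyX_dvd K Ba) mulrA.
  by apply/in_idealM/mem_in_ideal; rewrite -sqf_monE map_f.
elim: L f => [|B L IH] f /=.
  by move=> /in_ideal_nil -> a; rewrite mcoeff0 eqxx.
move=> /in_ideal_cons [c [h [-> Hh]]] a; rewrite mcoeffD.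
case: (eqVneq (c * sqf_mon K B)@_a 0) => [->|Ha _].
  by rewrite add0r => /(IH _ Hh) [B' BL]; exists B'; rewrite // inE BL orbT.
exists B; first exact: mem_head.
by move: Ha; rewrite mulrC sqf_monE; apply: mdvdX.
Qed.

End MonomialDivisibility.

(** Sequences of one length form a finite type, which gives the choice function; [y0] is its value
    on all other lengths. *)
Lemma seq_choice (I : finType) (Y : Type) (y0 : Y) (j : nat) (P : seq I -> Y -> Prop) :
  (forall t, size t = j -> exists y, P t y) ->
  exists f, forall t, size t = j -> P t (f t).
Proof.
move=> H; have /fin_all_exists [F HF] : forall t : j.-tuple I, exists y, P t y.
  by move=> t; apply: H; apply: size_tuple.
exists (fun t => if insub t is Some t' then F t' else y0) => t Et.
case: insubP => [t' _ <-|]; first exact: HF.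
by rewrite Et eqxx.
Qed.

Lemma raddf_bd (I : finType) (U V : zmodType) (phi : {additive U -> V}) (w : seq I -> U) s :
  phi (bd w s) = bd (fun t => phi (w t)) s.
Proof.
elim: s w => [|x s IH] w; first by rewrite /= raddf_sum.
by rewrite !bd_cons raddfB raddf_sum IH.
Qed.

(** * The Taylor complex of a family of variables *)

Section TaylorChains.
Variables (K : fieldType) (n : nat) (I : finType) (x : I -> 'I_n).
Local Notation R := {mpoly K[n]}.
Implicit Types (t s : seq I).

Definition supp t : {set 'I_n} := [set x v | v in t].

Lemma supp_cons v t : supp (v :: t) = x v |: supp t.
Proof.
apply/setP => i; rewrite !inE /supp; apply/imsetP/orP => [[u]|[/eqP ->|/imsetP [u ut ->]]].
- by rewrite inE => /orP [/eqP -> ->|ut ->]; [left | right; apply: imset_f].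
- by exists v => //; apply: mem_head.
- by exists u => //; rewrite inE ut orbT.
Qed.

Lemma supp_mem v t : v \in t -> x v \in supp t.
Proof. exact: imset_f. Qed.

(* w lies in the degree-j part of the Taylor complex of the (x_v)_v, tensored with R^k: the basis element
   indexed by t is identified with the monomial lcm of the x_v, v in t. *)
Definition taylor k j (w : seq I -> 'rV[R]_k) :=
  forall t, size t = j -> forall l, mdvd (set_mnm (supp t)) (w t ord0 l).

Lemma taylor_bd k j w : @taylor k j.+1 w -> taylor j (bd w).
Proof.
move=> H t Et l; rewrite -[supp t]set0U.
have: forall t', size t' = j.+1 -> mdvd (set_mnm (set0 :|: supp t')) (w t' ord0 l).
  by move=> t' /H; rewrite set0U.
move: set0 => A {H}; elim: t j Et w A => [|v t IH] j <- w A H.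
  rewrite summxE; apply: big_ind => [||u _]; [exact: mdvd0 | exact: mdvdD|].
  by apply: mdvd_trans (H [:: u] erefl); rewrite set_mnm_subset setUS // supp_cons subsetUr.
rewrite bd_cons mxE; apply: mdvdD.
  rewrite summxE; apply: big_ind => [||u _]; [exact: mdvd0 | exact: mdvdD|].
  by apply: mdvd_trans (H [:: u, v & t] erefl); rewrite set_mnm_subset setUS // [supp (u :: _)]supp_cons subsetUr.
rewrite mxE; apply: mdvdN; rewrite supp_cons setUA.
apply: (IH (size t) erefl) => t' Et'.
by have := H (v :: t'); rewrite supp_cons setUA; apply; rewrite /= Et'.
Qed.

(** The chosen vertex depends on the monomial alone; this makes [part] additive, hence compatible
    with boundaries. *)
Definition sel v (a : 'X_{1..n}) := [pick u | 0 < a (x u)]%N == Some v.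

Definition part v (f : R) : R := \sum_(a <- msupp f | sel v a) f@_a *: 'X_[a].

Lemma mcoeff_part v f b : (part v f)@_b = if sel v b then f@_b else 0.
Proof.
rewrite /part raddf_sum /= (eq_bigr (fun a => if a == b then f@_b else 0)); last first.
  by move=> a _; rewrite mcoeffZ mcoeffX; case: eqP => [->|_]; rewrite ?mulr1 ?mulr0.
rewrite -big_mkcondr /=.
case: (boolP (b \in msupp f)) => [bf|/memN_msupp_eq0 fb]; last first.
  by rewrite fb if_same big1.
rewrite -big_filter (eq_filter (_ : _ =1 fun a => (a == b) && sel v b)); last first.
  by move=> a; rewrite andbC; case: eqP => // ->.
case: (sel v b); last by rewrite (eq_filter (_ : _ =1 pred0)) ?filter_pred0 ?big_nil // => a; rewrite andbF.
rewrite (eq_filter (_ : _ =1 pred1 b)) => [|a]; last by rewrite andbT.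
by rewrite filter_pred1_uniq ?msupp_uniq // big_seq1.
Qed.

Lemma part_is_additive v : additive (part v).
Proof.
by move=> f g; apply/mpolyP => b; rewrite mcoeffB !mcoeff_part mcoeffB; case: ifP; rewrite ?subr0.
Qed.

HB.instance Definition _ v := GRing.isAdditive.Build R R (part v) (part_is_additive v).

Lemma mdvd_part v (A : {set 'I_n}) f : mdvd (set_mnm A) f -> mdvd (set_mnm (x v |: A)) (part v f).
Proof.
move=> H a; rewrite mcoeff_part; case: ifP => [/eqP sa /H|]; last by rewrite eqxx.
move: sa; case: pickP => // u xu [<-] Aa; apply/mnm_lepP => i; rewrite mnmE in_setU1.
case: eqP => [->//|_] /=; by move/mnm_lepP/(_ i): Aa; rewrite mnmE.
Qed.

Lemma sum_part v t f : v \in t -> mdvd (set_mnm (supp t)) f -> \sum_u part u f = f.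
Proof.
move=> vt H; apply/mpolyP => a; rewrite raddf_sum /=.
under eq_bigr do rewrite mcoeff_part.
case: (eqVneq f@_a 0) => [->|/H fa]; first by rewrite big1 // => u _; rewrite if_same.
have va : (0 < a (x v))%N.
  by move/mnm_lepP/(_ (x v)): fa; rewrite mnmE supp_mem.
rewrite -big_mkcond /= /sel; case: pickP => [u _|/(_ v)]; last by rewrite va.
by rewrite (big_pred1 u).
Qed.

(** The contracting homotopy prepends to [t] the vertex chosen by each monomial of [w t]. For
    non-empty [t], divisibility gives each monomial a chosen vertex, so the parts add up to
    [w t]. *)
Lemma taylor_exact k j w : @taylor k j.+1 w -> (forall t, size t = j -> bd w t = 0) ->
  exists w', taylor j.+2 w' /\ forall t, size t = j.+1 -> w t = bd w' t.
Proof.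
move=> H Hb; exists (fun t => if t is v :: t' then map_mx (part v) (w t') else 0); split.
  by move=> [|v t] // [Et] l; rewrite mxE supp_cons; apply/mdvd_part/H.
move=> [|v t] // Et; have [Et'] := Et.
rewrite bd_cons -raddf_bd Hb // raddf0 subr0; apply/rowP => l; rewrite summxE.
under eq_bigr do rewrite mxE.
by rewrite (sum_part (mem_head v t)) //; apply: H.
Qed.

End TaylorChains.

(** * Lower bound for the projective dimension *)

Section PdLower.
Variables (K : fieldType) (n : nat) (I : finType) (x : I -> 'I_n).
Local Notation R := {mpoly K[n]}.
Variables (gs : seq R) (r : nat -> nat) (D : forall i, 'M[R]_(r i.+1, r i)).
Hypothesis resD : free_res gs D.

(** Divide by the monomial of [t], lift along the resolution and multiply back: the lift keeps the
    divisibility. *)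
Lemma resol_lift i j w : @taylor K n I x (r i.+1) j w ->
  (forall t, size t = j -> w t *m D i = 0) ->
  exists w', taylor x j w' /\ forall t, size t = j -> w t = w' t *m D i.+1.
Proof.
move=> H Hw; have [_ _ ex] := resD.
have [w' Hw'] : exists w' : seq I -> 'rV[R]_(r i.+2), forall t, size t = j ->
    (forall l, mdvd (set_mnm (supp x t)) (w' t ord0 l)) /\ w t = w' t *m D i.+1.
  refine (@seq_choice I _ (0 : 'rV[R]_(r _)) j
    (fun t (y : 'rV[R]_(r i.+2)) => (forall l, mdvd (set_mnm (supp x t)) (y ord0 l)) /\ w t = y *m D i.+1) _) => t Et.
  pose u := map_mx (mquo (set_mnm (supp x t))) (w t).
  have Eu : w t = 'X_[set_mnm (supp x t)] *: u.
    by apply/rowP => l; rewrite !mxE -mquoK //; apply: H.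
  have /ex [v Ev] : u *m D i = 0.
    apply/rowP => l; move/rowP/(_ l)/eqP: (Hw t Et).
    by rewrite Eu -scalemxAl mxE [X in _ == X]mxE mulf_eq0 (negbTE (mpolyX_neq0 K _)) => /eqP ->; rewrite mxE.
  exists ('X_[set_mnm (supp x t)] *: v); split=> [l|]; first by rewrite mxE; apply: mdvdX.
  by rewrite -scalemxAl Ev.
by exists w'; split=> [t Et l|t Et]; have [] := Hw' t Et.
Qed.

Lemma bd_mulmx k l (w : seq I -> 'rV[R]_k) (M : 'M[R]_(k, l)) s :
  bd (fun t => w t *m M) s = bd w s *m M.
Proof.
elim: s w => [|v s IH] w; first by rewrite /= mulmx_suml.
by rewrite !bd_cons mulmxBl mulmx_suml IH.
Qed.

Variables (p q : nat).
Hypotheses (qp : (q < p)%N) (rq : forall i, (q < i)%N -> r i = 0%N).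

Lemma rV_empty k (k0 : k = 0%N) (v v' : 'rV[R]_k) : v = v'.
Proof. by apply/rowP => l; exfalso; move: (ltn_ord l); rewrite {2}k0. Qed.

(** A zigzag in the double complex of Taylor chains with values in the resolution. The recursion
    ends at Taylor degree 0, where the resolution has rank 0 in degree [p]. *)
Lemma resol_chase j i w : (j + i.+1 = p)%N -> @taylor K n I x (r i.+1) j w ->
  (forall t, (size t).+1 = j -> bd w t *m D i = 0) ->
  exists w' w'', [/\ taylor x j.+1 w', taylor x j w'' &
    forall t, size t = j -> w t = bd w' t + w'' t *m D i.+1].
Proof.
have [_ _ ex] := resD.
elim: j i w => [|j IH] i w Ep Ew Hw.
  have r0 : r i.+1 = 0%N by apply: rq; rewrite -[i.+1]add0n Ep.
  exists (fun=> 0), (fun=> 0); split.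
  - by move=> t _ l; rewrite mxE; apply: mdvd0.
  - by move=> t _ l; rewrite mxE; apply: mdvd0.
  - by move=> t _; apply: rV_empty.
have [v [Ev Hv]] : exists v, taylor x j v /\ forall t, size t = j -> bd w t = v t *m D i.+1.
  apply: resol_lift; first exact: taylor_bd.
  by move=> t Et; apply: Hw; rewrite Et.
have [||v' [v'' [Ev' Ev'' E]]] := IH i.+1 v _ Ev _; first by rewrite addnS -addSn.
  move=> t Et; rewrite -bd_mulmx -[RHS](bd_bd w t); apply: eq_bd_size => t' Et'.
  by rewrite Hv // Et' Et.
have DD (u : 'rV[R]_(r _)) : u *m D i.+2 *m D i.+1 = 0 by apply/ex; exists u.
have Ev'D : taylor x j.+1 (fun t => v' t *m D i.+1).
  move=> t Et l; rewrite mxE; apply: big_ind => [||k _]; [exact: mdvd0 | exact: mdvdD|].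
  by apply/mdvdMr/Ev'.
have [|t Et|w' [Ew' Hw']] := @taylor_exact K n I x _ j (fun t => w t - v' t *m D i.+1).
- by move=> t Et l; rewrite !mxE; apply: mdvdD; [apply: Ew|apply: mdvdN; have := Ev'D t Et l; rewrite mxE].
- by rewrite bdB bd_mulmx Hv // E // mulmxDl DD addr0 subrr.
- by exists w', v'; split=> // t Et; rewrite -Hw' // subrK.
Qed.

(** The last step of the zigzag, at F_0 = R. It expresses the vanishing of Tor_p: a cycle modulo the
    ideal is a boundary modulo the ideal. *)
Lemma resol_chase0 (w : seq I -> R) :
  (forall t, size t = p -> mdvd (set_mnm (supp x t)) (w t)) ->
  (forall t, (size t).+1 = p -> exists2 e, in_ideal gs e & bd w t = 'X_[set_mnm (supp x t)] * e) ->
  exists w' e, (forall t, size t = p -> w t = bd w' t + 'X_[set_mnm (supp x t)] * e t) /\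
    (forall t, size t = p -> in_ideal gs (e t)).
Proof.
move=> Ew Hw; have [r0 id0 ex] := resD.
have j0 : 'I_(r 0%N) by rewrite r0; exact: ord0.
have all0 (j : 'I_(r 0%N)) : j = j0 by move: j j0; rewrite r0 => j j'; rewrite !ord1.
case: p Ew Hw qp resol_chase => // j Ew Hw jq chase.
have [v Hv] : exists v : seq I -> 'rV[R]_(r 1), forall t, size t = j ->
    (forall l, mdvd (set_mnm (supp x t)) (v t ord0 l)) /\ bd w t = (v t *m D 0) ord0 j0.
  refine (@seq_choice I _ (0 : 'rV[R]_(r _)) j
    (fun t (y : 'rV[R]_(r 1)) => (forall l, mdvd (set_mnm (supp x t)) (y ord0 l)) /\ bd w t = (y *m D 0) ord0 j0) _) => t Et.
  have [|e /id0 [u [k]] Eu Ebd] := Hw t; first by rewrite Et.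
  exists ('X_[set_mnm (supp x t)] *: u); split=> [l|]; first by rewrite mxE; apply: mdvdX.
  by rewrite -scalemxAl mxE Ebd -Eu (all0 k).
have bd_entry k (f : seq I -> 'rV[R]_k) l s : bd f s ord0 l = bd (fun t => f t ord0 l) s.
  elim: s f => [|u s IH] f; first by rewrite /= summxE.
  by rewrite !bd_cons mxE summxE mxE IH.
have Ev : taylor x j v by move=> t Et; have [] := Hv t Et.
have [||v' [v'' [Ev' Ev'' E]]] := chase j 0%N v _ Ev; first by rewrite addn1.
  move=> t Et; apply/rowP => l; rewrite (all0 l) [RHS]mxE -bd_mulmx.
  rewrite bd_entry.
  rewrite -[RHS](bd_bd w t); apply: eq_bd_size => t' Et'; have [|_ ->] // := Hv t'.
  by rewrite Et' Et.
have DD (u : 'rV[R]_(r _)) : u *m D 1 *m D 0 = 0 by apply/ex; exists u.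
pose f t := w t - (v' t *m D 0) ord0 j0.
have [|t Et|w' [Ew' Hw']] := @taylor_exact K n I x 1 j (fun t => (f t)%:M).
- move=> t Et l; rewrite mxE !ord1 eqxx mulr1n /f; apply: mdvdD; first exact: Ew.
  apply: mdvdN; rewrite mxE; apply: big_ind => [||k _]; [exact: mdvd0 | exact: mdvdD|].
  by apply/mdvdMr/Ev'.
- apply/rowP => l; rewrite bd_entry [RHS]mxE.
  have -> : bd (fun t => (f t)%:M ord0 l) t = bd f t.
    by apply: eq_bd_size => t' _; rewrite mxE !ord1 eqxx mulr1n.
  have [_ Hvt] := Hv t Et; rewrite /f bdB Hvt.
  by rewrite -(bd_entry _ (fun t => v' t *m D 0)) bd_mulmx (E t Et) mulmxDl DD addr0 subrr.
- exists (fun t => w' t ord0 ord0), (fun t => (map_mx (mquo (set_mnm (supp x t))) (v' t) *m D 0) ord0 j0).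
  split=> t Et; last by apply/id0; do 2 eexists.
  have := congr1 (fun M : 'rV_1 => M ord0 ord0) (Hw' t Et).
  rewrite mxE eqxx mulr1n bd_entry => <-.
  have Ev't : v' t = 'X_[set_mnm (supp x t)] *: map_mx (mquo (set_mnm (supp x t))) (v' t).
    by apply/rowP => l; rewrite !mxE -mquoK //; apply: Ev'.
  by rewrite /f {1}Ev't -scalemxAl mxE subrK.
Qed.

End PdLower.

(* The class of X_all * omega in Tor(R/(x_v)_v, R/I), where X_all is the product of all variables,
   is detected by pairing with topc. *)
Theorem pd_lower (K : fieldType) (n : nat) (L : seq {set 'I_n}) (I : finType) (x : I -> 'I_n)
  (J : eqType) (f : I -> J) (js : seq J) (omega : seq I -> {mpoly K[n]}) :
  uniq js -> (forall v, f v \in js) ->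
  (forall t, {subset js <= map f t} -> forall A, A \in L -> ~~ [disjoint A & supp x t]) ->
  pairing (size js) (topc _ f js) omega = 1 ->
  (forall t, (size t).+1 = size js -> (forall A, A \in L -> ~~ [disjoint A & supp x t]) -> bd omega t = 0) ->
  forall r D, free_res [seq sqf_mon K A | A <- L] (r := r) D ->
  forall q, (forall i, (q < i)%N -> r i = 0%N) -> (size js <= q)%N.
Proof.
move=> Ujs fjs Hhit Hpair Hbd r D resD q rq; rewrite leqNgt; apply/negP => qp.
pose X : {mpoly K[n]} := 'X_[set_mnm setT].
have XE A : X = 'X_[set_mnm A] * 'X_[set_mnm (~: A)].
  rewrite -mpolyXD; congr 'X_[_]; apply/mnmP => i; rewrite !mnmE !inE.
  by case: (i \in A).
have bdX t : bd (fun s => omega s * X) t = bd omega t * X.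
  elim: t (omega) => [|v s IH] w; first by rewrite /= mulr_suml.
  by rewrite !bd_cons mulrBl mulr_suml IH.
have [||w' [e [Hw He]]] := resol_chase0 resD qp rq (x := x) (w := fun t => omega t * X).
- by move=> t _; rewrite mulrC (XE (supp x t)) -mulrA; apply: mdvdX.
- move=> t Et; rewrite bdX.
  case: (boolP (all (fun A : {set 'I_n} => ~~ [disjoint A & supp x t]) L)) => [/allP H|/allPn [A AL]].
    by exists 0; [apply: in_ideal0 | rewrite Hbd ?mul0r ?mulr0].
  (* As [supp x t] misses [A], the generator of [A] divides the complementary monomial. *)
  rewrite negbK => dA; exists (bd omega t * 'X_[set_mnm (~: supp x t)]).
    apply/in_idealM/in_mon_idealP => a; rewrite -mcoeff_msupp msuppX inE => /eqP ->.
    by exists A; rewrite ?set_mnm_subset -?disjoints_subset.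
  by rewrite (XE (supp x t)); ring.
(* The contradiction is read off the coefficient of [X], which is 1 on this side. *)
have /mpolyP /(_ (set_mnm setT)) /eqP := congr1 (fun y => y * X) Hpair.
apply/negP; rewrite mul1r [X in _ != X]mcoeffX eqxx.
have -> : pairing (size js) (topc _ f js) omega * X =
   pairing (size js) (topc _ f js) (fun t => omega t * X).
  elim: (size js) (topc _ f js) omega {Hpair Hbd bdX Hw} => [|k IH] c w /=; first by rewrite mulrA.
  by rewrite mulr_suml; apply: eq_bigr => v _; rewrite IH.
have -> : pairing (size js) (topc _ f js) (fun t => omega t * X) =
    pairing (size js) (topc _ f js) (fun t => bd w' t + 'X_[set_mnm (supp x t)] * e t).
  by apply: pairing_eq => t Et; rewrite Hw.
rewrite pairingDr -stokes mcoeffD.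
have -> : pairing (size js).+1 (cobd (topc {mpoly K[n]} f js)) w' = pairing (size js).+1 (fun _ : seq I => 0) (fun=> 0).
  by apply: pairing_eq => t _; rewrite cobd_topc // !mul0r.
rewrite pairing0r mcoeff0 add0r.
(* Where the cochain is non-zero, [supp x t] meets every generator. Then the complementary monomial
   is a multiple of no generator and cannot occur in an element of the ideal. *)
suff -> : (pairing (size js) (topc _ f js) (fun t => 'X_[set_mnm (supp x t)] * e t))@_(set_mnm setT) = 0.
  by rewrite eq_sym oner_eq0.
refine (@pairing_ind I {mpoly K[n]} (fun y : {mpoly K[n]} => y@_(set_mnm setT) = 0) _ _ _ _ _ _) => [||t Et].
  by rewrite mcoeff0.
- by move=> y z Hy Hz; rewrite mcoeffD Hy Hz addr0.
have [c0|ne] := eqVneq (topc {mpoly K[n]} f js t) 0.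
  by rewrite c0 mul0r mcoeff0.
have Hit := Hhit t (topc_neq0 ne); rewrite mulrCA; apply/eqP; apply: contraT => Hne.
have /in_mon_idealP Ie : in_ideal [seq sqf_mon K A | A <- L] (topc _ f js t * e t).
  by apply/in_idealM/He.
have := mdvdX Hne => le1.
have : (topc _ f js t * e t)@_(set_mnm setT - set_mnm (supp x t))%MM != 0.
  by move: Hne; rewrite -{1}(submK le1) mulrC addmC mcoeffMX.
move=> /Ie [A AL Ale].
case/negP: (Hit _ AL); rewrite disjoints_subset; apply/subsetP => i iA.
move/mnm_lepP/(_ i): Ale; rewrite mnmBE !mnmE iA !inE.
by case: (_ \in _).
Qed.

(** * Alternating cochains *)

Section Alternating.
Variables (I : finType) (F : comNzRingType).
Implicit Types (z : seq I -> F) (s : seq I).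

(** Vanishing on repeated letters is a separate clause, since in characteristic 2 antisymmetry does
    not imply it. *)
Definition alternating z :=
  (forall s1 x y s2, z (s1 ++ [:: x, y & s2]) = - z (s1 ++ [:: y, x & s2])) /\
  (forall s1 x s2, z (s1 ++ [:: x, x & s2]) = 0).

Lemma alternating_cons z x : alternating z -> alternating (fun s => z (x :: s)).
Proof. by move=> [H1 H2]; split=> [s1|s1]; [apply: (H1 (x :: s1)) | apply: (H2 (x :: s1))]. Qed.

Lemma alternating_cobd z : alternating z -> alternating (cobd z).
Proof.
move=> Hz; split=> s1.
  elim: s1 z Hz => [|v s1 IH] z Hz x y s2.
    rewrite /cobd /= !mul1r (@eq_wedge _ _ _ (fun=> 1) _ (fun t => - z [:: y, x & t])) //.
      by rewrite wedgeN; ring.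
    by move=> t; have [H _] := Hz; apply: (H [::]).
  have [H1 _] := Hz; rewrite /cobd !cat_cons !wedge_cons H1 -/(cobd _ _).
  by rewrite [wedge _ _ _](IH _ (alternating_cons v Hz)) /cobd; ring.
elim: s1 z Hz => [|v s1 IH] z Hz x s2.
  rewrite /cobd /= !mul1r (@eq_wedge _ _ _ (fun=> 1) _ (fun=> 0)) //.
    by rewrite wedge0; ring.
  by move=> t; have [_ H] := Hz; apply: (H [::]).
have [_ H2] := Hz; rewrite /cobd !cat_cons !wedge_cons H2.
by rewrite [wedge _ _ _](IH _ (alternating_cons v Hz)); ring.
Qed.

Lemma alternating_big z s : alternating z -> (#|I| < size s)%N -> z s = 0.
Proof.
move=> [H1 H2] sz.
have rep s1 x s2 s3 : z (s1 ++ x :: s2 ++ x :: s3) = 0.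
  elim: s2 s1 => [|v s2 IH] s1 /=; first exact: H2.
  by rewrite H1 -cat_rcons IH oppr0.
have nuniq s0 s' : ~~ uniq s' -> z (s0 ++ s') = 0.
  elim: s' s0 => // x s' IH s0 /=; rewrite negb_and negbK => /orP [xs|/(IH (rcons s0 x))].
    by case/splitPr: xs => s2 s3; rewrite rep.
  by rewrite cat_rcons.
by apply: (nuniq [::]); apply: contraL sz => /card_uniqP <-; rewrite -leqNgt max_card.
Qed.

End Alternating.

Lemma cobd_lin (R : comNzRingType) (I : finType) (J : Type) (al : I -> R) (z : I -> seq J -> R) t :
  \sum_j al j * cobd (z j) t = cobd (fun t' => \sum_j al j * z j t') t.
Proof.
elim: t z => [|x t IH] z; first by rewrite /cobd /= big1 // => j _; rewrite mulr0.
rewrite /cobd wedge_cons mul1r -[wedge _ _ t](IH (fun j t => z j (x :: t))) -sumrB.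
by apply: eq_bigr => j _; rewrite /cobd wedge_cons mul1r mulrBr.
Qed.

(** * The Čech double complex of two families with the same radical *)

Section Cech.
Variables (R : idomainType) (F : fieldType) (phi : {rmorphism R -> F}).

Definition inR (y : F) := exists r, y = phi r.

Lemma inR0 : inR 0. Proof. by exists 0; rewrite rmorph0. Qed.
Lemma inR_img r : inR (phi r). Proof. by exists r. Qed.
Lemma inRD y y' : inR y -> inR y' -> inR (y + y').
Proof. by move=> [r ->] [r' ->]; exists (r + r'); rewrite rmorphD. Qed.
Lemma inRN y : inR y -> inR (- y).
Proof. by move=> [r ->]; exists (- r); rewrite rmorphN. Qed.
Lemma inRM y y' : inR y -> inR y' -> inR (y * y').
Proof. by move=> [r ->] [r' ->]; exists (r * r'); rewrite rmorphM. Qed.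
Lemma inRX y k : inR y -> inR (y ^+ k).
Proof. by move=> [r ->]; exists (r ^+ k); rewrite rmorphXn. Qed.

Definition prodf (I : Type) (f : I -> R) (s : seq I) : F := \prod_(i <- s) phi (f i).

Lemma prodf_cons (I : Type) (f : I -> R) i s : prodf f (i :: s) = phi (f i) * prodf f s.
Proof. exact: big_cons. Qed.

Lemma inR_prodf (I : Type) (f : I -> R) s : inR (prodf f s).
Proof.
by elim: s => [|i s IH]; [exists 1; rewrite rmorph1 /prodf big_nil | rewrite prodf_cons; apply: inRM => //; apply: inR_img].
Qed.

Lemma inR_le y w k l : inR w -> (k <= l)%N -> inR (y * w ^+ k) -> inR (y * w ^+ l).
Proof. by move=> Hw /subnK <-; rewrite exprD mulrCA => H; apply: inRM => //; apply: inRX. Qed.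

(** [W] carries the factors of the letters that the recursion of [cobd] has already passed. *)
Lemma inR_cobd (I : Type) (f : I -> R) (a k : nat) (W : F) (z : seq I -> F) : inR W ->
  (forall s, size s = a -> inR (z s * (prodf f s * W) ^+ k)) ->
  forall s, size s = a.+1 -> inR (cobd z s * (prodf f s * W) ^+ k).
Proof.
elim: a W z => [|a IH] W z HW H [|x s] // [Es]; rewrite /cobd wedge_cons mul1r mulrBl.
  have s0 : s = [::] by case: s Es.
  apply: inRD; last by rewrite s0 mul0r oppr0; apply: inR0.
  rewrite prodf_cons -mulrA exprMn mulrCA; apply: inRM; first exact/inRX/inR_img.
  exact: H.
apply: inRD.
  rewrite prodf_cons -mulrA exprMn mulrCA; apply: inRM; first exact/inRX/inR_img.
  exact: H.
apply: inRN; have -> : prodf f (x :: s) * W = prodf f s * (phi (f x) * W).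
  by rewrite prodf_cons; ring.
apply: IH Es; first by apply: inRM => //; apply: inR_img.
move=> t Et; have := H (x :: t); rewrite prodf_cons /= Et => /(_ erefl).
by congr inR; congr (_ * _ ^+ _); ring.
Qed.

Variables (A B : finType) (q : A -> R) (m : B -> R).
Hypothesis q_neq0 : forall i, phi (q i) != 0.
Hypothesis m_neq0 : forall j, phi (m j) != 0.
Hypothesis q_rad : forall N, exists e, forall i, exists c : B -> R, q i ^+ e = \sum_j c j * m j ^+ N.
Hypothesis m_rad : forall N, exists e, forall j, exists c : A -> R, m j ^+ e = \sum_i c i * q i ^+ N.
Implicit Types (s : seq A) (t : seq B) (y : seq A -> seq B -> F).

(** Membership in the localizations at the products over [s] and [t], inside [F], with one exponent
    for all of them. *)
Definition cech a b y := exists k, forall s t, size s = a -> size t = b ->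
  inR (y s t * (prodf q s * prodf m t) ^+ k).

Definition alt y := forall t, alternating (fun s => y s t).
Definition dA y s t := cobd (fun s' => y s' t) s.
Definition dB y s t := cobd (y s) t.

Lemma cech_dA a b y : cech a b y -> cech a.+1 b (dA y).
Proof.
move=> [k H]; exists k => s t Es Et; apply: inR_cobd Es => //; first exact: inR_prodf.
by move=> s' Es'; apply: H.
Qed.

Lemma cech_dB a b y : cech a b y -> cech a b.+1 (dB y).
Proof.
move=> [k H]; exists k => s t Es Et; rewrite mulrC -[_ * prodf m t]mulrC mulrC.
apply: inR_cobd Et; first exact: inR_prodf.
by move=> t' Et'; rewrite [_ * prodf q s]mulrC; apply: H.
Qed.

Lemma cechB a b y y' : cech a b y -> cech a b y' -> cech a b (fun s t => y s t - y' s t).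
Proof.
move=> [k H] [l H']; exists (maxn k l) => s t Es Et; rewrite mulrBl.
have W : inR (prodf q s * prodf m t) by apply: inRM; apply: inR_prodf.
apply: inRD; first by apply: inR_le (H _ _ Es Et) => //; apply: leq_maxl.
by apply: inRN; apply: inR_le (H' _ _ Es Et) => //; apply: leq_maxr.
Qed.

Lemma alt_dA y : alt y -> alt (dA y).
Proof. by move=> H t; apply: alternating_cobd. Qed.

Lemma alt_dB y : alt y -> alt (dB y).
Proof.
move=> H t; split=> s1 x.
  move=> x' s2; rewrite /dB /cobd -wedgeN; apply: eq_wedge => // t'; exact: (proj1 (H t')).
move=> s2; rewrite /dB /cobd -[RHS](wedge0 (fun=> 1) t); apply: eq_wedge => // t'; exact: (proj2 (H t')).
Qed.

Lemma altB y y' : alt y -> alt y' -> alt (fun s t => y s t - y' s t).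
Proof.
move=> H H' t; split=> s1 x.
  by move=> x' s2; rewrite (proj1 (H t)) (proj1 (H' t)) opprB opprK addrC.
by move=> s2; rewrite (proj2 (H t)) (proj2 (H' t)) subrr.
Qed.

Lemma dA_dB y s t : dA (dB y) s t = dB (dA y) s t.
Proof.
rewrite /dA /dB; elim: s y => [|x s IH] y; first by rewrite /cobd /= wedge0.
rewrite /cobd wedge_cons mul1r [X in _ - X](IH (fun s => y (x :: s))) -wedgeB.
by apply: eq_wedge => // t'; rewrite /cobd wedge_cons mul1r.
Qed.

(** Once some [q i] is inverted, the powers [m j ^+ k] generate the unit ideal. Contracting with the
    resulting partition of unity is harmless, as its factor [m j ^+ k] clears the pole at the
    inserted [j]. *)
Lemma cech_exactB a b y : alt y -> cech a.+1 b.+1 y ->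
  (forall s t, size s = a.+1 -> size t = b.+2 -> dB y s t = 0) ->
  exists y', [/\ alt y', cech a.+1 b y' &
    forall s t, size s = a.+1 -> size t = b.+1 -> y s t = dB y' s t].
Proof.
move=> Hy [k Hk] H0; have [e /fin_all_exists [c Hc]] := q_rad k.
(* The partition of unity at s only depends on the set of entries of s, so that alternation survives. *)
pose rep s := ohead [seq i <- enum A | i \in s].
pose alpha s j := if rep s is Some i then phi (c i j) * phi (m j) ^+ k / phi (q i) ^+ e else 0.
have repE s s' : s =i s' -> rep s = rep s' by move=> E; rewrite /rep (eq_filter E).
have alphaE s s' j : s =i s' -> alpha s j = alpha s' j by move=> E; rewrite /alpha (repE s s').
have repP s : size s = a.+1 -> exists2 i, i \in s & rep s = Some i.
  case: s => // x s _; rewrite /rep; case E : [seq i <- _ | _] => [|i l].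
    have : x \in [seq i <- enum A | i \in x :: s] by rewrite mem_filter mem_head mem_enum.
    by rewrite E.
  exists i => //; have : i \in [seq i <- enum A | i \in x :: s] by rewrite E mem_head.
  by rewrite mem_filter => /andP [].
have alpha1 s : size s = a.+1 -> \sum_j alpha s j = 1.
  move=> /repP [i _ Ei]; rewrite /alpha Ei -mulr_suml.
  under eq_bigr do rewrite -rmorphXn -rmorphM.
  by rewrite -rmorph_sum -Hc rmorphXn divff // expf_neq0.
exists (fun s t => \sum_j alpha s j * y s (j :: t)); split.
- move=> t; split=> s1 x.
    move=> x' s2; rewrite -sumrN; apply: eq_bigr => j _.
    rewrite (proj1 (Hy (j :: t))) mulrN (alphaE _ (s1 ++ [:: x', x & s2])) // => v.
    by rewrite !mem_cat !inE (orbCA (v == x)).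
  by move=> s2; apply: big1 => j _; rewrite (proj2 (Hy (j :: t))) mulr0.
- exists (k + e)%N => s t Es Et; rewrite mulr_suml.
  apply: big_ind => [||j _]; [exact: inR0 | exact: inRD|].
  have [i si Ei] := repP s Es; rewrite /alpha Ei.
  have [V EV VR] : exists2 V, prodf q s = phi (q i) * V & inR V.
    case/splitPr: si => s1 s2; exists (prodf q (s1 ++ s2)); last exact: inR_prodf.
    by rewrite /prodf !big_cat big_cons /=; ring.
  have -> : phi (c i j) * phi (m j) ^+ k / phi (q i) ^+ e * y s (j :: t) *
      (prodf q s * prodf m t) ^+ (k + e) =
      phi (c i j) * (V * prodf m t) ^+ e * (y s (j :: t) * (prodf q s * prodf m (j :: t)) ^+ k).
    rewrite exprD prodf_cons {2}EV !exprMn; field.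
    by rewrite expf_neq0.
  apply: inRM; last by apply: Hk; rewrite //= Et.
  apply: inRM; first exact: inR_img.
  by apply/inRX/inRM => //; apply: inR_prodf.
- move=> s t Es Et; rewrite /dB /cobd.
  transitivity (\sum_j alpha s j * cobd (fun t' => y s (j :: t')) t).
    rewrite -[LHS]mul1r -(alpha1 s Es) mulr_suml; apply: eq_bigr => j _; congr (_ * _).
    have /eqP := H0 s (j :: t) Es (congr1 S Et).
    by rewrite /dB /cobd wedge_cons mul1r subr_eq0 => /eqP.
  exact: cobd_lin.
Qed.

(** The same with the families exchanged. The partition of unity may be read off the head of [t],
    since alternation is only demanded in [s]. *)
Lemma cech_exactA a b y : alt y -> cech a.+1 b.+1 y ->
  (forall s t, size s = a.+2 -> size t = b.+1 -> dA y s t = 0) ->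
  exists y', [/\ alt y', cech a b.+1 y' &
    forall s t, size s = a.+1 -> size t = b.+1 -> y s t = dA y' s t].
Proof.
move=> Hy [k Hk] H0; have [e /fin_all_exists [c Hc]] := m_rad k.
pose alpha t i := if t is j :: _ then phi (c j i) * phi (q i) ^+ k / phi (m j) ^+ e else 0.
have alpha1 t : size t = b.+1 -> \sum_i alpha t i = 1.
  case: t => // j t _; rewrite /alpha -mulr_suml.
  under eq_bigr do rewrite -rmorphXn -rmorphM.
  by rewrite -rmorph_sum -Hc rmorphXn divff // expf_neq0.
exists (fun s t => \sum_i alpha t i * y (i :: s) t); split.
- move=> t; split=> s1 x.
    move=> x' s2; rewrite -sumrN; apply: eq_bigr => i _.
    by rewrite -cat_cons (proj1 (Hy t)) mulrN.
  by move=> s2; apply: big1 => i _; rewrite -cat_cons (proj2 (Hy t)) mulr0.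
- exists (k + e)%N => s t Es Et; rewrite mulr_suml.
  apply: big_ind => [||i _]; [exact: inR0 | exact: inRD|].
  case: t Et => // j t Et; rewrite /alpha.
  have -> : phi (c j i) * phi (q i) ^+ k / phi (m j) ^+ e * y (i :: s) (j :: t) *
      (prodf q s * prodf m (j :: t)) ^+ (k + e) =
      phi (c j i) * (prodf q s * prodf m t) ^+ e *
        (y (i :: s) (j :: t) * (prodf q (i :: s) * prodf m (j :: t)) ^+ k).
    rewrite exprD !prodf_cons !exprMn; field.
    by rewrite expf_neq0.
  apply: inRM; last by apply: Hk; rewrite //= Es.
  apply: inRM; first exact: inR_img.
  by apply/inRX/inRM; apply: inR_prodf.
- move=> s t Es Et; rewrite /dA.
  transitivity (\sum_i alpha t i * cobd (fun s' => y (i :: s') t) s).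
    rewrite -[LHS]mul1r -(alpha1 t Et) mulr_suml; apply: eq_bigr => i _; congr (_ * _).
    have /eqP := H0 (i :: s) t (congr1 S Es) Et.
    by rewrite /dA /cobd wedge_cons mul1r subr_eq0 => /eqP.
  exact: cobd_lin.
Qed.

(** A zigzag with [d] steps left. It ends at a = #|A|, where [dA y] alternates in more indices than
    [A] has elements and so vanishes. *)
Lemma cech_chase (p : nat) : (#|A| < p)%N -> forall d a b y, (d + a = #|A|)%N -> (a + b.+1 = p)%N ->
  alt y -> cech a b.+1 y ->
  (forall s t, size s = a.+1 -> size t = b.+2 -> dA (dB y) s t = 0) ->
  exists x, [/\ alt x, cech a b x &
    forall s t, size s = a.+1 -> size t = b.+1 -> dA y s t = dA (dB x) s t].
Proof.
move=> Ap; elim=> [|d IH] a b y Ed Ep Hy Hc H0.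
  exists (fun _ _ => 0); split.
  - by move=> t; split=> *; rewrite ?oppr0.
  - by exists 0%N => s t _ _; rewrite mul0r; apply: inR0.
  - move=> s t Es _; rewrite (alternating_big (alt_dA Hy t)); last by rewrite Es -Ed.
    rewrite /dA /cobd (@eq_wedge _ _ _ (fun=> 1) _ (fun=> 0)) ?wedge0 // => s'.
    by rewrite /dB /cobd wedge0.
case: b Ep Hc H0 => [|b] Ep Hc H0; first by exfalso; move: Ap Ed Ep; lia.
have [|y' [Hy' Hc' E]] := cech_exactB (alt_dA Hy) (cech_dA Hc).
  by move=> s t Es Et; rewrite -dA_dB H0.
have [|||x' [Hx' Hcx' E']] := IH a.+1 b y' _ _ Hy' Hc'.
- by rewrite addnS.
- by rewrite addSn -addnS.
- move=> s t Es Et; rewrite -[RHS](cobd_cobd (fun s => y s t) s) {1}/dA /cobd.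
  by apply: eq_wedge_size => s'; rewrite Es => - [Es']; rewrite -E.
have [|||x [Hx Hcx Ex]] := @cech_exactA a b (fun s t => y' s t - dB x' s t).
- by apply: altB => //; apply: alt_dB.
- by apply: cechB => //; apply: cech_dB.
- move=> s t Es Et; have := E' s t Es Et; rewrite /dA /cobd => E1.
  by rewrite wedgeB E1 subrr.
exists x; split=> // s t Es Et; rewrite E // dA_dB {2}/dB /cobd.
transitivity (cobd (fun t' => y' s t' - dB x' s t') t); last first.
  by apply: eq_wedge_size => t'; rewrite Et => - [Et']; rewrite Ex.
by rewrite /cobd wedgeB [X in _ - X](cobd_cobd (x' s)) subr0.
Qed.

(** The cocycle is placed at the edge a = 0 of the double complex; any one index from [A] recovers
    it from [dA y]. *)
Lemma cech_vanish (p : nat) (z : seq B -> F) : (0 < #|A|)%N -> (#|A| <= p)%N ->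
  (exists k, forall t, size t = p.+1 -> inR (z t * prodf m t ^+ k)) ->
  (forall t, size t = p.+2 -> cobd z t = 0) ->
  exists eta, (exists k, forall t, size t = p -> inR (eta t * prodf m t ^+ k)) /\
    forall t, size t = p.+1 -> z t = cobd eta t.
Proof.
move=> /card_gt0P [i _] Ap [k Hk] Hz.
pose y s t := if s is [::] then z t else 0.
have dyE j t : dA y [:: j] t = z t by rewrite /dA /cobd /= mul1r subr0.
have [|||||x [_ [l Hl] Hx]] := @cech_chase p.+1 Ap #|A| 0 p y.
- by rewrite addn0.
- by rewrite add0n.
- by move=> t; split=> [[|??]|[|??]] *; rewrite /= ?oppr0.
- exists k => s t /size0nil -> Et; rewrite /prodf big_nil mul1r; exact: Hk.
- move=> [|j [|??]] t // _ Et; rewrite /dA /cobd wedge_cons /= subr0 mul1r.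
  exact: Hz.
exists (x [::]); split=> [|t Et].
  by exists l => t Et; have := Hl [::] t erefl Et; rewrite {1}/prodf big_nil mul1r.
by rewrite -(dyE i) Hx // /dA /cobd wedge_cons /= subr0 mul1r.
Qed.

End Cech.

(** * Passage to the fraction field, uniform exponents, and the lower bound for ara *)

Section Morphisms.
Variables (R S : comNzRingType) (phi : {rmorphism R -> S}).

Lemma rmorph_wedge (I : Type) (f : I -> R) (z : seq I -> R) s :
  phi (wedge f z s) = wedge (fun x => phi (f x)) (fun t => phi (z t)) s.
Proof.
elim: s z => [|x s IH] z /=; first exact: rmorph0.
by rewrite rmorphB rmorphM IH.
Qed.

Lemma rmorph_topc (I : Type) (J : eqType) (f : I -> J) (js : seq J) s :
  phi (topc R f js s) = topc S f js s.
Proof.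
elim: js s => [|j js IH] s /=; first exact: rmorph_nat.
by rewrite rmorph_wedge; apply: eq_wedge => // x; rewrite /ind rmorph_nat.
Qed.

Lemma rmorph_pairing (I : finType) p (c w : seq I -> R) :
  phi (pairing p c w) = pairing p (fun t => phi (c t)) (fun t => phi (w t)).
Proof.
elim: p c w => [|p IH] c w /=; first exact: rmorphM.
by rewrite rmorph_sum; apply: eq_bigr => v _; rewrite IH.
Qed.

End Morphisms.

Lemma pairing_scalel (I : finType) (R : comNzRingType) p a (c w : seq I -> R) :
  pairing p (fun t => a * c t) w = a * pairing p c w.
Proof.
elim: p c w => [|p IH] c w /=; first by rewrite mulrA.
by rewrite mulr_sumr; apply: eq_bigr => v _; rewrite IH.
Qed.

Lemma mulV_cancel (F : fieldType) (x c d : F) : x != 0 -> x^-1 * c * (d * x) = c * d.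
Proof. by move=> x0; field. Qed.

Lemma mul_rearrange (F : comNzRingType) (a b c d : F) : a * b * (c * d) = c * (a * d * b).
Proof. by ring. Qed.

Section Radicals.
Variables (K : fieldType) (n : nat).
Local Notation R := {mpoly K[n]}.
Implicit Types (f : R) (gs : seq R).

Lemma in_ideal_map (I : eqType) (s : seq I) (h : I -> R) f : uniq s ->
  in_ideal [seq h i | i <- s] f -> exists c : I -> R, f = \sum_(i <- s) c i * h i.
Proof.
elim: s f => [|i s IH] f /=; first by move=> _ /in_ideal_nil ->; exists (fun=> 0); rewrite big_nil.
move=> /andP [si U] /in_ideal_cons [c [g [-> /(IH _ U) [d ->]]]].
exists (fun j => if j == i then c else d j); rewrite big_cons eqxx; congr (_ + _).
by apply: eq_big_seq => j js; case: eqP si => // <-; rewrite js.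
Qed.

Lemma in_rad_powers (gs : seq R) f N : in_rad gs f -> in_rad [seq g ^+ N | g <- gs] f.
Proof.
apply: in_rad_sub => g ggs; exists N; apply: mem_in_ideal.
exact: (map_f (fun g => g ^+ N)).
Qed.

Lemma rad_uniform (I J : finType) (h : I -> R) (F : J -> R) N :
  (forall j, in_rad [seq h i | i <- enum I] (F j)) ->
  exists e, forall j, exists c : I -> R, F j ^+ e = \sum_i c i * h i ^+ N.
Proof.
move=> H; have /fin_all_exists [e He] : forall j, exists e, in_ideal [seq h i ^+ N | i <- enum I] (F j ^+ e).
  by move=> j; have [e] := in_rad_powers N (H j); rewrite -map_comp; exists e.
exists (\max_j e j)%N => j.
have /(in_ideal_map (enum_uniq I)) [c ->] : in_ideal [seq h i ^+ N | i <- enum I] (F j ^+ (\max_j e j)).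
  by apply: in_ideal_exp (He j); apply: (leq_bigmax j).
by exists c; rewrite big_enum.
Qed.

End Radicals.

(* Čech cohomology on the monomial generators in degree #js: the class topc/X_b is not a coboundary,
   whereas it would have to be one if fewer than #js polynomials defined the same radical. *)
Theorem ara_lower (K : fieldType) (n : nat) (B : finType) (g : B -> {set 'I_n}) (b : {set 'I_n})
  (J : eqType) (f : B -> J) (js : seq J) (omega : seq B -> {mpoly K[n]}) :
  uniq js -> (forall v, f v \in js) -> js != [::] ->
  (forall t, {subset js <= map f t} -> b \subset \bigcup_(j in t) g j) ->
  pairing (size js) (topc _ f js) omega = 1 ->
  (forall t, (size t).+1 = size js -> b \subset \bigcup_(j in t) g j -> bd omega t = 0) ->
  forall qs, same_rad qs [seq sqf_mon K (g j) | j <- enum B] -> (size js <= size qs)%N.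
Proof.
move=> Ujs fjs js0 Hcov Hpair Hbd qs0 Hrad0; rewrite leqNgt; apply/negP => Hsz0.
(* The Čech complex inverts the polynomials, so zeros are removed first. *)
pose qs := [seq h <- qs0 | h != 0].
have qs_neq0 h : h \in qs -> h != 0 by rewrite mem_filter => /andP [].
have Hsz : (size qs < size js)%N by apply: leq_ltn_trans Hsz0; rewrite size_filter count_size.
have Hrad f0 : in_rad qs f0 <-> in_rad [seq sqf_mon K (g j) | j <- enum B] f0.
  rewrite -Hrad0; split; apply: in_rad_sub => h.
    by rewrite mem_filter => /andP [_ ?]; apply/ideal_rad/mem_in_ideal.
  move=> hq; apply: ideal_rad; case: (eqVneq h 0) => [->|h0]; first exact: in_ideal0.
  by apply: mem_in_ideal; rewrite mem_filter h0.
clearbody qs; clear Hrad0 Hsz0 qs0.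
pose A := 'I_(size qs); pose q (i : A) := qs`_i; pose m j := sqf_mon K (g j).
pose phi : {rmorphism {mpoly K[n]} -> {fraction {mpoly K[n]}}} := @tofrac {mpoly K[n]}.
have phi_inj x y : phi x = phi y -> x = y by move/eqP; rewrite tofrac_eq => /eqP.
have phi_eq0 x : (phi x == 0) = (x == 0) by apply: tofrac_eq0.
have q0 i : phi (q i) != 0 by rewrite phi_eq0 qs_neq0 // mem_nth.
have m0 j : phi (m j) != 0 by rewrite phi_eq0 /m sqf_monE mpolyX_neq0.
have qsE : qs = [seq q i | i <- enum A].
  apply: (@eq_from_nth _ 0) => [|k kl]; first by rewrite size_map size_enum_ord.
  by rewrite (nth_map (Ordinal kl)) ?size_enum_ord // /q nth_enum_ord.
have q_rad N : exists e, forall i, exists c : B -> {mpoly K[n]}, q i ^+ e = \sum_j c j * m j ^+ N.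
  apply: rad_uniform => i; apply/Hrad; exact/ideal_rad/mem_in_ideal/mem_nth.
have m_rad N : exists e, forall j, exists c : A -> {mpoly K[n]}, m j ^+ e = \sum_i c i * q i ^+ N.
  apply: rad_uniform => j; rewrite -qsE; apply/Hrad/ideal_rad/mem_in_ideal.
  by apply: map_f; rewrite mem_enum.
have [p Ep] : exists p, size js = p.+1 by case: (js) js0 => // j l _; exists (size l).
have A0 : (0 < #|A|)%N.
  rewrite card_ord lt0n size_eq0; apply/eqP => qs_nil.
  case: (pickP (mem B)) => [j _|B0].
    have /Hrad : in_rad [seq sqf_mon K (g j) | j <- enum B] (m j).
      by apply/ideal_rad/mem_in_ideal/map_f; rewrite mem_enum.
    rewrite qs_nil => - [k /in_ideal_nil /eqP]; rewrite expf_eq0 => /andP [_].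
    by rewrite -phi_eq0 (negbTE (m0 j)).
  have /eqP := Hpair; rewrite Ep /= big1 => [|v _]; first by rewrite eq_sym oner_eq0.
  by have := B0 v; rewrite inE.
pose mt (t : seq B) : 'X_{1..n} := (\sum_(j <- t) set_mnm (g j))%MM.
have prodE t : prodf phi m t = phi 'X_[mt t].
  have <- : \prod_(j <- t) m j = 'X_[mt t].
    by rewrite /mt -mprodXE; apply: eq_bigr => j _; rewrite /m sqf_monE.
  by rewrite /prodf rmorph_prod.
have mtE t i : mt t i = (\sum_(j <- t) (i \in g j))%N.
  by rewrite /mt mnm_sumE; apply: eq_bigr => j _; rewrite mnmE.
have mt_cov t : b \subset \bigcup_(j in t) g j -> (set_mnm b <= mt t)%MM.
  move=> /subsetP Hb; apply/mnm_lepP => i; rewrite mnmE mtE.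
  case ib : (i \in b) => //; have /bigcupP [j jt ij] := Hb i ib.
  by rewrite (big_rem j jt) /= ij.
pose z t := (phi 'X_[set_mnm b])^-1 * topc {fraction {mpoly K[n]}} f js t.
have Xb0 a : phi 'X_[a] != 0 by rewrite phi_eq0 mpolyX_neq0.
have [|||eta [[k Hk] Heta]] := cech_vanish q0 m0 q_rad m_rad (p := p) (z := z) A0.
- by rewrite card_ord -ltnS -Ep.
(* Exponent 1 suffices: where [topc] is non-zero, [t] covers [b], so X_b divides the product of the
   generators in [t]. *)
- exists 1%N => t _; rewrite expr1 /z prodE.
  have [c0|ne] := eqVneq (topc {fraction {mpoly K[n]}} f js t) 0.
    by rewrite c0 mulr0 mul0r; apply: inR0.
  rewrite (mpolyX_dvd K (mt_cov t (Hcov t (topc_neq0 ne)))) rmorphM -(rmorph_topc phi).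
  have -> : (phi 'X_[(set_mnm b)])^-1 * phi (topc {mpoly K[n]} f js t) *
     (phi 'X_[(mt t - set_mnm b)] * phi 'X_[(set_mnm b)]) = phi (topc {mpoly K[n]} f js t * 'X_[(mt t - set_mnm b)]).
    by rewrite rmorphM mulV_cancel.
  exact: inR_img.
- by move=> t _; rewrite /z /cobd wedgeM [wedge _ _ _](cobd_topc _ _ Ujs fjs) mulr0.
have E1 : pairing p.+1 z (fun t => phi (omega t)) = (phi 'X_[set_mnm b])^-1.
  have := congr1 phi Hpair; rewrite rmorph1 rmorph_pairing Ep => E0.
  rewrite pairing_scalel -[RHS]mulr1 -E0; congr (_ * _).
  by apply: pairing_eq => t _; rewrite rmorph_topc.
have {Hpair} E2 : pairing p.+1 z (fun t => phi (omega t)) =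
    pairing p eta (fun t => phi (bd omega t)).
  transitivity (pairing p.+1 (cobd eta) (fun t => phi (omega t))).
    by apply: pairing_eq => t Et; rewrite Heta.
  by rewrite stokes; apply: pairing_eq => t _; rewrite raddf_bd.
(* The exponent k p clears the poles of [eta] on [p] generators; one more makes X_b divide [X]. *)
pose e := (k * p).+1; pose X : 'X_{1..n} := (set_mnm setT *+ e)%MM.
have bX : (set_mnm b <= X)%MM.
  by apply/mnm_lepP => i; rewrite mulmnE !mnmE inE mul1n; case: (i \in b).
pose N y := exists rho, y * phi 'X_[X] = phi rho /\ rho@_(X - set_mnm b)%MM = 0.
suff: N (phi 'X_[set_mnm b])^-1.
  move=> [rho []]; rewrite (mpolyX_dvd K bX) rmorphM mulrCA mulVf // mulr1 => /phi_inj <-.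
  by move/eqP; rewrite mcoeffX eqxx oner_eq0.
rewrite -E1 E2; refine (@pairing_ind B _ N _ _ _ _ _ _) => [|y y' [r [Ey Er]] [r' [Ey' Er']]|t Et].
- by exists 0; rewrite mul0r rmorph0 mcoeff0.
- by exists (r + r'); rewrite mulrDl Ey Ey' rmorphD mcoeffD Er Er' addr0.
have [/(Hbd t)|] := boolP (b \subset \bigcup_(j in t) g j).
  rewrite Et Ep => ->; rewrite // rmorph0 mulr0; exists 0; by rewrite mul0r rmorph0 mcoeff0.
(* No generator in [t] involves [v], so clearing the pole leaves the full power [e] of [v], whereas
   [X] divided by X_b contains only the power e - 1. *)
move=> /subsetPn [v vb vt]; have [r Er] := Hk t Et.
have mtX : (mt t *+ k <= X)%MM.
  apply/mnm_lepP => i; rewrite !mulmnE mnmE inE mul1n mtE; apply: leqW; rewrite mulnC leq_mul2l.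
  by rewrite -Et -sum1_size leq_sum ?orbT // => j _; case: (i \in _).
have mtv : mt t v = 0%N.
  rewrite mtE big1_seq // => j /andP [_ jt]; case vj : (v \in g j) => //.
  by case/negP: vt; apply/bigcupP; exists j.
exists ('X_[X - mt t *+ k] * (r * bd omega t)); split.
  by rewrite (mpolyX_dvd K mtX) !rmorphM -mpolyXn rmorphXn -prodE -Er mul_rearrange.
apply/eqP; apply: contraT => /mdvdX /mnm_lepP /(_ v).
by rewrite !mnmBE !mulmnE mtv mul0n !mnmE inE vb subn0 mul1n /e subn1 ltnn.
Qed.

(** * Mapping cones of free resolutions *)

Section Resolutions.
Variables (K : fieldType) (n : nat).
Local Notation R := {mpoly K[n]}.
Implicit Types (P J : R -> Prop).

(* free_res, for an ideal given as a predicate. *)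
Definition resolution P (r : nat -> nat) (D : forall i, 'M[R]_(r i.+1, r i)) : Prop :=
  [/\ r 0%N = 1%N,
      (forall f : R, (exists v : 'rV[R]_(r 1%N),
          exists j : 'I_(r 0%N), (v *m D 0%N) ord0 j = f) <-> P f) &
      (forall (i : nat) (v : 'rV[R]_(r i.+1)),
          v *m D i = 0 <-> exists u : 'rV[R]_(r i.+2), u *m D i.+1 = v)].

Definition pd_le P q := exists r D, @resolution P r D /\ forall i, (q < i)%N -> r i = 0%N.

Lemma pd_le_ext P P' q : (forall f, P f <-> P' f) -> pd_le P q -> pd_le P' q.
Proof.
move=> E [r [D [[r0 id0 ex] rq]]]; exists r, D; split=> //; split=> // f.
by rewrite id0 E.
Qed.

Lemma pd_le_mono P q q' : (q <= q')%N -> pd_le P q -> pd_le P q'.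
Proof.
move=> qq [r [D [res rq]]]; exists r, D; split=> // i qi; apply: rq.
exact: leq_ltn_trans qi.
Qed.

Lemma pd_le_zero : pd_le (fun f => f = 0) 0.
Proof.
exists (fun i => (i == 0)%N : nat), (fun i => 0); split=> [|[]//]; split=> // [f|i v].
  split=> [[v [j <-]]|->]; first by rewrite mulmx0 mxE.
  by exists 0, ord0; rewrite mulmx0 mxE.
split=> [_|_]; last by rewrite mulmx0.
by exists 0; apply/rowP => - [].
Qed.

Lemma resolution_lift_rows P r D : @resolution P r D ->
  forall i k (M : 'M[R]_(k, r i.+1)), M *m D i = 0 -> exists N, N *m D i.+1 == M.
Proof.
move=> [_ _ ex] i k M M0.
have /fin_all_exists [u Hu] : forall l : 'I_k, exists u : 'rV[R]_(r i.+2), u *m D i.+1 = row l M.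
  by move=> l; apply/ex; rewrite -row_mul M0 row0.
by exists (\matrix_l u l); apply/eqP/row_matrixP => l; rewrite row_mul rowK.
Qed.

Section MappingCone.
Variables (J : R -> Prop) (m : R) (r s : nat -> nat).
Variables (D : forall i, 'M[R]_(r i.+1, r i)) (E : forall i, 'M[R]_(s i.+1, s i)).
Hypotheses (resD : resolution J D) (resE : resolution (fun f => J (f * m)) E).

(** Lifts multiplication by [m], from R/(J : m) to R/J, to the resolutions. *)
Lemma cone_map : exists al : forall i, 'M[R]_(s i, r i),
  (forall j k, al 0%N j k = m) /\ forall i, al i.+1 *m D i = E i *m al i.
Proof.
have [r0 idD _] := resD; have [s0 idE exE] := resE.
have base : exists b, b *m D 0%N == E 0%N *m const_mx m.
  have /fin_all_exists [u Hu] : forall l : 'I_(s 1%N), exists u : 'rV[R]_(r 1%N),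
      u *m D 0%N = row l (E 0%N *m const_mx m).
    move=> l; have j0 : 'I_(s 0%N) by rewrite s0; exact: ord0.
    have /idD [v [j Ev]] : J (E 0%N l j0 * m).
      apply/(idE (E 0%N l j0)); exists (delta_mx ord0 l), j0.
      by rewrite -rowE mxE.
    exists v; apply/rowP => k.
    have -> : k = j by move: (k) (j); rewrite r0 => a b; rewrite !ord1.
    rewrite Ev !mxE (bigD1 j0) //= big1 ?addr0 ?mxE // => k' nk.
    by case/eqP: nk; move: (k') (j0); rewrite s0 => a b; rewrite !ord1.
  by exists (\matrix_l u l); apply/eqP/row_matrixP => l; rewrite row_mul rowK.
(* [good] keeps the existence of the next map as a boolean equation, so that [xchoose] makes it a
   value and the chain map can be defined by recursion. *)
pose good i (a : 'M[R]_(s i, r i)) := exists b, b *m D i == E i *m a.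
have step i (a : {a | good i a}) : {b : {b | good i.+1 b} | sval b *m D i = E i *m sval a}.
  case: a => a ga /=; have Eb := xchooseP ga; move: (xchoose ga) Eb => b /eqP Eb.
  suff gb : good i.+1 b by exists (exist _ b gb).
  apply: (resolution_lift_rows resD); rewrite -mulmxA Eb mulmxA.
  suff -> : E i.+1 *m E i = 0 by rewrite mul0mx.
  apply/row_matrixP => l; rewrite row_mul row0; apply/exE.
  by exists (delta_mx ord0 l); rewrite -rowE.
pose al := fix al i : {a | good i a} := if i is i'.+1 then sval (step i' (al i')) else exist _ (const_mx m) base.
exists (fun i => sval (al i)); split=> [j k|i]; first by rewrite mxE.
exact: (svalP (step i (al i))).
Qed.

End MappingCone.

(** The cone resolves the last term of 0 -> R/(J : m) -> R/J -> R/P -> 0. *)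
Lemma pd_le_cone J m P q : pd_le J q.+1 -> pd_le (fun f => J (f * m)) q ->
  (forall f, P f <-> exists c h, f = c * m + h /\ J h) -> pd_le P q.+1.
Proof.
move=> [r [D [resD rq]]] [s [E [resE sq]]] HP.
have [al [al0 alS]] := cone_map resD resE.
pose rr i := if i is k.+1 then (r k.+1 + s k)%N else r 0%N.
pose DD i : 'M[R]_(rr i.+1, rr i) := match i return 'M[R]_(rr i.+1, rr i) with
  | 0 => col_mx (D 0%N) (al 0%N)
  | k.+1 => block_mx (D k.+1) 0 (al k.+1) (- E k)
  end.
exists rr, DD; split; last first.
  by case=> // i qi; rewrite /rr rq // sq.
have [r0 idD exD] := resD; have [s0 idE exE] := resE.
have j0 : 'I_(r 0%N) by rewrite r0; exact: ord0.
have k0 : 'I_(s 0%N) by rewrite s0; exact: ord0.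
have rall (j : 'I_(r 0%N)) : j = j0 by move: (j) (j0); rewrite r0 => a b; rewrite !ord1.
have sall (j : 'I_(s 0%N)) : j = k0 by move: (j) (k0); rewrite s0 => a b; rewrite !ord1.
have mul_al0 (v : 'rV[R]_(s 0%N)) : (v *m al 0%N) ord0 j0 = v ord0 k0 * m.
  rewrite mxE (bigD1 k0) //= al0 big1 ?addr0 // => k.
  by rewrite (sall k) eqxx.
split=> // [f|[|i] v].
- rewrite HP; split=> [[v [j <-]]|[c [h [-> /idD [v [j Ev]]]]]].
    rewrite -[v]hsubmxK mul_row_col mxE (rall j) mul_al0 addrC.
    do 2 eexists; split; first by [].
    by apply/idD; do 2 eexists.
  exists (row_mx v (const_mx c)), j0; rewrite mul_row_col mxE mul_al0 [const_mx _ _ _]mxE addrC.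
  by rewrite -Ev (rall j).
- rewrite -[v]hsubmxK; move: (lsubmx v) (rsubmx v) => v1 v2 {v}; rewrite mul_row_col; split; last first.
    move=> [u]; rewrite -[u]hsubmxK mul_row_block => /eq_row_mx [<- <-].
    have DD0 (w : 'rV[R]_(r 2%N)) : w *m D 1%N *m D 0%N = 0 by apply/exD; exists w.
    by rewrite mulmx0 add0r mulmxDl DD0 add0r mulmxN mulNmx -!mulmxA alS subrr.
  move=> Hv; have : J (- v2 ord0 k0 * m).
    apply/idD; exists v1, j0; move/rowP/(_ j0): Hv.
    by rewrite [LHS]mxE mul_al0 [RHS]mxE => /eqP; rewrite addr_eq0 => /eqP ->; rewrite mulNr.
  move=> /(idE (- v2 ord0 k0)) [u2 [k Eu2]].
  have Eu : u2 *m E 0%N = - v2 by apply/rowP => l; rewrite (sall l) -(sall k) Eu2 mxE (sall k).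
  have /exD [u1 Eu1] : (v1 - u2 *m al 1%N) *m D 0%N = 0.
    rewrite mulmxBl -mulmxA alS mulmxA Eu mulNmx opprK; exact: Hv.
  exists (row_mx u1 u2); rewrite mul_row_block mulmx0 add0r Eu1 subrK mulmxN Eu.
  by rewrite opprK.
- rewrite -[v]hsubmxK; move: (lsubmx v) (rsubmx v) => v1 v2 {v}; rewrite mul_row_block mulmx0 add0r; split; last first.
    move=> [u]; rewrite -[u]hsubmxK mul_row_block => /eq_row_mx [<- <-].
    have DD0 (w : 'rV[R]_(r i.+3)) : w *m D i.+2 *m D i.+1 = 0 by apply/exD; exists w.
    have EE0 (w : 'rV[R]_(s i.+2)) : w *m E i.+1 *m E i = 0 by apply/exE; exists w.
    rewrite mulmx0 add0r mulmxDl DD0 add0r mulmxN mulNmx -!mulmxA alS subrr.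
    by rewrite mulmxN mulNmx EE0 !oppr0 row_mx0.
  rewrite -[X in _ = X]row_mx0 => /eq_row_mx [H1 H2].
  have /exE [u2 Eu2] : - v2 *m E i = 0 by rewrite mulNmx -mulmxN.
  have /exD [u1 Eu1] : (v1 - u2 *m al i.+2) *m D i.+1 = 0.
    by rewrite mulmxBl -mulmxA alS mulmxA Eu2 mulNmx opprK.
  exists (row_mx u1 u2); rewrite mul_row_block mulmx0 add0r Eu1 subrK mulmxN Eu2.
  by rewrite opprK.
Qed.

End Resolutions.

(** * Blocks of generators *)

Section Groups.
Variables (K : fieldType) (n : nat).
Local Notation R := {mpoly K[n]}.
Local Notation sets := {set 'I_n}.

Definition mon_ideal (L : seq sets) (f : R) := in_ideal [seq sqf_mon K A | A <- L] f.

Lemma mon_ideal_ext (L L' : seq sets) :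
  (forall A, A \in L -> exists2 B, B \in L' & B \subset A) ->
  (forall A, A \in L' -> exists2 B, B \in L & B \subset A) ->
  forall f, mon_ideal L f <-> mon_ideal L' f.
Proof.
move=> H H' f; rewrite /mon_ideal !in_mon_idealP.
split=> Hf a /Hf [A]; [move=> /H | move=> /H'] => - [B BL BA] Aa; exists B => //;
  by apply: lepm_trans Aa; rewrite set_mnm_subset.
Qed.

Lemma mon_ideal_colon (L : seq sets) A f :
  mon_ideal L (f * sqf_mon K A) <-> mon_ideal [seq B :\: A | B <- L] f.
Proof.
rewrite /mon_ideal !in_mon_idealP sqf_monE; split=> H a Ha.
  have [|B BL /mnm_lepP Ble] := H (set_mnm A + a)%MM; first by rewrite mcoeffMX.
  exists (B :\: A); first exact: map_f.
  apply/mnm_lepP => i; move: (Ble i); rewrite mnmDE !mnmE inE.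
  by case: (i \in A).
have le1 : (set_mnm A <= a)%MM by move: Ha; rewrite mulrC; apply: mdvdX.
have [|_ /mapP [B BL ->] /mnm_lepP Ble] := H (a - set_mnm A)%MM.
  by move: Ha; rewrite -{1}(submK le1) addmC mcoeffMX.
exists B => //; apply/mnm_lepP => i; move: (Ble i) (mnm_lepP le1 i).
by rewrite mnmBE !mnmE inE; case: (i \in A); case: (i \in B) => //=; rewrite subn0.
Qed.

(* Blocks of generators: a block of k generators with k >= 2 costs only k - 1 homological degrees. *)
Inductive block := Single of sets | Pair of sets & sets | Triple of sets & sets & sets.

Definition gens b := match b with
  | Single A => [:: A] | Pair C B => [:: C; B] | Triple C A B => [:: C; A; B] end.
Definition weight b := match b with Single _ => 1%N | Pair _ _ => 1%N | Triple _ _ _ => 2 end.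
Definition okb b := match b with
  | Single _ => true | Pair C B => C \subset B | Triple C A B => C \subset A :|: B end.
Definition colonb A b := match b with
  | Single B => Single (B :\: A) | Pair C B => Pair (C :\: A) (B :\: A)
  | Triple C B B' => Triple (C :\: A) (B :\: A) (B' :\: A) end.

Lemma okb_colon A b : okb b -> okb (colonb A b).
Proof.
by case: b => //= [C B|C B B'] H; rewrite -?setDUl; apply: setSD.
Qed.

Lemma weight_colon A b : weight (colonb A b) = weight b. Proof. by case: b. Qed.
Lemma gens_colon A b : gens (colonb A b) = [seq B :\: A | B <- gens b]. Proof. by case: b. Qed.

Definition all_gens bs := flatten [seq gens b | b <- bs].
Definition total_weight bs := sumn [seq weight b | b <- bs].

Lemma all_gens_cons b bs : all_gens (b :: bs) = gens b ++ all_gens bs. Proof. by []. Qed.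

Lemma all_gens_colon A bs : all_gens [seq colonb A b | b <- bs] = [seq B :\: A | B <- all_gens bs].
Proof.
rewrite /all_gens map_flatten -!map_comp; congr flatten; apply: eq_map => b; exact: gens_colon.
Qed.

Lemma total_weight_colon A bs : total_weight [seq colonb A b | b <- bs] = total_weight bs.
Proof. by rewrite /total_weight -map_comp; congr sumn; apply: eq_map => b; exact: weight_colon. Qed.

(** For a triple, the cone adds [A] to the ideal with [C] and [B] single. In the colon ideal by [A],
    what is left of [C] divides what is left of [B]: a pair of weight 1, which the shift raises to
    2. A pair just drops its redundant member. *)
Lemma pd_le_blocks bs : all okb bs -> pd_le (mon_ideal (all_gens bs)) (total_weight bs).
Proof.
have [N] := ubnP (size (all_gens bs)); elim: N bs => // N IH [|b bs]; rewrite ltnS => sz.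
  by move=> _; apply: pd_le_ext (pd_le_zero K n) => f; rewrite /mon_ideal /= in_ideal_nil.
have okc A cs : all okb cs -> all okb [seq colonb A b | b <- cs].
  by rewrite all_map; apply: sub_all => c; apply: okb_colon.
have cone A cs ds w : (size (all_gens cs) < N)%N -> (size (all_gens ds) < N)%N -> all okb cs -> all okb ds ->
    (forall B, B \in all_gens ds -> exists2 B', B' \in [seq C :\: A | C <- all_gens cs] & B' \subset B) ->
    (forall B, B \in [seq C :\: A | C <- all_gens cs] -> exists2 B', B' \in all_gens ds & B' \subset B) ->
    (total_weight cs <= w.+1)%N -> (total_weight ds <= w)%N -> pd_le (mon_ideal (A :: all_gens cs)) w.+1.
  move=> szc szd okcs okds h1 h2 wc wd; apply: (@pd_le_cone _ _ (mon_ideal (all_gens cs)) (sqf_mon K A)).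
  - exact: pd_le_mono wc (IH _ szc okcs).
  - apply: pd_le_ext (pd_le_mono wd (IH _ szd okds)) => f; rewrite mon_ideal_colon.
    exact: mon_ideal_ext.
  - by move=> f; rewrite /mon_ideal /= in_ideal_cons.
have id2 (L : seq sets) : forall B, B \in L -> exists2 B', B' \in L & B' \subset B.
  by move=> B BL; exists B.
case: b sz => [A|C B|C A B] /= sz; rewrite ?andTb => H.
- apply: (cone A bs [seq colonb A b | b <- bs]) => //; try (by rewrite all_gens_colon; apply: id2).
  + by rewrite all_gens_colon size_map.
  + exact: okc.
  + by rewrite total_weight_colon.
- case/andP: H => CB okbs.
  apply: pd_le_ext (IH (Single C :: bs) sz okbs).
  apply: mon_ideal_ext => D; rewrite /all_gens /= !inE.
    by move=> HD; exists D => //; rewrite !inE; case/orP: HD => ->; rewrite ?orbT.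
  case/or3P => [/eqP -> |/eqP ->|HD]; [exists C | exists C | exists D] => //; rewrite !inE ?eqxx ?HD ?orbT //.
- case/andP: H => CAB okbs.
  pose ds := Pair (C :\: A) (B :\: A) :: [seq colonb A b | b <- bs].
  have Eds : all_gens ds = [seq D :\: A | D <- all_gens [:: Single C, Single B & bs]].
    by rewrite !all_gens_cons all_gens_colon.
  have okds : all okb ds.
    rewrite /= okc // andbT; apply/subsetP => i; rewrite !inE => /andP [iA iC].
    by move/subsetP/(_ i iC): CAB; rewrite iA inE (negbTE iA).
  have szc : (size (all_gens [:: Single C, Single B & bs]) < N)%N by apply: sz.
  have H1 : pd_le (mon_ideal (A :: all_gens [:: Single C, Single B & bs])) (total_weight bs).+2.
    apply: (cone A [:: Single C, Single B & bs] ds (total_weight bs).+1) => //.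
    - by rewrite Eds size_map.
    - by rewrite Eds; apply: id2.
    - by rewrite Eds; apply: id2.
    - by rewrite /total_weight /= -/(total_weight _) -[X in (X <= _)%N]/(total_weight [seq colonb A b | b <- bs]).+1 total_weight_colon.
  apply: pd_le_ext H1; apply: mon_ideal_ext => D; rewrite !all_gens_cons !inE => HD; exists D => //;
    by rewrite !inE; case/or4P: HD => ->; rewrite ?orbT.
Qed.

End Groups.

(** * Upper bound for the projective dimension *)

Section PdUpper.
Variables (K : fieldType) (n : nat) (T : finType).
Implicit Types (O : {set T}) (m l : seq T).

Lemma total_weight_cons (b : block n) bs : total_weight (b :: bs) = (weight b + total_weight bs)%N. Proof. by []. Qed.

(* Used with h = g and, for the colon by the generator g a, with h = g \ g a: there an open last vertex,
   being a neighbour of a, only needs its other neighbour. *)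
Lemma greedy_blocks (h : T -> {set 'I_n}) O v m :
  (forall y i z, infix3 y i z (v :: m) -> i \in O -> h i \subset h y :|: h z) ->
  (forall s y i, v :: m = s ++ [:: y; i] -> i \in O -> h i \subset h y) ->
  exists bs, [/\ all (@okb n) bs, all_gens bs =i [seq h j | j <- v :: m] &
    (total_weight bs + greedy O m = (size m).+1)%N].
Proof.
have [N] := ubnP (size m); elim: N v m => // N IH v m; rewrite ltnS => sz H3 H2.
case: m sz H3 H2 => [|x m] sz H3 H2; first by exists [:: Single (h v)].
rewrite greedy_drop; case: ifP => xO; last first.
  have [|y i z Hi|s y i E|bs [ok eqi tot]] := IH x m.
  - by [].
  - exact/H3/infix3_cons.
  - by apply: (H2 (v :: s)); rewrite E.
  - exists (Single (h v) :: bs); split=> //; last by rewrite total_weight_cons /= -tot.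
    by move=> A; rewrite all_gens_cons mem_cat eqi !inE.
case: m sz H3 H2 => [|x' [|v' m]] sz H3 H2.
- exists [:: Pair (h x) (h v)]; split=> //=.
    by rewrite andbT; apply: (H2 [::]).
  by move=> A; rewrite !inE orbC.
- exists [:: Triple (h x) (h v) (h x')]; split=> //=.
    by rewrite andbT; apply: H3 => //; exists [::], [::].
  by move=> A; rewrite !inE orbCA.
- rewrite drop2_cons.
  have [|y i z Hi|s y i E|bs [ok eqi tot]] := IH v' m.
  - by move: sz => /=; lia.
  - exact/H3/infix3_cons/infix3_cons/infix3_cons.
  - by apply: (H2 [:: v, x, x' & s]); rewrite E.
  - exists (Triple (h x) (h v) (h x') :: bs); split=> /=.
    + by rewrite ok andbT; apply: H3 => //; exists [::], (v' :: m).
    + move=> A; rewrite all_gens_cons mem_cat eqi [RHS]in_cons [in RHS]in_cons [in X in _ || (_ || X)]in_cons !inE.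
      by case: (A == h x); case: (A == h v); case: (A == h x').
    + by rewrite total_weight_cons /= -tot; lia.
Qed.

Lemma greedy_rcons_closed O m y : y \notin O -> greedy O (rcons m y) = greedy O m.
Proof.
move=> yO; have [N] := ubnP (size m); elim: N m => // N IH m; rewrite ltnS => sz.
case: m sz => [|b m] sz; first by rewrite /= (negbTE yO).
rewrite rcons_cons !greedy_drop; case: (b \in O); last exact: IH.
case: m sz => [|c [|d m]] sz; rewrite /= ?drop0 //.
by rewrite IH //; move: sz => /=; lia.
Qed.

Theorem pd_upper (g : T -> {set 'I_n}) O a x l y :
  uniq (a :: x :: rcons l y) ->
  (forall u i w, infix3 u i w (a :: x :: rcons (rcons l y) a) -> i \in O -> g i \subset g u :|: g w) ->
  pd_le (@mon_ideal K n [seq g j | j <- a :: x :: rcons l y])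
    (size (a :: x :: rcons l y) - minn (greedy O (x :: rcons l y)) (greedy O l).+1).
Proof.
move=> U H.
have sub_infix u i w s1 s2 s : infix3 u i w s -> s1 ++ s ++ s2 = a :: x :: rcons (rcons l y) a ->
    infix3 u i w (a :: x :: rcons (rcons l y) a).
  by move=> [t1 [t2 ->]] <-; exists (s1 ++ t1), (t2 ++ s2); rewrite !catA -!catA.
set t := minn _ _.
(* Here [y] counts as closed, because its neighbour [a] is absent. *)
have [bJ [okJ genJ totJ]] : exists bs, [/\ all (@okb n) bs, all_gens bs =i [seq g j | j <- x :: rcons l y] &
    (total_weight bs + greedy (O :\ y) (rcons l y) = (size (rcons l y)).+1)%N].
  apply: greedy_blocks => [u i w Hi|s u i E]; rewrite in_setD1 => /andP [iy iO].
    by apply: H iO; apply: (sub_infix _ _ _ [:: a] [:: a] _ Hi); rewrite /= cats1.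
  move: E; rewrite -rcons_cons -[s ++ _]/(s ++ ([:: u] ++ [:: i])) catA cats1 => /rcons_inj [_ yi].
  by rewrite yi eqxx in iy.
have [bC [okC genC totC]] : exists bs, [/\ all (@okb n) bs,
    all_gens bs =i [seq g j :\: g a | j <- x :: rcons l y] &
    (total_weight bs + greedy O (x :: rcons l y) = (size (x :: rcons l y)))%N].
  pose h j := g j :\: g a.
  have hD u i w : g i \subset g u :|: g w -> h i \subset h u :|: h w.
    by move=> /subsetP Hi; rewrite /h -setDUl; apply/setSD/subsetP.
  have ha : h a = set0 by rewrite /h setDv.
  have last_h s u i : x :: rcons l y = s ++ [:: u; i] -> i \in O -> h i \subset h u.
    move=> E iO; rewrite -[h u]setU0 -ha; apply/hD/H => //.
    by exists (a :: s), [::]; rewrite -rcons_cons E cat_cons -cats1 -catA.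
  case: (boolP (x \in O)) => xO; last first.
    rewrite greedy_drop (negbTE xO); apply: greedy_blocks => [u i w Hi iO|].
      by apply/hD/H => //; apply: (sub_infix _ _ _ [:: a] [:: a] _ Hi); rewrite /= cats1.
    exact: last_h.
  have [x2 [m2 Em]] : exists x2 m2, rcons l y = x2 :: m2 by case: (l) => [|x2 m2]; do 2 eexists.
  have hx : h x \subset h x2.
    rewrite -[h x2]set0U -ha; apply/hD/H => //.
    by exists [::], (rcons m2 a); rewrite Em.
  (* The open end [x] pairs with its only remaining neighbour [x2]. The second skipped letter [v]
     starts the blocks of the rest. *)
  rewrite Em greedy_drop xO; case: m2 Em => [|v m2] Em.
    exists [:: Pair (h x) (h x2)]; split=> //=; by rewrite hx.
  have [u i w Hi iO|s u i E|bs [ok gen tot]] := @greedy_blocks h O v m2.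
  - apply/hD/H => //; apply: (sub_infix _ _ _ [:: a; x; x2] [:: a] _ Hi).
    by rewrite Em /= cats1.
  - by apply: (last_h [:: x, x2 & s]); rewrite Em E.
  - exists (Pair (h x) (h x2) :: bs); split=> /=.
    + by rewrite hx.
    + by move=> A; rewrite all_gens_cons mem_cat gen -mem_cat.
    + by rewrite total_weight_cons drop0 /= -tot; lia.
have Gy : greedy (O :\ y) (rcons l y) = greedy O l.
  rewrite greedy_rcons_closed ?greedy_D1 ?setD11 //.
  by move: U => /= /and3P [_ _]; rewrite rcons_uniq => /andP [].
rewrite Gy in totJ.
have [q Eq] : exists q, (size (a :: x :: rcons l y) - t = q.+1)%N.
  exists (size (x :: rcons l y) - t)%N; rewrite /= subSn //.
  by apply: leq_trans (geq_minl _ _) _; rewrite -[X in (_ <= X)%N]totC leq_addl.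
rewrite Eq; apply: (@pd_le_cone _ _ (@mon_ideal K n [seq g j | j <- x :: rcons l y]) (sqf_mon K (g a))).
- apply: (@pd_le_mono _ _ _ (total_weight bJ)).
    by rewrite -Eq /= /t; move: totJ => /=; lia.
  apply: pd_le_ext (pd_le_blocks K okJ); apply: mon_ideal_ext => A HA; exists A => //.
    by rewrite -genJ.
  by rewrite genJ.
- apply: (@pd_le_mono _ _ _ (total_weight bC)).
    by rewrite -ltnS -Eq /= /t; move: totC => /=; lia.
  apply: pd_le_ext (pd_le_blocks K okC) => f; rewrite mon_ideal_colon -map_comp.
  apply: mon_ideal_ext => A HA; exists A => //; first by rewrite -genC.
  by rewrite genC.
- by move=> f; rewrite /mon_ideal /= in_ideal_cons.
Qed.

End PdUpper.

(** * Chains with a single simplex *)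

Section Delta.
Variables (I : finType) (A : comNzRingType).
Implicit Types (s t : seq I) (w : seq I -> A).

Definition delta s t : A := (t == s)%:R.

Lemma delta_neq0 s t : delta s t != 0 -> t = s.
Proof. by rewrite /delta; case: (t =P s) => // _; rewrite eqxx. Qed.

Lemma bd_neq0 w t : bd w t != 0 -> exists s1 x s2, t = s1 ++ s2 /\ w (s1 ++ x :: s2) != 0.
Proof.
have sum_neq0 (F : I -> A) : \sum_v F v != 0 -> exists v, F v != 0.
  move=> H; case: (pickP (fun v => F v != 0)) => [v Fv|F0]; first by exists v.
  by case/eqP: H; apply: big1 => v _; apply/eqP; rewrite -[_ == _]negbK F0.
elim: t w => [|x t IH] w.
  by move=> /sum_neq0 [v wv]; exists [::], v, [::].
rewrite bd_cons; case: (eqVneq (\sum_v w [:: v, x & t]) 0) => [->|/sum_neq0 [v wv] _].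
  rewrite sub0r oppr_eq0 => /IH [s1 [v [s2 [-> H]]]].
  by exists (x :: s1), v, s2.
by exists [::], v, (x :: t).
Qed.

Lemma pairing_delta p c s : size s = p -> pairing p c (delta s) = c s.
Proof.
elim: s p c => [|x s IH] [|p] // c; first by rewrite /= /delta eqxx mulr1.
move=> [Es] /=; rewrite (bigD1 x) //= [X in _ + X]big1 => [|v vx].
  rewrite addr0 -(IH p (fun t => c (x :: t)) Es); apply: pairing_eq => t _.
  by rewrite /delta eqseq_cons eqxx.
rewrite -(pairing0r p (fun t => c (v :: t))); apply: pairing_eq => t _.
by rewrite /delta eqseq_cons (negbTE vx).
Qed.

End Delta.

(** * Lower bounds from minimal primes *)

Section PrimeData.
Variables (K : fieldType) (n : nat) (T : finType) (g : T -> {set 'I_n}).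
Local Notation dat := ('I_n * T)%type.
Implicit Types (ps : seq dat) (s : seq T).

(* A minimal prime (p.1)_{p in ps} of the ideal of the generators in s,
   where p.2 is a generator that p.1 alone divides. *)
Definition prime_data s ps :=
  [/\ uniq ps, forall p, p \in ps -> p.2 \in s,
      forall p k, p \in ps -> p.1 \in g k -> k \in s,
      forall p p', p \in ps -> p' \in ps -> (p.1 \in g p'.2) = (p == p') &
      forall j, j \in s -> exists2 p, p \in ps & p.1 \in g j].

Lemma prime_data_cat s1 s2 ps1 ps2 : ~~ has (mem s1) s2 ->
  prime_data s1 ps1 -> prime_data s2 ps2 -> prime_data (s1 ++ s2) (ps1 ++ ps2).
Proof.
move=> /hasPn dis [U1 A1 B1 C1 D1] [U2 A2 B2 C2 D2]; split.
- rewrite cat_uniq U1 U2 andbT /=; apply/hasPn => p p2; apply/negP => p1.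
  by have /negP := dis _ (A2 _ p2); apply; apply: A1.
- by move=> p; rewrite !mem_cat => /orP [/A1 ->|/A2 ->]; rewrite ?orbT.
- by move=> p k; rewrite !mem_cat => /orP [/B1 H /H ->|/B2 H /H ->]; rewrite ?orbT.
- move=> p p'; rewrite !mem_cat => /orP [h|h] /orP [h'|h']; first exact: C1.
  + have /negbTE -> : p != p' by apply: contraL (A2 _ h') => /eqP <-; apply: contraL (A1 _ h); apply: dis.
    by apply: contraTF (A2 _ h') => /(B1 _ _ h) h1; apply: contraL h1; apply: dis.
  + have /negbTE -> : p != p' by apply: contraL (A2 _ h) => /eqP ->; apply: contraL (A1 _ h'); apply: dis.
    by apply: contraTF (A1 _ h') => /(B2 _ _ h); apply: dis.
  + exact: C2.
- move=> j; rewrite mem_cat => /orP [/D1|/D2] [p h pj]; exists p => //; by rewrite mem_cat h ?orbT.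
Qed.

Lemma prime_data_single j v : (forall k, (v \in g k) = (k == j)) -> prime_data [:: j] [:: (v, j)].
Proof.
move=> Hv; split=> // [p|p k|p p'|k].
- by rewrite !inE => /eqP ->.
- by rewrite !inE => /eqP -> /=; rewrite Hv.
- by rewrite !inE => /eqP -> /eqP -> /=; rewrite Hv !eqxx.
- by rewrite inE => /eqP ->; exists (v, j); rewrite ?inE //= Hv.
Qed.

Lemma prime_data_pair y z v : (forall k, (v \in g k) = (k == y) || (k == z)) ->
  prime_data [:: y; z] [:: (v, y)].
Proof.
move=> Hv; split=> // [p|p k|p p'|k].
- by rewrite !inE => /eqP -> /=; rewrite eqxx.
- by rewrite !inE => /eqP -> /=; rewrite Hv.
- by rewrite !inE => /eqP -> /eqP -> /=; rewrite Hv !eqxx.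
- by rewrite !inE => Hk; exists (v, y); rewrite ?inE //= Hv.
Qed.

(** Two edges cover three vertices, and each outer vertex belongs to one of them only. *)
Lemma prime_data_triple x y z v v' : uniq [:: x; y; z] ->
  (forall k, (v \in g k) = (k == x) || (k == y)) -> (forall k, (v' \in g k) = (k == y) || (k == z)) ->
  prime_data [:: x; y; z] [:: (v, x); (v', z)].
Proof.
rewrite /= !inE negb_or andbT => /andP [/andP [xy xz] yz] Hv Hv'; split=> // [|p|p k|p p'|k].
- by rewrite /= !inE xpair_eqE (negbTE xz) andbF.
- by rewrite !inE => /orP [] /eqP -> /=; rewrite ?eqxx ?orbT.
- by rewrite !inE => /orP [] /eqP -> /=; rewrite ?Hv ?Hv' => /orP [] ->; rewrite ?orbT.
- rewrite !inE => /orP [] /eqP -> /orP [] /eqP -> /=; rewrite ?Hv ?Hv' ?eqxx ?orbT //.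
    by rewrite xpair_eqE ![z == _]eq_sym (negbTE xz) (negbTE yz) andbF.
  by rewrite xpair_eqE [z == _]eq_sym (negbTE xz) (negbTE xy) andbF.
- rewrite !inE orbA => /orP [h|h]; [exists (v, x) | exists (v', z)]; rewrite ?inE ?eqxx ?orbT //= ?Hv ?Hv' //.
  by rewrite h orbT.
Qed.

Variable O : {set T}.
Hypothesis closed_var : forall j, j \notin O -> exists v, forall k, (v \in g k) = (k == j).

Definition has_edges s := forall s1 y z s2, s = s1 ++ [:: y, z & s2] ->
  exists v, forall k, (v \in g k) = (k == y) || (k == z).

Lemma has_edges_cat s1 s2 : has_edges (s1 ++ s2) -> has_edges s2.
Proof. by move=> H t1 y z t2 E; apply: (H (s1 ++ t1) y z t2); rewrite E catA. Qed.

(** A closed letter takes its own variable; an open one and its two successors take two edges. At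
    most two letters, the first open, then remain before [tail]; [k0] is the extra saving of the
    tail. *)
Lemma prime_data_greedy (tail : seq T) (k0 : nat) :
  (forall m, m = [::] \/ (exists x, m = [:: x]) \/ (exists x x', m = [:: x; x']) ->
     (if m is x :: _ then x \in O else true) ->
     uniq (m ++ tail) -> has_edges (m ++ tail) ->
     exists ps, prime_data (m ++ tail) ps /\ (size ps + greedy O m + k0 = size m + size tail)%N) ->
  forall m, uniq (m ++ tail) -> has_edges (m ++ tail) ->
  exists ps, prime_data (m ++ tail) ps /\ (size ps + greedy O m + k0 = size m + size tail)%N.
Proof.
move=> base m; have [N] := ubnP (size m); elim: N m => // N IH m; rewrite ltnS => sz U E.
case: m sz U E => [|x m] sz U E; first by apply: base => //; left.
case: (boolP (x \in O)) => xO; last first.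
  have [v Hv] := closed_var xO.
  have [||ps [Hps szps]] := IH m sz.
  - by move: U => /= /andP [].
  - exact: (@has_edges_cat [:: x]).
  exists ((v, x) :: ps); split; last by rewrite greedy_drop (negbTE xO) /= !addSn szps.
  apply: (@prime_data_cat [:: x] _ [:: (v, x)]) => //; last exact: prime_data_single.
  move: U => /= /andP [xm _]; apply/hasPn => y ym.
  by apply: contra xm => /=; rewrite inE => /eqP <-.
case: m sz U E => [|x' [|x'' m]] sz U E.
- by apply: base => //; right; left; exists x.
- by apply: base => //; right; right; exists x, x'.
have [v Hv] := E [::] x x' _ erefl; have [v' Hv'] := E [:: x] x' x'' _ erefl.
have [|||ps [Hps szps]] := IH m.
- by move: sz => /=; lia.
- by move: U => /= /and4P [].
- exact: (@has_edges_cat [:: x; x'; x'']).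
exists ([:: (v, x); (v', x'')] ++ ps); split.
  apply: (@prime_data_cat [:: x; x'; x'']) => //.
    move: U; rewrite -[_ ++ tail]/([:: x; x'; x''] ++ (m ++ tail)) cat_uniq => /and3P [_ H _].
    exact: H.
  apply: prime_data_triple => //.
  by move: U; rewrite -[_ ++ tail]/([:: x; x'; x''] ++ (m ++ tail)) cat_uniq => /and3P [].
by rewrite greedy_drop xO drop2_cons size_cat /= addnS !addSn szps addnC.
Qed.

(** The closed end joins the one or two leftover letters in a stretch of two or three, or uses its
    own variable. *)
Lemma prime_data_closed_end m e : e \notin O -> uniq (rcons m e) -> has_edges (rcons m e) ->
  exists ps, prime_data (rcons m e) ps /\ (size ps + greedy O m = size (rcons m e))%N.
Proof.
move=> eO; rewrite -cats1 => U E.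
have [|ps [H1 H2]] := @prime_data_greedy [:: e] 0 _ m U E; last first.
  by exists ps; split=> //; rewrite size_cat -H2 addn0.
move=> {U E} {}m [->|[[x ->]|[x [x' ->]]]] xO U E.
- have [v Hv] := closed_var eO; exists [:: (v, e)]; split=> //; exact: prime_data_single.
- have [v Hv] := E [::] x e _ erefl; exists [:: (v, x)]; split; first exact: prime_data_pair.
  by rewrite /= xO.
- have [v Hv] := E [::] x x' _ erefl; have [v' Hv'] := E [:: x] x' e _ erefl.
  exists [:: (v, x); (v', e)]; split; first exact: prime_data_triple.
  by rewrite /= xO.
Qed.

(** The tail is a stretch of three. One leftover letter regroups it into two pairs; two leftover
    letters form a pair of their own. *)
Lemma prime_data_triple_end m y a x : uniq (m ++ [:: y; a; x]) -> has_edges (m ++ [:: y; a; x]) ->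
  exists ps, prime_data (m ++ [:: y; a; x]) ps /\ (size ps + (greedy O m).+1 = size m + 3)%N.
Proof.
move=> U E; have [|ps [H1 H2]] := @prime_data_greedy [:: y; a; x] 1 _ m U E; last first.
  by exists ps; split=> //; rewrite -H2 addnS addn1.
move=> {U E} {}m [->|[[z ->]|[z [z' ->]]]] zO U E.
- have [v Hv] := E [::] y a _ erefl; have [v' Hv'] := E [:: y] a x _ erefl.
  by exists [:: (v, y); (v', x)]; split=> //; apply: prime_data_triple.
- have [v Hv] := E [::] z y _ erefl; have [v' Hv'] := E [:: z; y] a x _ erefl.
  exists [:: (v, z); (v', a)]; split; last by rewrite /= zO.
  apply: (@prime_data_cat [:: z; y] [:: a; x] [:: (v, z)]); try exact: prime_data_pair.
  by move: U; rewrite -[[:: z] ++ _]/([:: z; y] ++ [:: a; x]) cat_uniq => /and3P [].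
- have [v Hv] := E [::] z z' _ erefl; have [v' Hv'] := E [:: z; z'] y a _ erefl.
  have [w Hw] := E [:: z; z'; y] a x _ erefl.
  move: U; rewrite -[[:: z; z'] ++ _]/([:: z; z'] ++ [:: y; a; x]) cat_uniq => /and3P [_ U1 U2].
  exists [:: (v, z); (v', y); (w, x)]; split; last by rewrite /= zO.
  apply: (@prime_data_cat [:: z; z'] [:: y; a; x] [:: (v, z)]) => //; first exact: prime_data_pair.
  exact: prime_data_triple.
Qed.

Variables (s : seq T) (ps : seq dat).
Hypotheses (sT : forall j, j \in s) (Hps : prime_data s ps) (ps0 : ps != [::]).

(** The chain is the simplex of the private generators [p.2]. A facet omits one of them, and the
    variable belonging to it divides none of the others, so no facet covers the prime. *)
Lemma prime_ara_lower qs : same_rad qs [seq sqf_mon K (g j) | j <- enum T] -> (size ps <= size qs)%N.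
Proof.
have [U A B C D] := Hps.
have p0 : exists p, p \in ps by case: (ps) ps0 => // p l _; exists p; rewrite mem_head.
have [d _] := p0; pose f j := nth d ps (find (fun p => p.1 \in g j) ps).
have fP j : f j \in ps /\ (f j).1 \in g j.
  have h : has (fun p => p.1 \in g j) ps by have [p pps pj] := D j (sT j); apply/hasP; exists p.
  by split; [apply: mem_nth; rewrite -has_find | apply: (nth_find d h)].
have fid p : p \in ps -> f p.2 = p.
  by move=> pps; have [h1 h2] := fP p.2; move: h2; rewrite C // => /eqP.
have mapf : map f (map snd ps) = ps.
  by rewrite -map_comp -[RHS]map_id; apply/eq_in_map => p /fid.
apply: (@ara_lower K n T g [set p.1 | p in ps] _ f ps (@delta T _ (map snd ps))) => //.
- by move=> j; have [] := fP j.
- move=> t Ht; apply/subsetP => _ /imsetP [p pps ->].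
  have /mapP [j jt pj] := Ht p pps; apply/bigcupP; exists j => //.
  by rewrite pj; have [] := fP j.
- by rewrite pairing_delta ?size_map // -{1}mapf topc_id // mapf.
- move=> t Et Hc; apply/eqP; apply: contraT => /bd_neq0 [t1 [x [t2 [Et12 Hd]]]].
  have E := delta_neq0 Hd.
  have : f x \in ps by have [] := fP x.
  have mapf' : map f t1 ++ f x :: map f t2 = ps by rewrite -[RHS]mapf -E map_cat.
  move=> fx; have /bigcupP [j jt xj] : (f x).1 \in \bigcup_(j in t) g j.
    by apply: (subsetP Hc); apply: imset_f.
  have js : j \in map snd ps by rewrite -E mem_cat inE; move: jt; rewrite Et12 mem_cat => /orP [->|->]; rewrite ?orbT.
  case/mapP: js => p' p'ps Ej; move: xj; rewrite Ej C // => /eqP fxp'.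
  have : f j \in map f (t1 ++ t2) by rewrite map_f -?Et12.
  rewrite Ej fid // -fxp' map_cat mem_cat => H.
  by move: U; rewrite -mapf' uniq_catC cat_cons /= mem_cat orbC H.
Qed.

(** Dually, the simplex consists of the variables of the prime: a facet omits one, and then misses
    its private generator. *)
Lemma prime_pd_lower r D : free_res [seq sqf_mon K (g j) | j <- enum T] (r := r) D ->
  forall q, (forall i, (q < i)%N -> r i = 0%N) -> (size ps <= q)%N.
Proof.
have [U A1 B C E] := Hps => resD q rq.
have p0 : exists p, p \in ps by case: (ps) ps0 => // p l _; exists p; rewrite mem_head.
have [d _] := p0; pose I := 'I_(size ps); pose p (i : I) := nth d ps i.
have pps i : p i \in ps by apply: mem_nth.
have p_inj i i' : (p i == p i') = (i == i') by rewrite nth_uniq.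
rewrite -(size_enum_ord (size ps)).
have {}resD : free_res [seq sqf_mon K A | A <- [seq g j | j <- enum T]] D by rewrite -map_comp.
apply: (@pd_lower K n _ I (fun i => (p i).1) _ id (enum I) (@delta I _ (enum I)) _ _ _ _ _ r D resD q rq).
- exact: enum_uniq.
- by move=> i; rewrite mem_enum.
- move=> t Ht _ /mapP [j _ ->]; have [p' p'ps p'j] := E j (sT j).
  have i0 : (index p' ps < size ps)%N by rewrite index_mem.
  apply/pred0Pn; exists p'.1; rewrite /= p'j /=; apply/imsetP; exists (Ordinal i0).
    by rewrite -[Ordinal _]/(id (Ordinal i0)) -(map_id t); apply: Ht; rewrite mem_enum.
  by rewrite /p /= nth_index.
- by rewrite pairing_delta // -{1}(map_id (enum I)) topc_id // map_id enum_uniq.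
- move=> t Et Hc; apply/eqP; apply: contraT => /bd_neq0 [t1 [x [t2 [Et12 Hd]]]].
  have Ee := delta_neq0 Hd.
  have /pred0Pn [v /andP [/= vg /imsetP [i it Ev]]] := Hc (g (p x).2) (map_f _ (mem_enum _ _)).
  move: vg; rewrite Ev C // p_inj => /eqP Eix; move: (enum_uniq I).
  by rewrite -Ee uniq_catC cat_cons /= mem_cat orbC -mem_cat -Et12 -Eix it.
Qed.

End PrimeData.

(** * The boundary of a single simplex *)

Section DeltaBoundary.
Variables (I : finType) (A : comNzRingType).
Implicit Types (s t : seq I).

Lemma bdM c (w : seq I -> A) t : bd (fun u => c * w u) t = c * bd w t.
Proof.
elim: t w => [|x t IH] w /=; first by rewrite mulr_sumr.
by rewrite IH mulrBr mulr_sumr.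
Qed.

Lemma bd_delta_cons x s t : bd (delta A (x :: s)) t =
  (t == s)%:R - (if t is y :: t' then (y == x)%:R * bd (delta A s) t' else 0).
Proof.
have E u : \sum_v delta A (x :: s) (v :: u) = (u == s)%:R.
  rewrite (bigD1 x) //= big1 => [|v vx]; first by rewrite addr0 /delta eqseq_cons eqxx.
  by rewrite /delta eqseq_cons (negbTE vx).
case: t => [|y t]; first by rewrite /= E subr0.
rewrite bd_cons E -bdM; congr (_ - _); apply: eq_bd_size => u _.
by rewrite /delta eqseq_cons; case: (y == x); rewrite ?mul1r ?mul0r.
Qed.

Lemma bd_delta_del s1 x s2 : uniq (s1 ++ x :: s2) ->
  bd (delta A (s1 ++ x :: s2)) (s1 ++ s2) = (-1) ^+ size s1.
Proof.
elim: s1 => [|y s1 IH] U.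
  rewrite bd_delta_cons eqxx expr0; case: s2 U => [|y s2] U; first by rewrite subr0.
  move: U => /=; rewrite inE negb_or eq_sym => /andP [/andP [/negbTE -> _] _].
  by rewrite mul0r subr0.
move: U; rewrite cat_cons cons_uniq => /andP [ys U].
rewrite !cat_cons bd_delta_cons eqxx mul1r IH // exprS mulN1r.
case: eqP => [E|_]; last by rewrite sub0r.
by case/negP: ys; rewrite -E mem_head.
Qed.

Lemma rem_del s1 (x : I) s2 : x \notin s1 -> rem x (s1 ++ x :: s2) = s1 ++ s2.
Proof.
elim: s1 => [|y s1 IH] /=; first by rewrite eqxx.
by rewrite inE negb_or eq_sym => /andP [/negbTE -> /IH ->].
Qed.

Lemma del_inj s1 s2 t1 t2 (x : I) : uniq (s1 ++ x :: s2) ->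
  s1 ++ x :: s2 = t1 ++ x :: t2 -> s1 ++ s2 = t1 ++ t2.
Proof.
have nin u1 u2 : uniq (u1 ++ x :: u2) -> x \notin u1.
  by rewrite uniq_catC /= mem_cat negb_or => /andP [/andP []].
move=> U E; have U' := U; rewrite E in U'.
by rewrite -(rem_del s2 (nin _ _ U)) -(rem_del t2 (nin _ _ U')) E.
Qed.

End DeltaBoundary.

(** * The explicit chain for 3k + 1 open vertices *)

Section Exceptional.
Variables (T : finType) (nxt : T -> T) (A : comNzRingType).
Local Notation block := (T * T * T)%type.
Implicit Types (bs : seq block) (s t pre : seq T) (b : block).

(* The vertices of the cycle are z and the letters of k blocks (u, v, w); below, the cochain is pulled back
   along the map w |-> v. In omega, the boundary of the term of block i turns the pair uw of that block
   into uv, up to simplices that are not good, so that the boundary of omega telescopes. *)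
Definition fl bs := flatten [seq [:: b.1.1; b.1.2; b.2] | b <- bs].
Definition al bs := flatten [seq [:: b.1.1; b.2] | b <- bs].
Definition be bs := flatten [seq [:: b.1.1; b.1.2] | b <- bs].

Fixpoint linked p bs z : Prop :=
  if bs is b :: bs' then [/\ nxt p = b.1.1, nxt b.1.1 = b.1.2, nxt b.1.2 = b.2 & linked b.2 bs' z]
  else nxt p = z.

(** Vertex covers of the cycle. Both tests reduce to this: the generators in [t] involve all edge
    variables, and the edge variables indexed by [t] meet all generators. *)
Definition good t := forall y, (y \in t) || (nxt y \in t).

(** Deleting such an [x] from [s] uncovers the edge between [x] and [y]. *)
Definition locked s x := exists2 y, y \notin s & nxt x = y \/ nxt y = x.

Lemma sub_cat_cons s1 (x : T) s2 : {subset s1 ++ s2 <= s1 ++ x :: s2}.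
Proof. by move=> y; rewrite !mem_cat inE => /orP [->|->]; rewrite ?orbT. Qed.

Lemma locked_not_good s1 x s2 : uniq (s1 ++ x :: s2) -> locked (s1 ++ x :: s2) x ->
  ~ good (s1 ++ s2).
Proof.
move=> U [y ys H] G.
have xt : x \notin s1 ++ s2 by move: U; rewrite uniq_catC /= mem_cat orbC -mem_cat => /andP [].
have yt : y \notin s1 ++ s2.
  by apply: contra ys; rewrite !mem_cat inE => /orP [->|->]; rewrite ?orbT.
case: H => [H|H]; [have := G x | have := G y]; rewrite H; by rewrite (negbTE xt) (negbTE yt).
Qed.

Fixpoint omega pre bs t : A :=
  if bs is b :: bs' then
    delta A (pre ++ [:: b.1.1; b.1.2; b.2] ++ al bs') t + omega (pre ++ [:: b.1.1; b.1.2]) bs' t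
  else 0.

Lemma al_sub bs : {subset al bs <= fl bs}.
Proof.
elim: bs => // b bs IH x; rewrite /al /fl /= !inE => /or3P [->|->|/IH]; rewrite ?orbT //.
by rewrite /fl => ->; rewrite !orbT.
Qed.

Lemma be_sub bs : {subset be bs <= fl bs}.
Proof.
elim: bs => // b bs IH x; rewrite /be /fl /= !inE => /or3P [->|->|/IH]; rewrite ?orbT //.
by rewrite /fl => ->; rewrite !orbT.
Qed.

Lemma uniq_al pre bs : uniq (pre ++ fl bs) -> uniq (pre ++ al bs).
Proof.
rewrite !cat_uniq => /and3P [-> /hasPn H U]; apply/and3P; split=> //.
  by apply/hasPn => x /al_sub /H.
elim: bs U {H} => // b bs IH; rewrite /fl /al /= -/(fl bs) -/(al bs) !inE !negb_or.
move=> /and4P [/and3P [h1 h2 h3] /andP [h4 h5] h6 /IH ->]; rewrite h2 andbT /=.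
by apply/andP; split; [apply: contra h3 | apply: contra h6]; apply: al_sub.
Qed.

Lemma al_locked p bs z x : linked p bs z -> uniq (fl bs) -> x \in al bs ->
  exists2 y, (y \in fl bs) && (y \notin al bs) & nxt x = y \/ nxt y = x.
Proof.
elim: bs p => // b bs IH p; rewrite /fl /al /= -/(fl bs) -/(al bs).
move=> [_ uv vw L]; rewrite !inE !negb_or => /and4P [/and3P [h1 h2 h3] /andP [h4 h5] h6 U].
have vbs : b.1.2 \notin al bs by apply: contra h5; apply: al_sub.
case/or3P => [/eqP ->|/eqP ->|/(IH _ L U) [y /andP [y1 y2] H]].
- by exists b.1.2; [rewrite !inE eqxx orbT /= !negb_or eq_sym h1 h4 vbs | left].
- by exists b.1.2; [rewrite !inE eqxx orbT /= !negb_or eq_sym h1 h4 vbs | right].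
- exists y => //; rewrite !inE y1 !orbT /= !negb_or y2 andbT.
  by apply/andP; split; [apply: contraNneq h3 => <- | apply: contraNneq h6 => <-].
Qed.

Lemma be_last_locked p bs z : linked p bs z -> uniq (fl bs) -> bs != [::] ->
  exists2 y, (y \in fl bs) && (y \notin be bs) & nxt y = z.
Proof.
elim: bs p => // b bs IH p; rewrite /fl /be /= -/(fl bs) -/(be bs).
move=> [_ uv vw L]; rewrite !inE !negb_or => /and4P [/and3P [h1 h2 h3] /andP [h4 h5] h6 U] _.
case: (eqVneq bs [::]) L => [-> /= L|bs0 L].
  by exists b.2 => //; rewrite !inE eqxx !orbT /= negb_or !(eq_sym b.2) h2 h4.
have [y /andP [y1 y2] H] := IH _ L U bs0; exists y => //.
rewrite !inE y1 !orbT /= !negb_or y2 andbT.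
by apply/andP; split; [apply: contraNneq h3 => <- | apply: contraNneq h5 => <-].
Qed.

(** All letters but the second and third of [b] are locked: those of [pre] by assumption, the first
    of [b] by [p], the later ones by the omitted middle letter of their block. Two faces remain, and
    the even length of [pre] fixes their signs. *)
Lemma bd_block pre p b bs z t : uniq (pre ++ fl (b :: bs)) -> ~~ odd (size pre) ->
  (forall x, x \in pre -> locked (pre ++ fl (b :: bs)) x) ->
  p \notin pre ++ fl (b :: bs) -> linked p (b :: bs) z -> good t ->
  bd (delta A (pre ++ [:: b.1.1; b.1.2; b.2] ++ al bs)) t =
    (t == pre ++ [:: b.1.1; b.1.2] ++ al bs)%:R - (t == pre ++ al (b :: bs))%:R.
Proof.
case: b => [[u v] w] /= U ev Hpre pfl [pu uv vw L] G; set s := pre ++ _.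
have ssub : {subset s <= pre ++ fl ((u, v, w) :: bs)}.
  move=> x; rewrite /s /fl /= -/(fl bs) !(mem_cat, inE) => /orP [->//|/or4P [] H]; rewrite ?H ?orbT //.
  by rewrite (al_sub H) !orbT.
have Us : uniq s.
  have U' : uniq ((pre ++ [:: u; v; w]) ++ fl bs) by rewrite -catA.
  by have := uniq_al U'; rewrite -catA.
have Ev : s = (pre ++ [:: u]) ++ v :: w :: al bs by rewrite /s -catA.
have Ew : s = (pre ++ [:: u; v]) ++ w :: al bs by rewrite /s -catA.
have vw' : v != w.
  by move: Us; rewrite Ev uniq_catC /= !inE negb_or => /andP [/andP [/negP H _] _]; apply/eqP => E; apply: H; rewrite E.
have dvw : (pre ++ [:: u; v] ++ al bs == pre ++ [:: u; w] ++ al bs) = false.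
  apply/negbTE; rewrite eqseq_cat // eqxx /= eqseq_cons eqxx eqseq_cons (negbTE vw') //.
case: (eqVneq t (pre ++ al ((u, v, w) :: bs))) => [->|tv].
  rewrite /al /= -/(al bs) [in RHS]eq_sym dvw sub0r Ev.
  rewrite (_ : pre ++ [:: u, w & al bs] = (pre ++ [:: u]) ++ w :: al bs); last by rewrite -catA.
  rewrite bd_delta_del -?Ev // size_cat /= addn1 exprS -signr_odd (negbTE ev) expr0 mulr1 //.
case: (eqVneq t (pre ++ [:: u, v & al bs])) => [->|tw].
  rewrite subr0 Ew (_ : pre ++ [:: u, v & al bs] = (pre ++ [:: u; v]) ++ al bs); last by rewrite -catA.
  by rewrite bd_delta_del -?Ew // size_cat /= addn2 !exprS -signr_odd (negbTE ev) expr0 mulr1 mulrNN mulr1.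
rewrite subr0; apply/eqP; apply: contraT => /bd_neq0 [t1 [x [t2 [Et /delta_neq0 Es]]]].
have xs : x \in s by rewrite -Es mem_cat mem_head orbT.
have Ut : uniq (t1 ++ x :: t2) by rewrite Es.
have xv : x != v.
  apply: contraNneq tv => xv; rewrite Et; apply/eqP.
  by rewrite xv in Es Ut; rewrite (del_inj Ut (etrans Es Ev)) -catA.
have xw : x != w.
  apply: contraNneq tw => xw; rewrite Et; apply/eqP.
  by rewrite xw in Es Ut; rewrite (del_inj Ut (etrans Es Ew)) -catA.
exfalso; apply: (@locked_not_good t1 x t2) => //; last by rewrite -Et.
rewrite Es; move: (xs); rewrite {1}/s !mem_cat !inE (negbTE xv) (negbTE xw) /=.
case/or3P => [/Hpre [y ys H]|/eqP ->|xal].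
- by exists y => //; apply: contra ys; apply: ssub.
- by exists p; [apply: contra pfl; apply: ssub | right].
- have Ufl : uniq (fl bs).
    by move: U; rewrite /fl /= -/(fl bs) cat_uniq => /and3P [_ _] /and4P [].
  have [y /andP [y1 y2] H] := al_locked L Ufl xal; exists y => //.
  rewrite /s !mem_cat !negb_or y2 andbT.
  move: U; rewrite /fl /= -/(fl bs) (_ : _ ++ _ = (pre ++ [:: u; v; w]) ++ fl bs); last by rewrite -catA.
  rewrite cat_uniq => /and3P [_ /hasPn /(_ y y1) H1 _]; move: H1.
  by rewrite /= mem_cat !inE !negb_or.
Qed.

(** Telescoping: the omitted last letter of a finished block plays the part of [p] for the next
    one. *)
Lemma bd_omega pre p bs z t : uniq (pre ++ fl bs) -> ~~ odd (size pre) ->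
  (forall x, x \in pre -> locked (pre ++ fl bs) x) ->
  p \notin pre ++ fl bs -> linked p bs z -> good t ->
  bd (omega pre bs) t = (t == pre ++ be bs)%:R - (t == pre ++ al bs)%:R.
Proof.
elim: bs pre p => [|b bs IH] pre p U ev Hpre pfl L G; first by rewrite bd0 subrr.
rewrite [omega _ _]/= bdD (bd_block U ev Hpre pfl L G).
have Efl : pre ++ fl (b :: bs) = (pre ++ [:: b.1.1; b.1.2]) ++ b.2 :: fl bs by rewrite -catA.
have sub : {subset (pre ++ [:: b.1.1; b.1.2]) ++ fl bs <= pre ++ fl (b :: bs)}.
  by rewrite Efl; apply: sub_cat_cons.
have [w_n U'] : b.2 \notin (pre ++ [:: b.1.1; b.1.2]) ++ fl bs /\ uniq ((pre ++ [:: b.1.1; b.1.2]) ++ fl bs).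
  move: U; rewrite Efl uniq_catC /= => /andP [h1 h2]; split; last by rewrite uniq_catC.
  by rewrite mem_cat orbC -mem_cat.
have [pu uv vw L'] := L.
rewrite (IH _ b.2) //.
- rewrite -!catA addrC addrA [X in X - _](_ : _ = (t == pre ++ [:: b.1.1, b.1.2 & be bs])%:R) //.
  by rewrite subrK.
- by rewrite size_cat /= addn2 /= negbK.
- move=> x; rewrite mem_cat => /orP [/Hpre [y ys H]|].
    by exists y => //; apply: contra ys; apply: sub.
  rewrite !inE => /orP [] /eqP ->.
    by exists p; [apply: contra pfl; apply: sub | right].
  by exists b.2 => //; left.
Qed.

Fixpoint fold_w bs x : T := if bs is b :: bs' then if x == b.2 then b.1.2 else fold_w bs' x else x.

Lemma fold_w_id bs x : (forall b, b \in bs -> x != b.2) -> fold_w bs x = x.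
Proof.
elim: bs => //= b bs IH H; rewrite (negbTE (H b (mem_head _ _))) IH // => b' b'bs.
by apply: H; rewrite inE b'bs orbT.
Qed.

Lemma fold_w_cases bs x : fold_w bs x = x \/ fold_w bs x \in fl bs.
Proof.
elim: bs => [|b bs IH] /=; first by left.
case: eqP => _; first by right; rewrite /fl /= !inE eqxx orbT.
by case: IH => [->|H]; [left | right; rewrite /fl /= !inE -/(fl bs) H !orbT].
Qed.

Lemma mem_fl b bs : b \in bs -> [/\ b.1.1 \in fl bs, b.1.2 \in fl bs & b.2 \in fl bs].
Proof. by move=> bbs; split; apply/flatten_mapP; exists b; rewrite // !inE eqxx ?orbT. Qed.

Lemma fold_w_inv bs b x : uniq (fl bs) -> b \in bs ->
  (fold_w bs x = b.1.1 -> x = b.1.1) /\ (fold_w bs x = b.1.2 -> x = b.1.2 \/ x = b.2).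
Proof.
elim: bs => // b0 bs IH; rewrite /fl /= -/(fl bs) !inE !negb_or.
move=> /and4P [/and3P [h1 h2 h3] /andP [h4 h5] h6 U] /orP [/eqP ->|bbs].
  case: eqP => [->|_]; first by split=> [E|]; [rewrite E eqxx in h1 | right].
  by case: (fold_w_cases bs x) => [->|H]; [split=> // ->; left | split=> E; move: H; rewrite E ?(negbTE h3) ?(negbTE h5)].
have [b1 b2 _] := mem_fl bbs.
case: eqP => [_|_]; last exact: IH.
by split=> E; move: h5; rewrite E ?b1 ?b2.
Qed.

Lemma fold_w_be bs x : uniq (fl bs) -> x \in fl bs -> fold_w bs x \in be bs.
Proof.
elim: bs => // b bs IH; rewrite /fl /be /= -/(fl bs) -/(be bs) !inE !negb_or.
move=> /and4P [/and3P [h1 h2 h3] /andP [h4 h5] h6 U].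
have nid y : y \notin fl bs -> fold_w bs y = y.
  by move=> ys; apply: fold_w_id => b' /mem_fl [_ _ b'2]; apply: contraNneq ys => ->.
case/or4P => [/eqP ->|/eqP ->|/eqP ->|xf].
- by rewrite (negbTE h2) nid // eqxx.
- by rewrite (negbTE h4) nid // eqxx orbT.
- by rewrite !eqxx orbT.
- have -> : (x == b.2) = false by apply/negbTE; apply: contraNneq h6 => <-.
  by rewrite IH ?orbT.
Qed.

Lemma map_fold_w bs : uniq (fl bs) -> map (fold_w bs) (al bs) = be bs.
Proof.
elim: bs => // b bs IH; rewrite /fl /al /be [map _ (flatten _)]/= -/(fl bs) -/(al bs) -/(be bs) /=.
rewrite !inE !negb_or eqxx => /and4P [/and3P [h1 h2 h3] /andP [h4 h5] h6 U].
rewrite (negbTE h2) fold_w_id => [|b' /mem_fl [_ _ b'2]]; last by apply: contraNneq h3 => ->.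
congr [:: _, _ & _]; rewrite -[RHS](IH U); apply/eq_in_map => x /al_sub xf.
by have -> : (x == b.2) = false by apply/negbTE; apply: contraNneq h6 => <-.
Qed.

Lemma linked_good p bs z t : linked p bs z -> z \in t ->
  (forall b, b \in bs -> (b.1.1 \in t) /\ (b.1.2 \in t) || (b.2 \in t)) ->
  forall y, y \in p :: fl bs -> (y \in t) || (nxt y \in t).
Proof.
elim: bs p => [|b bs IH] p; first by move=> /= pz zt _ y; rewrite inE => /eqP ->; rewrite pz zt orbT.
move=> [pu uv vw L] zt H y; have [ut vt] := H b (mem_head _ _).
rewrite /fl /= -/(fl bs) in_cons in_cons in_cons => /or4P [/eqP ->|/eqP ->|/eqP ->|].
- by rewrite pu ut orbT.
- by rewrite ut.
- by rewrite vw.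
- by apply: IH => // b' b'bs; apply: H; rewrite inE b'bs orbT.
Qed.

Lemma omega_sub pre bs t : omega pre bs t != 0 -> {subset t <= pre ++ fl bs}.
Proof.
elim: bs pre => [|b bs IH] pre /=; first by rewrite eqxx.
case: (eqVneq (omega (pre ++ [:: b.1.1; b.1.2]) bs t) 0) => [->|/IH H _]; last first.
  move=> x /H; rewrite /fl /= !mem_cat !inE -orbA => /orP [->//|/orP [/orP [] ->|->]]; by rewrite ?orbT.
rewrite addr0 => /delta_neq0 ->; rewrite /fl /= -/(fl bs).
move=> x; rewrite !mem_cat !inE.
by move=> /orP [->//|/or4P [->|->|->|/al_sub ->]]; rewrite ?orbT.
Qed.

Variables (bs : seq block) (z : T).
Hypotheses (Ubs : uniq (rcons (fl bs) z)) (Lbs : linked z bs z) (bs0 : bs != [::]).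
Hypothesis (bsT : forall x, x \in rcons (fl bs) z).
Local Notation js := (rcons (be bs) z).
Local Notation f := (fold_w bs).
Local Notation w := (fun t => delta A (rcons (al bs) z) t + omega [::] bs t).

Let zfl : z \notin fl bs. Proof. by move: Ubs; rewrite rcons_uniq => /andP []. Qed.
Let Ufl : uniq (fl bs). Proof. by move: Ubs; rewrite rcons_uniq => /andP []. Qed.

Let fz : f z = z.
Proof. by apply: fold_w_id => b /mem_fl [_ _ b2]; apply: contraNneq zfl => ->. Qed.

Let map_f : map f (rcons (al bs) z) = js.
Proof. by rewrite map_rcons map_fold_w // fz. Qed.

Lemma uniq_be cs : uniq (fl cs) -> uniq (be cs).
Proof.
elim: cs => // b cs IH; rewrite /fl /be /= -/(fl cs) -/(be cs) !inE !negb_or.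
move=> /and4P [/and3P [h1 h2 h3] /andP [h4 h5] h6 /IH ->]; rewrite h1 andbT /=.
by apply/andP; split; [apply: contra h3 | apply: contra h5]; apply: be_sub.
Qed.

Lemma exc_uniq : uniq js.
Proof. by rewrite rcons_uniq uniq_be // andbT; apply: contra zfl; apply: be_sub. Qed.

Lemma exc_mem x : f x \in js.
Proof.
have := bsT x; rewrite !mem_rcons !inE => /orP [/eqP ->|xf]; first by rewrite fz eqxx.
by rewrite fold_w_be ?orbT.
Qed.

Lemma size_be cs : size (be cs) = (size cs).*2.
Proof. by elim: cs => // b cs IH; rewrite /be /= -/(be cs) IH doubleS. Qed.

Lemma size_al cs : size (al cs) = (size cs).*2.
Proof. by elim: cs => // b cs IH; rewrite /al /= -/(al cs) IH doubleS. Qed.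

Lemma exc_size : size js = (size bs).*2.+1.
Proof. by rewrite size_rcons size_be. Qed.

(** Such a [t] contains [z], the first letter of every block and one of the other two, hence an end
    of each edge. *)
Lemma exc_good t : {subset js <= map f t} -> good t.
Proof.
move=> H y; apply: (linked_good Lbs).
- have /mapP [x xt fx] : z \in map f t by apply: (H z); rewrite mem_rcons mem_head.
  case: (fold_w_cases bs x) => E; first by rewrite fx E.
  by move: zfl; rewrite fx E.
- move=> b bbs; have inv x := fold_w_inv x Ufl bbs; split.
    have /mapP [x xt fx] : b.1.1 \in map f t.
      apply: (H b.1.1); rewrite mem_rcons inE; apply/orP; right.
      by apply/flatten_mapP; exists b; rewrite // mem_head.
    by rewrite -(proj1 (inv x) (esym fx)).
  have /mapP [x xt fx] : b.1.2 \in map f t.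
    apply: (H b.1.2); rewrite mem_rcons inE; apply/orP; right.
    by apply/flatten_mapP; exists b; rewrite // !inE eqxx orbT.
  by case: (proj2 (inv x) (esym fx)) => <-; rewrite xt ?orbT.
- by rewrite -mem_rcons.
Qed.

(** The simplices of [omega] avoid [z], so only the first summand contributes. *)
Lemma exc_pairing : pairing (size js) (topc A f js) w = 1.
Proof.
rewrite pairingDr pairing_delta; last by rewrite !size_rcons size_be size_al.
rewrite -{1}map_f topc_id ?map_f ?exc_uniq // -[RHS]addr0; congr (_ + _).
refine (@pairing_ind T A (fun y => y = 0) _ _ _ _ _ _) => [//|x y -> ->|t _]; first by rewrite addr0.
case: (eqVneq (omega [::] bs t) 0) => [->|/omega_sub Ht]; first by rewrite mulr0.
rewrite (@topc_miss _ _ _ _ _ _ z) ?mul0r ?mem_rcons ?mem_head //.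
apply/mapP => - [x /Ht xf zx]; case: (fold_w_cases bs x) => E; move: zfl; rewrite zx E //.
by rewrite /= in xf; rewrite xf.
Qed.

(** The only good facet of the first simplex is [al bs], which cancels one end of the telescoped
    sum. The other end, [be bs], is not good: it misses both [z] and the letter before it. *)
Lemma exc_bd t : good t -> bd w t = 0.
Proof.
move=> G; rewrite bdD (bd_omega (p := z) (z := z)) //=.
have Ual : uniq (rcons (al bs) z).
  rewrite rcons_uniq (uniq_al (pre := [::])) // andbT.
  by apply: contra zfl; apply: al_sub.
have -> : (t == be bs) = false.
  apply/negP => /eqP Et; have [y /andP [y1 y2] yz] := be_last_locked Lbs Ufl bs0.
  have := G y; rewrite Et (negbTE y2) yz /=.
  by move=> /be_sub; rewrite (negbTE zfl).
case: (eqVneq t (al bs)) => [->|tal].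
  rewrite -{2}[al bs]cats0 -cats1 bd_delta_del ?cats1 // size_al -signr_odd odd_double.
  by rewrite /= expr0 sub0r subrr.
rewrite subrr addr0; apply/eqP; apply: contraT => /bd_neq0 [t1 [x [t2 [Et /delta_neq0 Es]]]].
have Ut : uniq (t1 ++ x :: t2) by rewrite Es.
have xz : x != z.
  apply: contraNneq tal => xz; rewrite Et; apply/eqP.
  rewrite xz -cats1 in Es Ut; by rewrite (del_inj Ut Es) cats0.
exfalso; apply: (@locked_not_good t1 x t2) => //; last by rewrite -Et.
have : x \in t1 ++ x :: t2 by rewrite mem_cat mem_head orbT.
rewrite Es mem_rcons inE (negbTE xz) /= => xal.
have [y /andP [y1 y2] H] := al_locked Lbs Ufl xal; exists y => //.
rewrite mem_rcons inE negb_or y2 andbT.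
by apply: contraNneq zfl => <-.
Qed.

End Exceptional.

(** * Cyclic words *)

Section CyclicLists.
Variables (T : finType).
Implicit Types (s : seq T).

Lemma infix3_next u i w z s : uniq (z :: s) -> infix3 u i w (z :: rcons s z) ->
  next (z :: s) u = i /\ next (z :: s) i = w.
Proof.
move=> U [s1 [s2 E]]; have := cycle_next U; rewrite /cycle; move: (next _) => nx.
move: E; case: s1 => [|b s1] /=; first by move=> [-> ->] /= /and3P [/eqP -> /eqP -> _].
by move=> [_ ->]; rewrite cat_path /= => /andP [_ /and4P [_ /eqP -> /eqP -> _]].
Qed.

Lemma sorted_next (e : rel T) s s1 y z s2 : sorted e s -> s = s1 ++ [:: y, z & s2] -> e y z.
Proof.
move=> + E; rewrite {}E; case: s1 => [|b s1] /=; first by case/andP.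
by rewrite cat_path /= => /and3P [_ _ /andP []].
Qed.

Lemma greedy_setT (m : seq T) : greedy setT m = ((size m + 2) %/ 3)%N.
Proof.
have [N] := ubnP (size m); elim: N m => // N IH m; rewrite ltnS => sz.
case: m sz => [|x [|x' [|x'' m]]] sz; rewrite ?greedy_drop ?inE ?drop2_cons //.
by rewrite IH; move: sz => /=; lia.
Qed.

Lemma split_blocks k s : size s = (3 * k).+1 -> exists bs z, s = rcons (fl bs) z /\ size bs = k.
Proof.
elim: k s => [|k IH] s; first by case: s => [|z [|? ?]] // _; exists [::], z.
case: s => [|u [|v [|w s]]]; rewrite ?mulnS //= => - [/IH [bs [z [-> Eb]]]].
by exists ((u, v, w) :: bs), z; split=> //=; rewrite Eb.
Qed.

Lemma path_linked (nxt : T -> T) p bs z : path (frel nxt) p (rcons (fl bs) z) -> linked nxt p bs z.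
Proof.
elim: bs p => [|[[u v] w] bs IH] p /=; first by case/andP => /eqP.
by case/and4P => /eqP -> /eqP -> /eqP -> /IH.
Qed.

End CyclicLists.

Lemma in_spair mu j (k : 'I_mu) : (k \in spair mu j) = (nat_of_ord k == j) || (nat_of_ord k == j.+1).
Proof. by rewrite inE. Qed.

Lemma in_cpair mu (k : 'I_mu) : (k \in cpair mu) = (nat_of_ord k == mu.-1) || (nat_of_ord k == 0%N).
Proof. by rewrite inE. Qed.

(** * Cycle hypergraphs *)

Section Cycle.
Variables (K : fieldType) (n mu : nat) (g : 'I_mu -> {set 'I_n}).
Hypothesis Hcyc : is_cycle (hyp_of g).
Local Notation R := {mpoly K[n]}.
Local Notation T := 'I_mu.

Definition nxt (j : T) : T := next (enum T) j.

Lemma mu_ge3 : (3 <= mu)%N. Proof. by case: Hcyc. Qed.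

Lemma val_nxt (j : T) : val (nxt j) = if (j.+1 < mu)%N then j.+1 else 0%N.
Proof.
have m0 : (0 < mu)%N by apply: leq_trans mu_ge3.
pose o := Ordinal m0.
have cyc : cycle (fun i k : T => val k == if (i.+1 < mu)%N then i.+1 else 0%N) (enum T).
  case E : (enum T) => [|x p] //=.
  have szp : (size p).+1 = mu by have := size_enum_ord mu; rewrite E.
  have nthE i : (i < mu)%N -> nth o (x :: p) i = i :> nat by move=> im; rewrite -E nth_enum_ord.
  apply/(pathP o) => i; rewrite size_rcons szp => im.
  have h1 : nth o (x :: rcons p x) i = i :> nat.
    by rewrite -rcons_cons nth_rcons /= szp im nthE.
  have h2 : nth o (rcons p x) i = (if (i.+1 < mu)%N then i.+1 else 0%N) :> nat.
    rewrite nth_rcons; case: (ltngtP i (size p)) => ip.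
    - have im2 : (i.+1 < mu)%N by rewrite -szp ltnS.
      by rewrite im2 -(nthE _ im2).
    - have : (i < (size p).+1)%N by rewrite szp.
      by rewrite ltnS leqNgt ip.
    - by rewrite ip szp ltnn; apply: (nthE 0%N m0).
  by rewrite /= h1 h2.
by rewrite (eqP (next_cycle cyc (mem_enum _ j))).
Qed.

Lemma hypP (F : {set T}) : reflect (exists2 v, (exists j, v \in g j) & F = [set j | v \in g j]) (F \in hyp_of g).
Proof.
apply: (iffP imsetP) => [[v]|[v [j vj] ->]]; first by rewrite inE => /existsP ? ->; exists v.
by exists v => //; rewrite inE; apply/existsP; exists j.
Qed.

Lemma edge_var (y : T) : exists v, forall k, (v \in g k) = (k == y) || (k == nxt y).
Proof.
have [_ [Ht [[Hs _] E]]] := Hcyc.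
have vn := val_nxt y.
have : [set k : T | (k == y) || (k == nxt y)] \in hyp_of g.
  rewrite E inE; move: vn; case: ltnP => ym vn.
    suff -> : [set k | (k == y) || (k == nxt y)] = spair mu y by rewrite Hs.
    by apply/setP => k; rewrite !inE -!val_eqE vn.
  suff -> : [set k | (k == y) || (k == nxt y)] = cpair mu by rewrite in_set1 eqxx orbT.
  apply/setP => k; rewrite !inE -!val_eqE vn; congr ((_ == _) || _).
  by have := ltn_ord y; have := mu_ge3; move: ym => /=; lia.
move=> /hypP [v _ /setP Ev]; exists v => k; by have := Ev k; rewrite !inE.
Qed.

Definition opens : {set T} := [set j | [set j] \notin hyp_of g].

Lemma closed_var (j : T) : j \notin opens -> exists v, forall k, (v \in g k) = (k == j).
Proof.
rewrite inE negbK => /hypP [v _ /setP Ev]; exists v => k; by have := Ev k; rewrite !inE.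
Qed.

Lemma nxt_inj : injective nxt.
Proof.
move=> i j E; apply: val_inj; have := congr1 val E; rewrite !val_nxt.
have := ltn_ord i; have := ltn_ord j; rewrite /=; case: ifP; case: ifP; lia.
Qed.

(** The face of a variable dividing an open generator is not a singleton, so it is one of the two
    edges at [i]. *)
Lemma open_sub (y i z : T) : nxt y = i -> nxt i = z -> i \in opens -> g i \subset g y :|: g z.
Proof.
move=> yi iz; rewrite inE => iO; apply/subsetP => v vi; rewrite inE.
have [_ [Ht [[_ Hs] E]]] := Hcyc.
have HF : [set k | v \in g k] \in hyp_of g by apply/hypP; exists v => //; exists i.
have iF : i \in [set k | v \in g k] by rewrite inE.
have yv := val_nxt y; have iv := val_nxt i; rewrite yi in yv; rewrite iz in iv.
have vF (k : T) : k \in [set k | v \in g k] = (v \in g k) by rewrite inE.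
rewrite -!vF; move: HF iF; rewrite {1}E inE in_set1 => /orP [/Hs [/eqP/cards1P [k EF]|[j [jm ->]]]|/eqP ->].
- rewrite EF inE => /eqP ik; case/negP: iO; rewrite ik -EF.
  by apply/hypP; exists v => //; exists i.
- rewrite !in_spair => H; apply/orP; move: yv iv (ltn_ord y) (ltn_ord i) H; rewrite /=.
  case: ltnP => h1; case: ltnP => h2 e1 e2 h3 h4 /orP [] /eqP h5;
    first [by left; apply/orP; left; apply/eqP; lia | by right; apply/orP; right; apply/eqP; lia | lia].
- rewrite !in_cpair => H; apply/orP; have m3 := mu_ge3; move: yv iv (ltn_ord y) (ltn_ord i) H; rewrite /=.
  case: ltnP => h1; case: ltnP => h2 e1 e2 h3 h4 /orP [] /eqP h5;
    first [by left; apply/orP; left; apply/eqP; lia | by right; apply/orP; right; apply/eqP; lia | lia].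
Qed.

Lemma rotation (a : T) : exists x l y,
  [/\ uniq (a :: x :: rcons l y), forall j, j \in a :: x :: rcons l y,
      next (a :: x :: rcons l y) =1 nxt & size (a :: x :: rcons l y) = mu].
Proof.
have [i s E] := rot_to (mem_enum T a).
have sz : size (a :: s) = mu by rewrite -E size_rot size_enum_ord.
have := mu_ge3; rewrite -[X in (_ <= X)%N]sz; case: s E sz => [|x s] // E sz.
case/lastP: s E sz => // l y E sz _; exists x, l, y; split=> //.
- by rewrite -E rot_uniq enum_uniq.
- by move=> j; rewrite -E mem_rot mem_enum.
- by move=> j; rewrite -E next_rot ?enum_uniq.
Qed.

Section AtVertex.
Variables (a x : T) (l : seq T) (y : T).
Hypothesis Uc : uniq (a :: x :: rcons l y).
Hypothesis cT : forall j, j \in a :: x :: rcons l y.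
Hypothesis cnxt : next (a :: x :: rcons l y) =1 nxt.
Hypothesis csz : size (a :: x :: rcons l y) = mu.

Let t := minn (greedy opens (x :: rcons l y)) (greedy opens l).+1.

Lemma ara_upper : exists qs : seq R,
  [/\ size qs = (mu - t)%N, all (@at_most_trinomial K n) qs & same_rad qs (gens_list K g)].
Proof.
have [z [v [m [U' mem' nx' [rows [szr r3 rsub rsys]]]]]] := saves_cycle opens Uc.
exists [seq row_poly K g r | r <- rows]; split.
- rewrite size_map -(addnK t (size rows)) szr; congr (_ - _)%N.
  rewrite -[RHS]card_ord; apply: eq_card => j; rewrite -[RHS](cT j) -mem' -rcons_cons.
  by rewrite !inE mem_rcons !inE; do !case: (_ == _).
- by rewrite all_map; apply: sub_all r3 => r; apply: msupp_row_poly.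
- move=> f; split; apply: in_rad_sub => h /mapP [].
    move=> r _ ->; apply: ideal_rad; apply: in_ideal_sum => j _; apply: mem_in_ideal.
    by apply: map_f; rewrite mem_enum.
  move=> j _ ->; apply: (row_system_rad K _ rsys) => [s1 u i w s2 E iO|].
    have [] := @infix3_next T u i w z (v :: m) U'; first by exists s1, s2.
    by rewrite !nx' !cnxt => ui iw; apply: open_sub ui iw iO.
  by have := cT j; rewrite -mem' -rcons_cons => jc; move: jc; rewrite !inE mem_rcons !inE => /or3P [] ->; rewrite ?orbT.
Qed.

Lemma pd_upper_cycle : pd_le (in_ideal (gens_list K g)) (mu - t).
Proof.
have Hopen u i w : infix3 u i w (a :: x :: rcons (rcons l y) a) -> i \in opens -> g i \subset g u :|: g w.
  move=> Hi iO; have [] := @infix3_next T u i w a (x :: rcons l y) Uc Hi.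
  by rewrite !cnxt => ui iw; apply: open_sub ui iw iO.
have := pd_upper K Uc Hopen; rewrite csz -/t; apply: pd_le_ext => f.
rewrite /mon_ideal -map_comp; split; apply: in_ideal_subset => h /mapP [j _ ->].
  by apply: (map_f (fun k => sqf_mon K (g k))); rewrite mem_enum.
exact: (map_f (fun k => sqf_mon K (g k)) (cT j)).
Qed.

Lemma lower_suffices :
  (forall qs : seq R, same_rad qs (gens_list K g) -> (mu - t <= size qs)%N) ->
  (forall r D, free_res (gens_list K g) (r := r) D ->
     forall q, (forall i, (q < i)%N -> r i = 0%N) -> (mu - t <= q)%N) ->
  exists p, [/\ is_pd (gens_list K g) p, is_ara (gens_list K g) p & is_triara (gens_list K g) p].
Proof.
move=> Hara Hpd; exists (mu - t)%N; have [qs [sz tri rad]] := ara_upper.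
have [r [D [resD rq]]] := pd_upper_cycle.
split; split; [by exists r, D | exact: Hpd | by exists qs | exact: Hara | by exists qs |].
by move=> qs' _; apply: Hara.
Qed.

Lemma path_edges s : cycle (frel nxt) s -> has_edges g s.
Proof.
move=> cyc s1 u w s2 E; have srt : sorted (frel nxt) s.
  by case: (s) cyc => //= b s'; rewrite rcons_path => /andP [].
by have /eqP <- := sorted_next srt E; apply: edge_var.
Qed.

Lemma cycle_c : cycle (frel nxt) (a :: x :: rcons l y).
Proof.
apply: sub_cycle (cycle_next Uc) => u w /eqP <-; apply/eqP; exact/esym/cnxt.
Qed.

Lemma lower_prime s ps : (forall j, j \in s) -> prime_data g s ps -> (size ps + t = mu)%N ->
  exists p, [/\ is_pd (gens_list K g) p, is_ara (gens_list K g) p & is_triara (gens_list K g) p].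
Proof.
move=> sT Hps sz; have szE : (mu - t)%N = size ps by rewrite -[X in (X - _)%N]sz addnK.
have ps0 : ps != [::].
  by have [_ _ _ _ /(_ a (sT a)) [p]] := Hps; case: (ps).
apply: lower_suffices; rewrite szE.
  exact: (prime_ara_lower sT Hps ps0).
move=> r D; exact: (prime_pd_lower sT Hps ps0).
Qed.

Lemma case_triple_end : t = (greedy opens l).+1 ->
  exists p, [/\ is_pd (gens_list K g) p, is_ara (gens_list K g) p & is_triara (gens_list K g) p].
Proof.
move=> Et.
have E : l ++ [:: y; a; x] = rot 2 (a :: x :: rcons l y).
  by rewrite /rot /= drop0 take0 cat_rcons.
have [||ps [Hps sz]] := @prime_data_triple_end n T g opens closed_var l y a x.
- by rewrite E rot_uniq.
- by rewrite E; apply: path_edges; rewrite rot_cycle cycle_c.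
apply: (lower_prime _ Hps); first by move=> j; rewrite E mem_rot.
by rewrite Et sz -[RHS]csz /= size_rcons addn3.
Qed.

(** Whichever term attains the minimum, a prime matches it: G(x l y) the one ending in the closed
    [a], G(l) + 1 the one ending in [y], [a], [x]. *)
Lemma case_closed : a \notin opens ->
  exists p, [/\ is_pd (gens_list K g) p, is_ara (gens_list K g) p & is_triara (gens_list K g) p].
Proof.
move=> aO; have [tE|tE] : t = greedy opens (x :: rcons l y) \/ t = (greedy opens l).+1.
- by rewrite /t /minn; case: ifP; [left | right].
- have E : rcons (x :: rcons l y) a = rot 1 (a :: x :: rcons l y) by rewrite rot1_cons.
  have [||ps [Hps sz]] := @prime_data_closed_end n T g opens closed_var (x :: rcons l y) a aO.
  + by rewrite E rot_uniq.
  + by rewrite E; apply: path_edges; rewrite rot_cycle cycle_c.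
  apply: (lower_prime _ Hps); first by move=> j; rewrite E mem_rot.
  by rewrite tE sz E size_rot.
- exact: case_triple_end.
Qed.

Lemma case_exceptional k : opens = setT -> mu = (3 * k).+1 ->
  exists p, [/\ is_pd (gens_list K g) p, is_ara (gens_list K g) p & is_triara (gens_list K g) p].
Proof.
(* With all letters open, G is the length divided by 3, rounded up; the words x l y and l have 3k
   and 3k - 2 letters. *)
move=> allO muk; have tk : t = k.
  have sz2 : (size l).+3 = (3 * k).+1 by rewrite -muk -[RHS]csz /= size_rcons.
  rewrite /t allO !greedy_setT /= size_rcons /minn; clear -sz2.
  by case: ifP; lia.
have [bs [z [E szbs]]] := split_blocks (etrans csz muk).
have Ubs : uniq (rcons (fl bs) z) by rewrite -E.
have bsT j : j \in rcons (fl bs) z by rewrite -E.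
have Lbs : linked nxt z bs z.
  apply: path_linked; have := cycle_c.
  by rewrite E -rot1_cons rot_cycle rot1_cons.
have bs0 : bs != [::].
  rewrite -size_eq0 szbs; have := mu_ge3; by rewrite muk; case: (k).
have szjs : size (rcons (be bs) z) = (mu - t)%N.
  by rewrite exc_size szbs tk muk; lia.
have /fin_all_exists [ev Hev] := edge_var.
have Hgood t' : good nxt t' -> forall j, exists2 i, i \in t' & ev i \in g j.
  move=> G j; have [i ij] : exists i, nxt i = j.
    by exists (finv nxt j); apply: f_finv nxt_inj j.
  have /orP [it|jt] := G i; first by exists i; rewrite // Hev ij eqxx orbT.
  by exists j; rewrite ?Hev ?eqxx // -ij.
apply: lower_suffices; rewrite -szjs.
- apply: (@ara_lower K n T g [set ev j | j : T] T (fold_w bs) _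
    (fun t' => delta R (rcons (al bs) z) t' + omega R [::] bs t')).
  + exact: exc_uniq.
  + by move=> j; apply: exc_mem.
  + by case: (be bs).
  + move=> t' /(@exc_good _ nxt _ _ Ubs Lbs bsT t') G; apply/subsetP => _ /imsetP [j _ ->].
    by apply/bigcupP; have /orP [jt|jt] := G j; [exists j | exists (nxt j)]; rewrite // Hev eqxx ?orbT.
  + exact: exc_pairing.
  + move=> t' _ /subsetP Hc; apply: (exc_bd _ Ubs Lbs bs0) => j.
    have /bigcupP [i it] : ev j \in \bigcup_(i in t') g i by apply: Hc; apply: imset_f.
    by rewrite Hev => /orP [] /eqP <-; rewrite it ?orbT.
- move=> r D resD q rq.
  have {}resD : free_res [seq sqf_mon K A | A <- [seq g j | j <- enum T]] D by rewrite -map_comp.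
  apply: (@pd_lower K n _ T ev T (fold_w bs) _
    (fun t' => delta R (rcons (al bs) z) t' + omega R [::] bs t') _ _ _ _ _ r D resD q rq).
  + exact: exc_uniq.
  + by move=> j; apply: exc_mem.
  + move=> t' /(@exc_good _ nxt _ _ Ubs Lbs bsT t') G _ /mapP [j _ ->].
    have [i it ij] := Hgood t' G j; apply/pred0Pn; exists (ev i); rewrite /= ij /=.
    exact: imset_f.
  + exact: exc_pairing.
  + move=> t' _ Hc; apply: (exc_bd _ Ubs Lbs bs0) => j.
    have /pred0Pn [v /andP [/= vg /imsetP [i it Ev]]] := Hc (g (nxt j)) (map_f _ (mem_enum _ _)).
    move: vg; rewrite Ev Hev => /orP [/eqP ->|/eqP /nxt_inj ->]; by rewrite it ?orbT.
Qed.

End AtVertex.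

End Cycle.

Theorem theorem4p1 (K : fieldType) (n mu : nat) (g : 'I_mu -> {set 'I_n}) :
  minimal_sqf_gens g -> is_cycle (hyp_of g) ->
  exists p : nat,
    [/\ is_pd (gens_list K g) p, is_ara (gens_list K g) p
      & is_triara (gens_list K g) p].
Proof.
move=> _ Hcyc; case: (pickP (fun a => a \notin opens g)) => [a aO|allO].
  have [x [l [y [U cT cn sz]]]] := rotation Hcyc a.
  exact: (case_closed K Hcyc U cT cn sz aO).
have {}allO : opens g = setT.
  by apply/setP => j; rewrite in_setT; apply: negbFE (allO j).
have m0 : (0 < mu)%N by apply: leq_trans (mu_ge3 Hcyc).
have [x [l [y [U cT cn sz]]]] := rotation Hcyc (Ordinal m0).
have [mu1|mu1] := eqVneq (mu %% 3)%N 1%N.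
  by apply: (case_exceptional K Hcyc U cT cn sz allO (k := mu %/ 3)); rewrite {1}(divn_eq mu 3) mu1 addn1 mulnC.
(* For mu not 1 modulo 3, the two terms of the minimum agree. *)
apply: (case_triple_end K Hcyc U cT cn sz).
have sz2 : (size l).+3 = mu by rewrite -[RHS]sz /= size_rcons.
rewrite allO !greedy_setT /= size_rcons /minn; clear -sz2 mu1.
by case: ifP; lia.
Qed.
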